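(* Let $N\ge 2$ and $r\in(0,\infty)$. Let $\{t_n\}_{n=1}^\infty\subset(0,1)$ be any decreasing sequence converging to zero with $\{t_n\}_{n=1}^\infty\in\ell^{r,\infty}(\mathbb{N})$. Set $$s_0=\min\left\{\frac{r}{r+1},\ \frac12\right\}.$$ Then for every $s>s_0$ there is a constant $C$, not depending on $f$, such that $$\Bigl\|\sup_{n\in\mathbb{N}}|e^{it_nL}f|\Bigr\|_{L^2(B(0,1))}\le C\|f\|_{H^s(\mathbb{R}^N)}\qquad\text{for all } f\in H^s(\mathbb{R}^N).$$
   Context: For $t\in\mathbb{R}$, the nonelliptic Schrödinger mean is $e^{itL}f(x)=\int_{\mathbb{R}^N}e^{ix\cdot\xi+it(\xi_1^2-\xi_2^2\pm\cdots\pm\xi_N^2)}\hat f(\xi)\,d\xi$, for any fixed choice of the signs $\pm$ of $\xi_3^2,\dots,\xi_N^2$, with $\hat f$ the Fourier transform of $f$ (normalized so that $t=0$ gives $f$; for $f\in L^2$ the integral is understood as the usual $L^2$ extension). $B(0,1)$ is the unit ball of $\mathbb{R}^N$ centered at the origin. $H^s(\mathbb{R}^N)$ is the usual inhomogeneous $L^2$-based Sobolev space. For $0<r<\infty$, a sequence $\{t_n\}$ belongs to $\ell^{r,\infty}(\mathbb{N})$ if $\sup_{b>0}b^r\,\sharp\{n\in\mathbb{N}:t_n>b\}<\infty$, where $\sharp$ denotes cardinality. *)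

(* Defs.v *)
From HB Require Import structures.
From mathcomp Require Import all_boot all_order all_algebra.
From mathcomp Require Import complex.
From mathcomp Require Import all_classical all_reals all_analysis.

Set Implicit Arguments.
Unset Strict Implicit.
Unset Printing Implicit Defensive.

Import Order.TTheory GRing.Theory Num.Theory.
Import numFieldNormedType.Exports.

Local Open Scope classical_set_scope.
Local Open Scope ring_scope.

(* R^N is the type of N-tuples of reals, with the product of the Borel
   sigma-algebras. *)
Notation Rn R N := (N.-tuple (measurableTypeR R)).

Section lebesgue_measure_tuple.
Context {R : realType} (N : nat).
Variable m : {sigma_finite_measure set (Rn R N) -> \bar R}.

Definition tuple_of_pair (p : measurableTypeR R * Rn R N) : Rn R N.+1 :=
  [the N.+1.-tuple (measurableTypeR R) of p.1 :: p.2].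

Definition lebesgue_tupleS : set (Rn R N.+1) -> \bar R :=
  pushforward (@lebesgue_measure R \x m)%E tuple_of_pair.

Let measurable_tuple_of_pair : measurable_fun setT tuple_of_pair.
Proof. exact: measurable_cons. Qed.

Let tupleS0 : lebesgue_tupleS set0 = 0%E.
Proof. by rewrite /lebesgue_tupleS /pushforward preimage_set0 measure0. Qed.

Let tupleS_ge0 A : (0 <= lebesgue_tupleS A)%E.
Proof. exact: measure_ge0. Qed.

Let tupleS_sigma_additive : semi_sigma_additive lebesgue_tupleS.
Proof.
rewrite /lebesgue_tupleS => F mF tF mUF; rewrite /pushforward preimage_bigcup.
have mpre A : measurable A -> measurable (tuple_of_pair @^-1` A).
  by move=> mA; rewrite -[X in measurable X]setTI; exact: measurable_tuple_of_pair.
apply: measure_semi_sigma_additive.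
- by move=> n; exact: mpre.
- apply/trivIsetP => /= i j _ _ ij; rewrite -preimage_setI.
  by move/trivIsetP : tF => /(_ _ _ _ _ ij) ->//; rewrite preimage_set0.
- by rewrite -preimage_bigcup; exact: mpre.
Qed.

HB.instance Definition _ := isMeasure.Build _ _ _ lebesgue_tupleS
  tupleS0 tupleS_ge0 tupleS_sigma_additive.

Let tupleS_sigma_finite : sigma_finite setT lebesgue_tupleS.
Proof.
have [F TF Foo] : sigma_finite setT (@lebesgue_measure R \x m)%E.
  have /sigma_finiteP[F [TF ndF Foo]] := sigma_finiteT (@lebesgue_measure R).
  have /sigma_finiteP[G [TG ndG Goo]] := sigma_finiteT m.
  exists (fun n => F n `*` G n).
    rewrite -setXTT TF TG predeqE => -[x y]; split.
      move=> [/= [n _ Fnx] [k _ Gky]]; exists (maxn n k) => //; split.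
      - by move: x Fnx; exact/subsetPset/ndF/leq_maxl.
      - by move: y Gky; exact/subsetPset/ndG/leq_maxr.
    by move=> [n _ []/= ? ?]; split; exists n.
  move=> k; have [? ?] := Foo k; have [? ?] := Goo k.
  split; first exact: measurableX.
  by rewrite product_measure1E// lte_mul_pinfty// ge0_fin_numE.
pose g (x : Rn R N.+1) : measurableTypeR R * Rn R N := (thead x, [tuple of behead x]).
have mg : measurable_fun setT g.
  by apply/measurable_fun_pair; [exact: measurable_tnth|exact: measurable_behead].
have gK p : g (tuple_of_pair p) = p.
  by case: p => a b; rewrite /g theadE; congr pair; apply/val_inj.
exists (fun i => g @^-1` F i).
  by rewrite -preimage_bigcup -TF preimage_setT.
move=> i; have [mF Fi] := Foo i; split.
  by rewrite -[X in measurable X]setTI; exact: mg.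
rewrite /lebesgue_tupleS /pushforward.
by rewrite (_ : _ @^-1` _ = F i)//; apply/seteqP; split=> p /=; rewrite gK.
Qed.

HB.instance Definition _ := Measure_isSigmaFinite.Build _ _ _ lebesgue_tupleS
  tupleS_sigma_finite.

End lebesgue_measure_tuple.

(* Lebesgue measure on R^N, as the iterated product measure *)
Fixpoint lebesgueN {R : realType} (N : nat) :
    {sigma_finite_measure set (Rn R N) -> \bar R} :=
  match N with
  | 0%N => [the sigma_finite_measure _ _ of \d_([tuple] : Rn R 0)]
  | N'.+1 => [the sigma_finite_measure _ _ of lebesgue_tupleS (lebesgueN N')]
  end.

Lemma lebesgueN_box {R : realType} (N : nat)
    (A : 'I_N -> set (measurableTypeR R)) :
  (forall i, measurable (A i)) ->
  lebesgueN N [set x | forall i, A i (tnth x i)] =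
  (\prod_(i < N) lebesgue_measure (A i))%E.
Proof.
elim: N A => [|N IH] A mA.
  rewrite big_ord0 /= diracE mem_set//= => -[]//.
rewrite big_ord_recl -IH// /lebesgueN -/lebesgueN /= /lebesgue_tupleS /pushforward.
rewrite -product_measure1E//.
  congr ((_ \x _) _)%E; apply/seteqP; split=> -[a y] /=.
    move=> H; split; first exact: (H ord0).
    by move=> i; have := H (lift ord0 i); rewrite tnthS.
  move=> [Aa Ay] i; have [->//|i0] := eqVneq i ord0.
  have [j ->] : exists j, i = lift ord0 j.
    by case: (unliftP ord0 i) i0 => [j ->|->]; [exists j|rewrite eqxx].
  by rewrite tnthS; exact: Ay.
rewrite (_ : [set x | _] = \bigcap_(i in [set: 'I_N])
   ((fun x : Rn R N => tnth x i) @^-1` A (lift ord0 i))).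
  apply: fin_bigcap_measurable => // i _.
  by rewrite -[X in measurable X]setTI; exact: measurable_tnth.
by apply/seteqP; split=> x /= H i; [move=> _|]; exact: H.
Qed.

Section definitions.
Context {R : realType} {N : nat}.

Local Notation mu := (@lebesgueN R N).
Local Notation normc := ComplexField.Normc.normc.
Implicit Types (x xi : Rn R N) (f g u : Rn R N -> R[i]) (t s : R).

Definition dotp x xi : R := \sum_(j < N) tnth x j * tnth xi j.

Definition sqnorm x : R := \sum_(j < N) tnth x j ^+ 2.

Definition unit_ball : set (Rn R N) := [set x | sqnorm x < 1].

Definition cis (theta : R) : R[i] := Complex (cos theta) (sin theta).

Definition cintegral f : R[i] :=
  Complex (\int[mu]_x complex.Re (f x)) (\int[mu]_x complex.Im (f x)).

Definition cLfun (p : \bar R) f : Prop :=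
  ((fun x => complex.Re (f x)) \in Lfun mu p) /\
  ((fun x => complex.Im (f x)) \in Lfun mu p).

Definition L2norm f : \bar R := Lnorm mu 2%:E (fun x => (normc (f x))%:E).

(* The extension to L^2 of an integral operator T given on L^1 `&` L^2, as the
   closure of its graph: T extends to f with value g when some sequence in
   L^1 `&` L^2 tends to f while its image under T tends to g, both in L^2. *)
Definition is_L2_extension (T : (Rn R N -> R[i]) -> (Rn R N -> R[i])) f g :
    Prop :=
  [/\ cLfun 2%:E f, cLfun 2%:E g &
    exists h : nat -> (Rn R N -> R[i]),
      [/\ forall k, cLfun 1%E (h k) /\ cLfun 2%:E (h k),
        L2norm (fun x => h k x - f x) @[k --> \oo] --> 0%E &
        L2norm (fun x => T (h k) x - g x) @[k --> \oo] --> 0%E]].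

(* For the operators below, Plancherel's theorem provides such a g for every f
   in L^2, unique up to a null set; the default value 0 is only a totalization
   outside L^2. *)
Definition L2_extension (T : (Rn R N -> R[i]) -> (Rn R N -> R[i])) f :
    Rn R N -> R[i] :=
  xget (cst 0) [set g | is_L2_extension T f g].

(* The factor (2 pi)^-N is what makes the inversion formula read
   f x = \int e^(i x . xi) (fourier f xi) dxi. *)
Definition fourier_integral f xi : R[i] :=
  Complex ((2 * pi) ^- N) 0 * cintegral (fun x => cis (- dotp x xi) * f x).

Definition fourier f : Rn R N -> R[i] := L2_extension fourier_integral f.

(* xi_1^2 - xi_2^2 +- ... +- xi_N^2; the first two signs are forced, and
   eps j = true means that xi_(j+1)^2 has a minus sign, for j >= 2. *)
Definition phase (eps : 'I_N -> bool) xi : R :=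
  \sum_(j < N)
    (if j == 0%N :> nat then 1 else if j == 1%N :> nat then -1
     else (-1) ^+ eps j) * tnth xi j ^+ 2.

Definition schrodinger_integral (eps : 'I_N -> bool) t g x : R[i] :=
  cintegral (fun xi => cis (dotp x xi + t * phase eps xi) * g xi).

Definition schrodinger (eps : 'I_N -> bool) t f : Rn R N -> R[i] :=
  L2_extension (schrodinger_integral eps t) (fourier f).

Definition sobolev_norm s f : \bar R :=
  Lnorm mu 2%:E
    (fun xi => ((1 + sqnorm xi) `^ (s / 2) * normc (fourier f xi))%:E).

(* H^s for s >= 0, in which case it is a subspace of L^2 *)
Definition sobolev s f : Prop := cLfun 2%:E f /\ (sobolev_norm s f < +oo)%E.

Definition maximal (u : nat -> (Rn R N -> R[i])) (x : Rn R N) : \bar R :=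
  ereal_sup (range (fun n => (normc (u n x))%:E)).

End definitions.

Definition weak_lr {R : realType} (r : R) (t : nat -> R) : Prop :=
  (ereal_sup [set (b `^ r)%:E * counting [set n | (b < t n)%R]
             | b in [set b : R | (0 < b)%R]] < +oo)%E.

(* Main.v *)
(* Write g for the Fourier transform of f, and cut it into the shells where |xi|
   is about 2^k. Schur's test, applied to one variable at a time, gives two bounds
   for the operator with phase x . xi + t phi(xi) localized to |x| <= 1: at a fixed
   time it is bounded on L^2, and, integrating over 0 < t < 1 and using t instead
   of a variable x_j with |xi_j| about 2^k (so that |d phi / d xi_j| is about 2^k,
   whatever the signs), it gains a factor 2^-k in the squared norm.

   On the k-th shell |phi| <= 4^k, so the value at time t is dominated by the mean
   over [t - 4^-k, t + 4^-k] of the solution for a modified g. Hence the squared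
   supremum over 0 < t < 1 costs 4^k 2^-k = 4^(k/2). Alternatively, the supremum
   over the t_n <= b costs 4^k b by the fixed time bound, and each of the O(b^-r)
   remaining times costs O(1); taking b = 4^(-k/(r+1)) gives 4^(k r/(r+1)). Since
   s exceeds one of the two exponents, a weighted Cauchy-Schwarz inequality sums
   the shells.

   This dominates the truncated integrals by one function D, uniformly in the
   truncation and in n; D then dominates each e^(i t_n L) f almost everywhere,
   since that is an L^2 limit. *)

Require Import Defs.
From HB Require Import structures.
From mathcomp Require Import all_boot all_order all_algebra.
From mathcomp Require Import complex.
From mathcomp Require Import all_classical all_reals all_analysis.
From mathcomp Require Import measurable_realfun ring lra.

Set Implicit Arguments.
Unset Strict Implicit.
Unset Printing Implicit Defensive.

Import Order.TTheory GRing.Theory Num.Theory.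
Import numFieldNormedType.Exports.

Local Open Scope classical_set_scope.
Local Open Scope ring_scope.

(** * Oscillatory quadratic forms *)

(** All integrals are kept real: an amplitude is a real function, and a squared modulus is
    [fcos ^+ 2 + fsin ^+ 2]. Whenever a complex amplitude arises, inside a tensor product or from
    the Fourier transform of f, it is split into real and imaginary part at the cost of a factor 2.

    Tensorizing is obstructed by time, which multiplies the square of every frequency coordinate and
    so belongs to no single pair (x_j, xi_j). A bound is therefore required to hold with an
    arbitrary additional phase [m] in the frequency. Schur's test provides this, because its kernel
    estimate tolerates a constant shift of the phase. A fixed time, and the terms t xi_i^2 of the
    coordinates that are not paired with time, then disappear into [m].

    The ball is replaced by the weight [bumpN], which factors over the coordinates as the indicator
    of a ball does not.

    By definition e^(itL) f is a limit along some unknown approximating sequence, whereas the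
    estimates concern the truncations of the Fourier transform of f. The fixed time bound, weighted
    by [bumpN], is what compares the two. *)

Section measurability.
Context {R : realType}.

Lemma measurable_idR :
  measurable_fun [set: measurableTypeR R] (fun u : measurableTypeR R => u : R).
Proof. exact: measurable_id. Qed.

Lemma measurable_cosT d (T : measurableType d) (f : T -> R) :
  measurable_fun setT f -> measurable_fun setT (fun x => cos (f x)).
Proof.
apply: measurableT_comp; apply: continuous_measurable_fun; exact: continuous_cos.
Qed.

Lemma measurable_sinT d (T : measurableType d) (f : T -> R) :
  measurable_fun setT f -> measurable_fun setT (fun x => sin (f x)).
Proof.
apply: measurableT_comp; apply: continuous_measurable_fun; exact: continuous_sin.
Qed.

Lemma measurable_EFinT d (T : measurableType d) (f : T -> R) :
  measurable_fun setT f -> measurable_fun setT (fun x => (f x)%:E).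
Proof. by move=> mf; exact/measurable_EFinP. Qed.

Lemma measurable_funPair d d1 d2 (T : measurableType d) (T1 : measurableType d1)
    (T2 : measurableType d2) (f : T -> T1) (g : T -> T2) :
  measurable_fun setT f -> measurable_fun setT g ->
  measurable_fun setT (fun x => (f x, g x)).
Proof. exact: measurable_fun_pair. Qed.

Lemma measurable_fun2 d d1 d2 (T : measurableType d) (T1 : measurableType d1)
    (T2 : measurableType d2) (h : T1 -> T2 -> R) (f : T -> T1) (g : T -> T2) :
  measurable_fun setT (fun p : T1 * T2 => h p.1 p.2) ->
  measurable_fun setT f -> measurable_fun setT g ->
  measurable_fun setT (fun x => h (f x) (g x)).
Proof.
move=> mh mf mg.
exact: (measurableT_comp mh (measurable_funPair mf mg)).
Qed.

Lemma measurable_fun2r d1 d2 (T1 : measurableType d1)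
    (T2 : measurableType d2) (h : T1 -> T2 -> R) (y : T1) :
  measurable_fun setT (fun p : T1 * T2 => h p.1 p.2) ->
  measurable_fun setT (h y).
Proof.
move=> mh; apply: (measurable_fun2 (f := cst y) (g := id) mh).
  exact: measurable_cst.
exact: measurable_id.
Qed.

Lemma measurable_fstT d d1 d2 (T : measurableType d) (T1 : measurableType d1)
    (T2 : measurableType d2) (f : T -> T1 * T2) :
  measurable_fun setT f -> measurable_fun setT (fun x => (f x).1).
Proof. exact: (measurableT_comp measurable_fst). Qed.

Lemma measurable_sndT d d1 d2 (T : measurableType d) (T1 : measurableType d1)
    (T2 : measurableType d2) (f : T -> T1 * T2) :
  measurable_fun setT f -> measurable_fun setT (fun x => (f x).2).
Proof. exact: (measurableT_comp measurable_snd). Qed.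

(** No integrability is assumed: Tonelli's theorem makes the integrals of the positive and negative
    parts measurable, and [fine] preserves this even where their difference is infinite. *)
Lemma measurable_fun_integralr dX (X : measurableType dX)
    (mu : {sigma_finite_measure set X -> \bar R}) dY (Y : measurableType dY)
    (g : Y * X -> R) :
  measurable_fun setT g -> measurable_fun setT (fun y => \int[mu]_x g (y, x)).
Proof.
move=> mg; apply: (measurableT_comp (fine_measurable measurableT)).
have mG : measurable_fun setT (EFin \o g) by exact/measurable_EFinP.
rewrite (_ : (fun y => _) = (fun y => \int[mu]_x ((EFin \o g)^\+ (y, x))) \-
   (fun y => \int[mu]_x ((EFin \o g)^\- (y, x))))%E; last first.
  apply/funext => y /=; rewrite integralE; congr (_ - _)%E;
  by apply: eq_integral => x _; rewrite ?funeposE ?funenegE.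
apply: emeasurable_funB; apply: measurable_fun_fubini_tonelli_F => //.
  exact: measurable_funepos.
exact: measurable_funeneg.
Qed.

End measurability.

(* Solves measurability goals over the whole space by decomposing the function
   syntactically. *)
Ltac meas :=
  repeat first
  [ assumption
  | match goal with
    | |- measurable_fun _ (fun x => (@?f x + @?g x)%R) => apply: measurable_funD
    | |- measurable_fun _ (fun x => (@?f x * @?g x)%R) => apply: measurable_funM
    | |- measurable_fun _ (fun x => (- @?f x)%R) => apply: measurable_funN
    | |- measurable_fun _ (fun x => (@?f x ^+ _)%R) => apply: measurable_funX
    | |- measurable_fun _ (fun x => (@?f x)%:E) => apply: measurable_EFinT
    | |- measurable_fun _ (EFin \o _) => apply: measurable_EFinT
    | |- measurable_fun _ (fun x => cos (@?f x)) => apply: measurable_cosT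
    | |- measurable_fun _ (fun x => sin (@?f x)) => apply: measurable_sinT
    | |- measurable_fun _ (fun x => (@?f x, @?g x)) => apply: measurable_funPair
    | |- measurable_fun _ (fun x => x.1) => exact: measurable_fst
    | |- measurable_fun _ (fun x => x.2) => exact: measurable_snd
    | |- measurable_fun _ (fun x => (@?f x).1) => apply: measurable_fstT
    | |- measurable_fun _ (fun x => (@?f x).2) => apply: measurable_sndT
    | |- measurable_fun _ (fun x => x) => first [exact: measurable_id | exact: measurable_idR]
    | |- measurable_fun _ (fun x => ?c) => exact: measurable_cst
    end
  | match goal with
    | H : measurable_fun setT (fun p => ?h p.1 p.2) |-
        measurable_fun setT (fun x => ?h _ _) =>
        apply: (measurable_fun2 H)
    | H : measurable_fun setT (fun p => ?h p.1 p.2) |-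
        measurable_fun setT (?h ?y) =>
        exact: (measurable_fun2r y H)
    end
  | match goal with
    | H : measurable_fun setT ?f |- measurable_fun setT (fun x => ?f _) =>
        apply: (measurableT_comp H)
    end ].

Section oscillation.
Context {R : realType}.
Context dX (X : measurableType dX) (mu : {measure set X -> \bar R}).
Implicit Types (th m a b : X -> R).

(* [sq th a] is the squared modulus of the integral of e^(i th) a, for real a. *)
Definition fcos th a : R := \int[mu]_x (cos (th x) * a x).
Definition fsin th a : R := \int[mu]_x (sin (th x) * a x).
Definition sq th a : R := fcos th a ^+ 2 + fsin th a ^+ 2.

Lemma sq_ge0 th a : 0 <= sq th a.
Proof. by rewrite addr_ge0// sqr_ge0. Qed.

Lemma eq_sq th th' a : th =1 th' -> sq th a = sq th' a.
Proof. by move=> /funext ->. Qed.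

Lemma integrableM1 (K : X -> R) a : measurable_fun setT K ->
  (forall x, `|K x| <= 1) -> mu.-integrable setT (EFin \o a) ->
  mu.-integrable setT (fun x => (K x * a x)%:E).
Proof.
move=> mK K1 ia; have /measurable_EFinP ma := measurable_int mu ia.
apply: le_integrable ia => //; first by meas.
by move=> x _ /=; rewrite lee_fin normrM ler_piMl.
Qed.

Lemma integrableZlr (k : R) a : mu.-integrable setT (EFin \o a) ->
  mu.-integrable setT (EFin \o (fun x => k * a x)).
Proof. by move=> ia; exact: (integrableZl measurableT k ia). Qed.

Lemma integrableDr a b : mu.-integrable setT (EFin \o a) ->
  mu.-integrable setT (EFin \o b) ->
  mu.-integrable setT (EFin \o (fun x => a x + b x)).
Proof. by move=> ia ib; exact: (integrableD measurableT ia ib). Qed.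

Lemma abs_cos_le1 (x : R) : `|cos x| <= 1.
Proof. by rewrite ler_norml cos_geN1 cos_le1. Qed.

Lemma abs_sin_le1 (x : R) : `|sin x| <= 1.
Proof. by rewrite ler_norml sin_geN1 sin_le1. Qed.

Lemma integrable_cosM th a : measurable_fun setT th ->
  mu.-integrable setT (EFin \o a) ->
  mu.-integrable setT (fun x => (cos (th x) * a x)%:E).
Proof. by move=> mth; apply: integrableM1; [meas|move=> x; exact: abs_cos_le1]. Qed.

Lemma integrable_sinM th a : measurable_fun setT th ->
  mu.-integrable setT (EFin \o a) ->
  mu.-integrable setT (fun x => (sin (th x) * a x)%:E).
Proof. by move=> mth; apply: integrableM1; [meas|move=> x; exact: abs_sin_le1]. Qed.

End oscillation.

(* The free phase [m] absorbs the terms contributed by the other variables when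
   bounds are tensorized. *)
Definition osc_bound {R : realType} dX (X : measurableType dX)
    (mu : {measure set X -> \bar R}) dY (Y : measurableType dY)
    (nu : {measure set Y -> \bar R}) (v : Y -> R) (Phi : Y -> X -> R)
    (E : set X) (A : R) : Prop :=
  forall a m, mu.-integrable setT (EFin \o a) -> measurable_fun setT m ->
    (forall x, ~ E x -> a x = 0) ->
    (\int[nu]_y (v y * sq mu (fun x => Phi y x + m x) a)%:E
      <= A%:E * \int[mu]_x (a x ^+ 2)%:E)%E.

Section measurable_sq.
Context {R : realType} dX (X : measurableType dX)
  (mu : {sigma_finite_measure set X -> \bar R}) dY (Y : measurableType dY).

Lemma measurable_fcos (th a : Y -> X -> R) :
  measurable_fun setT (fun p : Y * X => th p.1 p.2) ->
  measurable_fun setT (fun p : Y * X => a p.1 p.2) ->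
  measurable_fun setT (fun y => fcos mu (th y) (a y)).
Proof.
move=> mth ma.
apply: (measurable_fun_integralr mu
  (g := fun p : Y * X => cos (th p.1 p.2) * a p.1 p.2)).
by meas.
Qed.

Lemma measurable_fsin (th a : Y -> X -> R) :
  measurable_fun setT (fun p : Y * X => th p.1 p.2) ->
  measurable_fun setT (fun p : Y * X => a p.1 p.2) ->
  measurable_fun setT (fun y => fsin mu (th y) (a y)).
Proof.
move=> mth ma.
apply: (measurable_fun_integralr mu
  (g := fun p : Y * X => sin (th p.1 p.2) * a p.1 p.2)).
by meas.
Qed.

Lemma measurable_sq (th a : Y -> X -> R) :
  measurable_fun setT (fun p : Y * X => th p.1 p.2) ->
  measurable_fun setT (fun p : Y * X => a p.1 p.2) ->
  measurable_fun setT (fun y => sq mu (th y) (a y)).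
Proof.
by move=> mth ma; apply: measurable_funD; apply: measurable_funX;
  [exact: measurable_fcos|exact: measurable_fsin].
Qed.

End measurable_sq.

(** * Tensor products *)

Section product_sigma_finite.
Context {R : realType}.
Context dX1 (X1 : measurableType dX1) (mu1 : {sigma_finite_measure set X1 -> \bar R}).
Context dX2 (X2 : measurableType dX2) (mu2 : {sigma_finite_measure set X2 -> \bar R}).

(* The library only declares the sigma-finite structure of a product of
   subprobabilities, hence this copy of [mu1 \x mu2]. *)
Definition prodm : set (X1 * X2) -> \bar R := (mu1 \x mu2)%E.

HB.instance Definition _ := Measure.copy prodm (mu1 \x mu2)%E.

Let prodm_sigma_finite : sigma_finite setT prodm.
Proof.
have /sigma_finiteP[F [TF ndF Foo]] := sigma_finiteT mu1.
have /sigma_finiteP[G [TG ndG Goo]] := sigma_finiteT mu2.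
exists (fun n => F n `*` G n).
  rewrite -setXTT TF TG predeqE => -[x y]; split.
    move=> [/= [n _ Fnx] [k _ Gky]]; exists (maxn n k) => //; split.
    - by move: x Fnx; exact/subsetPset/ndF/leq_maxl.
    - by move: y Gky; exact/subsetPset/ndG/leq_maxr.
  by move=> [n _ []/= ? ?]; split; exists n.
move=> k; have [? ?] := Foo k; have [? ?] := Goo k.
split; first exact: measurableX.
by rewrite /prodm product_measure1E// lte_mul_pinfty// ge0_fin_numE.
Qed.

HB.instance Definition _ := Measure_isSigmaFinite.Build _ _ _ prodm
  prodm_sigma_finite.

End product_sigma_finite.

Section real_fubini.
Context {R : realType}.
Context dX1 (X1 : measurableType dX1) (mu1 : {sigma_finite_measure set X1 -> \bar R}).
Context dX2 (X2 : measurableType dX2) (mu2 : {sigma_finite_measure set X2 -> \bar R}).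

Lemma le_abse_fine (z : \bar R) : (`|(fine z)%:E| <= `|z|)%E.
Proof. by case: z => [z||] //=; rewrite normr0 leey. Qed.

Lemma ae_eq_Rintegral (f g : X1 -> R) :
  measurable_fun setT f -> measurable_fun setT g ->
  {ae mu1, forall x, f x = g x} -> \int[mu1]_x f x = \int[mu1]_x g x.
Proof.
move=> mf mg fg; congr fine; apply: ae_eq_integral => //; try exact/measurable_EFinP.
by apply: filterS fg => x /= -> _.
Qed.

Lemma integrable_Rfubini (f : X1 * X2 -> R) :
  (mu1 \x mu2)%E.-integrable setT (EFin \o f) ->
  mu1.-integrable setT (fun x => (\int[mu2]_y f (x, y))%:E).
Proof.
move=> intf; have mf := measurable_int _ intf.
apply: (le_integrable measurableT _ _ (integrable_fubini_F intf)).
  by apply: measurable_EFinT; apply: measurable_fun_integralr; exact/measurable_EFinP.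
by move=> x _; exact: le_abse_fine.
Qed.

(** On the null set of sections that are not integrable, [fine] may replace an infinite value by 0,
    so the outer integrands are compared only almost everywhere. *)
Lemma Rfubini (f : X1 * X2 -> R) :
  (mu1 \x mu2)%E.-integrable setT (EFin \o f) ->
  \int[(mu1 \x mu2)%E]_x f x = \int[mu1]_x \int[mu2]_y f (x, y).
Proof.
move=> intf; rewrite /Rintegral -(integral12_prod_meas1 intf); congr fine.
apply: ae_eq_integral => //.
- exact: (measurable_fubini_F intf).
- exact: measurable_int (integrable_Rfubini intf).
have := ae_integrable1 intf; apply: filterS => x ix _.
by rewrite fineK//; exact: integrable_fin_num ix.
Qed.

Lemma Rfubini2 (f : X1 * X2 -> R) :
  (mu1 \x mu2)%E.-integrable setT (EFin \o f) ->
  \int[(mu1 \x mu2)%E]_x f x = \int[mu2]_y \int[mu1]_x f (x, y).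
Proof.
move=> intf; have /measurable_EFinP mf := measurable_int _ intf.
rewrite /Rintegral -(integral21_prod_meas1 intf); congr fine.
apply: ae_eq_integral => //.
- exact: (measurable_fubini_G intf).
- apply: measurable_EFinT.
  apply: (measurable_fun_integralr mu1 (g := fun p : X2 * X1 => f (p.2, p.1))).
  by meas.
have := ae_integrable2 intf; apply: filterS => x ix _.
by rewrite fineK//; exact: integrable_fin_num ix.
Qed.

End real_fubini.

Section tensor.
Context {R : realType}.
Context dX1 (X1 : measurableType dX1) (mu1 : {sigma_finite_measure set X1 -> \bar R}).
Context dX2 (X2 : measurableType dX2) (mu2 : {sigma_finite_measure set X2 -> \bar R}).

Section inner.
Variables (A : X1 -> R) (B a : X1 * X2 -> R).
Hypotheses (mA : measurable_fun setT A) (mB : measurable_fun setT B).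
Hypothesis ia : (mu1 \x mu2)%E.-integrable setT (EFin \o a).

Let ma : measurable_fun setT a.
Proof. by have /measurable_EFinP := measurable_int _ ia. Qed.

(** Real and imaginary part of the integral of e^(iB) a over [x2]; they serve as amplitudes of the
    remaining integral over [x1]. *)
Definition inner_cos x1 := fcos mu2 (fun x2 => B (x1, x2)) (fun x2 => a (x1, x2)).
Definition inner_sin x1 := fsin mu2 (fun x2 => B (x1, x2)) (fun x2 => a (x1, x2)).

Lemma integrable_inner_cos : mu1.-integrable setT (EFin \o inner_cos).
Proof.
by apply: (integrable_Rfubini (f := fun x => cos (B x) * a x)); exact: integrable_cosM.
Qed.

Lemma integrable_inner_sin : mu1.-integrable setT (EFin \o inner_sin).
Proof.
by apply: (integrable_Rfubini (f := fun x => sin (B x) * a x)); exact: integrable_sinM.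
Qed.

Lemma ae_section_integrable :
  {ae mu1, forall x1, mu2.-integrable setT (EFin \o (fun x2 => a (x1, x2)))}.
Proof. exact: ae_integrable1 ia. Qed.

Let mAB : measurable_fun setT (fun x : X1 * X2 => A x.1 + B x).
Proof. by meas. Qed.

Let mB1 x1 : measurable_fun setT (fun x2 => B (x1, x2)).
Proof. by meas. Qed.

Lemma fcos_fubini : fcos (mu1 \x mu2)%E (fun x => A x.1 + B x) a =
  fcos mu1 A inner_cos - fsin mu1 A inner_sin.
Proof.
have ic := integrable_inner_cos; have is_ := integrable_inner_sin.
rewrite /fcos Rfubini; last exact: integrable_cosM.
rewrite -RintegralB//; [|exact: integrable_cosM|exact: integrable_sinM].
have /measurable_EFinP mic := measurable_int _ ic.
have /measurable_EFinP mis := measurable_int _ is_.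
apply: ae_eq_Rintegral.
- apply: (measurable_fun_integralr mu2 (g := fun x => cos (A x.1 + B x) * a x)).
  by meas.
- by meas.
have := ae_section_integrable; apply: filterS => x1 i1 /=.
rewrite /inner_cos /inner_sin /fcos /fsin -!RintegralZl//;
  [|exact: integrable_sinM|exact: integrable_cosM].
rewrite -RintegralB//.
- by apply: eq_Rintegral => x2 _; rewrite cosD; ring.
- by apply: integrableZlr; exact: integrable_cosM.
- by apply: integrableZlr; exact: integrable_sinM.
Qed.

Lemma fsin_fubini : fsin (mu1 \x mu2)%E (fun x => A x.1 + B x) a =
  fsin mu1 A inner_cos + fcos mu1 A inner_sin.
Proof.
have ic := integrable_inner_cos; have is_ := integrable_inner_sin.
rewrite /fsin Rfubini; last exact: integrable_sinM.
rewrite -RintegralD//; [|exact: integrable_sinM|exact: integrable_cosM].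
have /measurable_EFinP mic := measurable_int _ ic.
have /measurable_EFinP mis := measurable_int _ is_.
apply: ae_eq_Rintegral.
- apply: (measurable_fun_integralr mu2 (g := fun x => sin (A x.1 + B x) * a x)).
  by meas.
- by meas.
have := ae_section_integrable; apply: filterS => x1 i1 /=.
rewrite /inner_cos /inner_sin /fcos /fsin -!RintegralZl//;
  [|exact: integrable_sinM|exact: integrable_cosM].
rewrite -RintegralD//.
- by apply: eq_Rintegral => x2 _; rewrite sinD; ring.
- by apply: integrableZlr; exact: integrable_cosM.
- by apply: integrableZlr; exact: integrable_sinM.
Qed.

(** The outer integral has the complex amplitude [inner_cos + i inner_sin]. The factor 2 is the
    price for treating its two parts as separate real amplitudes, the only ones that [osc_bound]
    admits. *)
Lemma sq_fubini_le : sq (mu1 \x mu2)%E (fun x => A x.1 + B x) a <=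
  2 * (sq mu1 A inner_cos + sq mu1 A inner_sin).
Proof.
rewrite /sq fcos_fubini fsin_fubini.
set p := fcos _ _ _; set q := fsin _ _ _; set r := fsin _ _ _; set s := fcos _ _ _.
have := sqr_ge0 (p + q); have := sqr_ge0 (r - s); nra.
Qed.

End inner.

Context dY1 (Y1 : measurableType dY1) (nu1 : {sigma_finite_measure set Y1 -> \bar R}).
Context dY2 (Y2 : measurableType dY2) (nu2 : {sigma_finite_measure set Y2 -> \bar R}).
Variables (v1 : Y1 -> R) (v2 : Y2 -> R) (Phi1 : Y1 -> X1 -> R) (Phi2 : Y2 -> X2 -> R).
Variables (mm : Y2 -> X1 -> R) (E1 : set X1) (E2 : set X2) (A1 A2 : R).
Hypotheses (A10 : 0 <= A1) (A20 : 0 <= A2).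
Hypotheses (v10 : forall y, 0 <= v1 y) (v20 : forall y, 0 <= v2 y).
Hypotheses (mv1 : measurable_fun setT v1) (mv2 : measurable_fun setT v2).
Hypothesis mPhi1 : measurable_fun setT (fun p : Y1 * X1 => Phi1 p.1 p.2).
Hypothesis mPhi2 : measurable_fun setT (fun p : Y2 * X2 => Phi2 p.1 p.2).
Hypothesis mmm : measurable_fun setT (fun p : Y2 * X1 => mm p.1 p.2).

(** For fixed [y2] the inner integrals are amplitudes in [x1], and the first bound applies with free
    phase [mm y2]. For fixed [x1] the sum of their squares is a [sq] over [x2], to which the second
    bound applies with free phase [m (x1, _)]. The coupling [mm] may join [y2] to [x1] because [y2]
    is frozen while the first bound is used: this is how a time variable kept in [y2] reaches the
    frequency [x1]. *)
Lemma osc_bound_tensor :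
  osc_bound mu1 nu1 v1 Phi1 E1 A1 -> osc_bound mu2 nu2 v2 Phi2 E2 A2 ->
  osc_bound (mu1 \x mu2)%E (nu1 \x nu2)%E (fun y => v1 y.1 * v2 y.2)
    (fun y x => Phi1 y.1 x.1 + Phi2 y.2 x.2 + mm y.2 x.1) (E1 `*` E2)
    (2 * A1 * A2).
Proof.
move=> P1 P2 a m ia mma aE.
have /measurable_EFinP ma := measurable_int _ ia.
pose B y2 (x : X1 * X2) := Phi2 y2 x.2 + m x.
have mB : measurable_fun setT (fun p : Y2 * (X1 * X2) => B p.1 p.2).
  by rewrite /B; meas.
have mB1 y2 : measurable_fun setT (B y2) by meas.
pose b1 y2 := inner_cos (B y2) a; pose b2 y2 := inner_sin (B y2) a.
pose A y1 y2 x1 := Phi1 y1 x1 + mm y2 x1.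
have mA1 y1 y2 : measurable_fun setT (A y1 y2).
  by rewrite /A; meas.
have msum : measurable_fun setT (fun p : (Y1 * Y2) * (X1 * X2) =>
    Phi1 p.1.1 p.2.1 + Phi2 p.1.2 p.2.2 + mm p.1.2 p.2.1 + m p.2).
  by meas.
have msq : measurable_fun setT (fun y : Y1 * Y2 =>
  sq (mu1 \x mu2)%E (fun x => Phi1 y.1 x.1 + Phi2 y.2 x.2 + mm y.2 x.1 + m x) a).
  apply: (measurable_sq (prodm mu1 mu2) (th := fun (y : Y1 * Y2) (x : X1 * X2) =>
    Phi1 y.1 x.1 + Phi2 y.2 x.2 + mm y.2 x.1 + m x) (a := fun _ : Y1 * Y2 => a)); by meas.
rewrite (fubini_tonelli2 (fun y : Y1 * Y2 => (v1 y.1 * v2 y.2 * sq _ _ a)%:E)); first last.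
- by move=> y; rewrite lee_fin !mulr_ge0// sq_ge0.
- by meas.
pose s2 y2 x1 := b1 y2 x1 ^+ 2 + b2 y2 x1 ^+ 2.
have ms2 : measurable_fun setT (fun p : Y2 * X1 => s2 p.1 p.2).
  have h : measurable_fun setT (fun q : (Y2 * X1) * X2 => B q.1.1 (q.1.2, q.2)).
    by meas.
  have h' : measurable_fun setT (fun q : (Y2 * X1) * X2 => a (q.1.2, q.2)).
    by meas.
  exact: (measurable_sq mu2 (th := fun p x2 => B p.1 (p.2, x2))
    (a := fun (p : Y2 * X1) x2 => a (p.2, x2))).
have step y2 : (\int[nu1]_y1 (v1 y1 * v2 y2 * sq (mu1 \x mu2)%E
      (fun x => Phi1 y1 x.1 + Phi2 y2 x.2 + mm y2 x.1 + m x) a)%:E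
    <= (2 * A1)%:E * \int[mu1]_x1 (v2 y2 * s2 y2 x1)%:E)%E.
  have ib1 := integrable_inner_cos (mB1 y2) ia.
  have ib2 := integrable_inner_sin (mB1 y2) ia.
  have mbb1 : measurable_fun setT (b1 y2) by apply/measurable_EFinP; exact: measurable_int ib1.
  have mbb2 : measurable_fun setT (b2 y2) by apply/measurable_EFinP; exact: measurable_int ib2.
  have a0 x1 : ~ E1 x1 -> forall x2, a (x1, x2) = 0.
    by move=> nE x2; apply: aE => -[].
  have b10 x1 : ~ E1 x1 -> b1 y2 x1 = 0.
    move=> /a0 h; rewrite /b1 /inner_cos /fcos.
    under eq_Rintegral do rewrite h mulr0.
    by rewrite Rintegral_cst// mul0r.
  have b20 x1 : ~ E1 x1 -> b2 y2 x1 = 0.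
    move=> /a0 h; rewrite /b2 /inner_sin /fsin.
    under eq_Rintegral do rewrite h mulr0.
    by rewrite Rintegral_cst// mul0r.
  have mmm2 : measurable_fun setT (mm y2) by meas.
  have msq1 (b : X1 -> R) : measurable_fun setT b ->
      measurable_fun setT (fun y1 => sq mu1 (A y1 y2) b).
    move=> mb; apply: (measurable_sq mu1 (th := fun y1 => A y1 y2) (a := fun=> b)).
      by rewrite /A; meas.
    by meas.
  have Q1 := P1 _ _ ib1 mmm2 b10; have Q2 := P1 _ _ ib2 mmm2 b20.
  apply: (@le_trans _ _ (\int[nu1]_y1 ((2 * v2 y2)%:E *
      ((v1 y1 * sq mu1 (A y1 y2) (b1 y2))%:E + (v1 y1 * sq mu1 (A y1 y2) (b2 y2))%:E)))%E).
    apply: ge0_le_integral => //.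
    - by move=> y1 _; rewrite lee_fin !mulr_ge0// sq_ge0.
    - apply: measurable_EFinT; apply: measurable_funM; first by meas.
      exact: (measurable_fun_pair1 (f := fun y : Y1 * Y2 => sq (mu1 \x mu2)%E
        (fun x => Phi1 y.1 x.1 + Phi2 y.2 x.2 + mm y.2 x.1 + m x) a) y2 msq).
    - have h1 := msq1 _ mbb1; have h2 := msq1 _ mbb2.
      apply: measurable_funeM; apply: emeasurable_funD; apply: measurable_EFinT.
        exact: measurable_funM mv1 h1.
      exact: measurable_funM mv1 h2.
    move=> y1 _; rewrite -EFinD -EFinM lee_fin.
    rewrite (_ : (fun x => _ + _) = (fun x => A y1 y2 x.1 + B y2 x)); last first.
      by apply/funext => x; rewrite /A /B; ring.
    have := sq_fubini_le (mA1 y1 y2) (mB1 y2) ia.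
    rewrite -/(b1 y2) -/(b2 y2) => h.
    apply: le_trans (ler_wpM2l _ h) _; first by rewrite mulr_ge0.
    move: (sq mu1 _ (b1 y2)) (sq mu1 _ (b2 y2)) => S1 S2.
    by rewrite [leLHS](_ : _ = 2 * v2 y2 * (v1 y1 * S1 + v1 y1 * S2))//; ring.
  rewrite ge0_integralZl//; first last.
  - by rewrite lee_fin mulr_ge0.
  - by move=> y1 _; rewrite -EFinD lee_fin addr_ge0// mulr_ge0// sq_ge0.
  - have h1 := msq1 _ mbb1; have h2 := msq1 _ mbb2.
    apply: emeasurable_funD; apply: measurable_EFinT.
      exact: measurable_funM mv1 h1.
    exact: measurable_funM mv1 h2.
  rewrite ge0_integralD//; first last.
  - by apply: measurable_EFinT; exact: measurable_funM mv1 (msq1 _ mbb2).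
  - by move=> y1 _; rewrite lee_fin mulr_ge0// sq_ge0.
  - by apply: measurable_EFinT; exact: measurable_funM mv1 (msq1 _ mbb1).
  - by move=> y1 _; rewrite lee_fin mulr_ge0// sq_ge0.
  apply: (@le_trans _ _ ((2 * v2 y2)%:E * (A1%:E * \int[mu1]_x1 (b1 y2 x1 ^+ 2)%:E
     + A1%:E * \int[mu1]_x1 (b2 y2 x1 ^+ 2)%:E)))%E.
    apply: lee_wpmul2l; first by rewrite lee_fin mulr_ge0.
    exact: leeD Q1 Q2.
  rewrite -ge0_muleDr ?integral_ge0//; try by move=> x _; rewrite lee_fin sqr_ge0.
  rewrite -ge0_integralD//; first last.
  - by meas.
  - by move=> y1 _; rewrite lee_fin sqr_ge0.
  - by meas.
  - by move=> y1 _; rewrite lee_fin sqr_ge0.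
  under [X in (_ <= _ * X)%E]eq_integral do rewrite EFinM.
  rewrite ge0_integralZl//; first last.
  - by rewrite lee_fin.
  - by move=> x _; rewrite lee_fin addr_ge0// sqr_ge0.
  - by apply: measurable_EFinT; rewrite /s2; meas.
  rewrite !muleA -!EFinM.
  rewrite (_ : 2 * v2 y2 * A1 = 2 * A1 * v2 y2)//; ring.
have m0 : measurable_fun setT (fun y2 => \int[mu1]_x1 (v2 y2 * s2 y2 x1)%:E)%E.
  apply: (measurable_fun_fubini_tonelli_F (fun p : Y2 * X1 => (v2 p.1 * s2 p.1 p.2)%:E)).
    by meas.
  by move=> p; rewrite lee_fin mulr_ge0// addr_ge0// sqr_ge0.
apply: (@le_trans _ _ (\int[nu2]_y2 ((2 * A1)%:E * \int[mu1]_x1 (v2 y2 * s2 y2 x1)%:E))%E).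
  apply: ge0_le_integral => //.
  - by move=> y2 _; apply: integral_ge0 => y1 _; rewrite lee_fin !mulr_ge0// sq_ge0.
  - apply: (measurable_fun_fubini_tonelli_G (fun y : Y1 * Y2 => (v1 y.1 * v2 y.2 * sq _ _ a)%:E)).
      by meas.
    by move=> y; rewrite lee_fin !mulr_ge0// sq_ge0.
  - exact: measurable_funeM.
  - by move=> y2 _; exact: step.
rewrite ge0_integralZl//; first last.
- by rewrite lee_fin mulr_ge0.
- by move=> y2 _; apply: integral_ge0 => x _; rewrite lee_fin mulr_ge0// addr_ge0// sqr_ge0.
rewrite [in leRHS]EFinM -[leRHS]muleA; apply: lee_wpmul2l; first by rewrite lee_fin mulr_ge0.
rewrite (fubini_tonelli (fun p : Y2 * X1 => (v2 p.1 * s2 p.1 p.2)%:E)); first last.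
- by move=> p; rewrite lee_fin mulr_ge0// addr_ge0// sqr_ge0.
- by meas.
rewrite (fubini_tonelli1 (fun x : X1 * X2 => (a x ^+ 2)%:E)); first last.
- by move=> x; rewrite lee_fin sqr_ge0.
- by meas.
have mE : measurable_fun setT (fun x1 => \int[mu2]_x2 (a (x1, x2) ^+ 2)%:E)%E.
  apply: (measurable_fun_fubini_tonelli_F (fun x : X1 * X2 => (a x ^+ 2)%:E)); first by meas.
  by move=> x; rewrite lee_fin sqr_ge0.
rewrite -ge0_integralZl//; last first.
  by move=> x _; apply: integral_ge0 => y _; rewrite lee_fin sqr_ge0.
apply: ae_ge0_le_integral => //.
- by move=> x _; apply: integral_ge0 => y _; rewrite lee_fin mulr_ge0// addr_ge0// sqr_ge0.
- apply: (measurable_fun_fubini_tonelli_G (fun p : Y2 * X1 => (v2 p.1 * s2 p.1 p.2)%:E)).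
    by meas.
  by move=> p; rewrite lee_fin mulr_ge0// addr_ge0// sqr_ge0.
- move=> x _; rewrite mule_ge0 ?lee_fin//.
  by apply: integral_ge0 => y _; rewrite lee_fin sqr_ge0.
- exact: measurable_funeM.
(* The second bound asks for an integrable amplitude, and the section of [a] is one for almost every
   [x1]. *)
have := ae_section_integrable ia; apply: filterS => x1 i1 _ /=.
apply: P2 => //; first by meas.
by move=> x2 nE; apply: aE => -[].
Qed.

End tensor.

(** * Schur's test *)

Section schur.
Context {R : realType}.

Lemma integrable_tensor dX (X : measurableType dX) dY (Y : measurableType dY)
    (mu : {sigma_finite_measure set X -> \bar R})
    (nu : {sigma_finite_measure set Y -> \bar R}) (f : X -> R) (g : Y -> R) :
  mu.-integrable setT (EFin \o f) -> nu.-integrable setT (EFin \o g) ->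
  (mu \x nu)%E.-integrable setT (EFin \o (fun z => f z.1 * g z.2)).
Proof.
move=> fi gi.
have /measurable_EFinP mf := measurable_int _ fi.
have /measurable_EFinP mg := measurable_int _ gi.
apply/integrable12ltyP; first by apply: measurable_EFinT; meas.
have [_ lf] := integrableP _ _ _ fi; have [_ lg] := integrableP _ _ _ gi.
have If0 : (0 <= \int[mu]_x `|(f x)%:E|)%E by exact: integral_ge0.
have Ig0 : (0 <= \int[nu]_x `|(g x)%:E|)%E by exact: integral_ge0.
rewrite [ltLHS](_ : _ = ((\int[mu]_x `|(f x)%:E|) * (\int[nu]_x `|(g x)%:E|))%E).
  by rewrite lte_mul_pinfty// ge0_fin_numE.
rewrite -ge0_integralZr//; last first.
  by apply: measurableT_comp => //; exact: measurable_EFinT.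
apply: eq_integral => x _; rewrite -ge0_integralZl//.
  by apply: eq_integral => y _; rewrite -abseM -EFinM.
by apply: measurableT_comp => //; exact: measurable_EFinT.
Qed.

Context dX (X : measurableType dX) (mu : {sigma_finite_measure set X -> \bar R}).
Context dY (Y : measurableType dY) (nu : {sigma_finite_measure set Y -> \bar R}).
Variables (v : Y -> R) (Phi : Y -> X -> R) (E : set X) (k : X -> X -> R) (A : R).
Hypothesis iv : nu.-integrable setT (EFin \o v).
Hypothesis mPhi : measurable_fun setT (fun p : Y * X => Phi p.1 p.2).
Hypothesis A0 : 0 <= A.
Hypothesis k0 : forall x x', 0 <= k x x'.
Hypothesis mk : measurable_fun setT (fun p : X * X => k p.1 p.2).
Hypothesis ksym : forall x x', k x x' = k x' x.
Hypothesis vk : forall x x' c, E x -> E x' ->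
  `|\int[nu]_y (v y * cos (Phi y x - Phi y x' + c))| <= k x x'.
Hypothesis kA : forall x, (\int[mu]_x' (k x x')%:E <= A%:E)%E.

Lemma sq_prodE (th a : X -> R) : measurable_fun setT th ->
  mu.-integrable setT (EFin \o a) ->
  sq mu th a = \int[(mu \x mu)%E]_z (cos (th z.1 - th z.2) * (a z.1 * a z.2)).
Proof.
move=> mth ia; have /measurable_EFinP ma := measurable_int _ ia.
have iaa := integrable_tensor ia ia.
rewrite Rfubini; last by apply: integrable_cosM => //; meas.
rewrite (_ : (fun x => _) = (fun x => fcos mu th a * (cos (th x) * a x) +
    fsin mu th a * (sin (th x) * a x))); last first.
  apply/funext => x /=.
  have ic := integrable_cosM mth ia; have is_ := integrable_sinM mth ia.
  rewrite -(RintegralZr (cos (th x) * a x) measurableT ic).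
  rewrite -(RintegralZr (sin (th x) * a x) measurableT is_).
  rewrite -RintegralD//.
  - by apply: eq_Rintegral => y _; rewrite cosB; ring.
  - by apply: eq_integrable (integrableZlr (cos (th x) * a x) ic) => // y _ /=; rewrite mulrC.
  - by apply: eq_integrable (integrableZlr (sin (th x) * a x) is_) => // y _ /=; rewrite mulrC.
have ic := integrable_cosM mth ia; have is_ := integrable_sinM mth ia.
rewrite (RintegralD measurableT (integrableZlr _ ic) (integrableZlr _ is_)).
by rewrite !RintegralZl.
Qed.

(** Expanding the square gives a double integral of [a x * a x'] against the [v]-average of the
    cosine of the phase difference. The free phase contributes [m x - m x'], constant in [y], which
    is why [vk] is assumed for every shift [c]. Then [a x * a x'] is bounded by half the sum of the
    squares, and the two halves agree because [k] is symmetric. *)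
Lemma schur_test : osc_bound mu nu v Phi E A.
Proof.
move=> a m ia mm aE.
have /measurable_EFinP ma := measurable_int _ ia.
have /measurable_EFinP mv := measurable_int _ iv.
have iaa := integrable_tensor ia ia.
pose th y x := Phi y x + m x.
have mth y : measurable_fun setT (th y) by rewrite /th; meas.
pose F (p : Y * (X * X)) : R :=
  cos (th p.1 p.2.1 - th p.1 p.2.2) * (v p.1 * (a p.2.1 * a p.2.2)).
have mF : measurable_fun setT F by rewrite /F /th; meas.
have iF : (nu \x prodm mu mu)%E.-integrable setT (EFin \o F).
  apply: integrable_cosM; first by rewrite /th; meas.
  have iaa' : (prodm mu mu).-integrable setT (EFin \o (fun z => a z.1 * a z.2)).
    exact: iaa.
  exact: (integrable_tensor iv iaa').
have iFy y : (mu \x mu)%E.-integrable setT (EFin \o (fun z =>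
    cos (th y z.1 - th y z.2) * (a z.1 * a z.2))).
  have mthy := mth y.
  by apply: integrable_cosM => //; meas.
rewrite (_ : (\int[nu]_y _)%E = (\int[nu]_y \int[prodm mu mu]_z (F (y, z))%:E)%E);
    last first.
  apply: eq_integral => y _; rewrite (sq_prodE (mth y))// EFinM.
  rewrite /Rintegral fineK; last exact: integrable_fin_num (iFy y).
  rewrite -integralZl//; last exact: iFy.
  by apply: eq_integral => z _; rewrite /F -EFinM/= mulrCA.
rewrite (Fubini iF).
pose F2 z := (\int[nu]_y (F (y, z))%:E)%E.
have mF2 : measurable_fun setT F2 by exact: (measurable_fubini_G iF).
apply: le_trans (lee_abs _) _; apply: le_trans (le_abse_integral _ measurableT mF2) _.
pose G1 (z : X * X) : \bar R := (2^-1 * (a z.1 ^+ 2 * k z.1 z.2))%:E.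
pose G2 (z : X * X) : \bar R := (2^-1 * (a z.2 ^+ 2 * k z.1 z.2))%:E.
have G10 z : (0 <= G1 z)%E by rewrite lee_fin mulr_ge0// mulr_ge0// sqr_ge0.
have G20 z : (0 <= G2 z)%E by rewrite lee_fin mulr_ge0// mulr_ge0// sqr_ge0.
have mG1 : measurable_fun setT G1 by rewrite /G1; meas.
have mG2 : measurable_fun setT G2 by rewrite /G2; meas.
have FG z : (`|F2 z| <= G1 z + G2 z)%E.
  rewrite /F2.
  have [zE|zE] := pselect (E z.1 /\ E z.2); last first.
    rewrite integral0_eq ?abse0 ?adde_ge0// => y _.
    rewrite /F/=; suff -> : a z.1 * a z.2 = 0 by rewrite !mulr0.
    by move/not_andP: zE => -[/aE->|/aE->]; rewrite ?mul0r ?mulr0.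
  have mthz : measurable_fun setT (fun y => Phi y z.1 - Phi y z.2 + (m z.1 - m z.2)).
    by meas.
  have iH := integrable_cosM mthz iv.
  rewrite (_ : (fun y => (F (y, z))%:E) = (fun y => (a z.1 * a z.2)%:E *
     (cos (Phi y z.1 - Phi y z.2 + (m z.1 - m z.2)) * v y)%:E)%E); last first.
    apply/funext => y; rewrite -EFinM; congr EFin.
    rewrite /F /th /= (_ : Phi y z.1 + m z.1 - (Phi y z.2 + m z.2) =
      Phi y z.1 - Phi y z.2 + (m z.1 - m z.2)); last by ring.
    by ring.
  rewrite integralZl// abseM.
  rewrite -[X in (_ * `|X|)%E]fineK; last exact: integrable_fin_num iH.
  rewrite /= -EFinM -EFinD lee_fin.
  have := vk (m z.1 - m z.2) zE.1 zE.2.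
  under eq_Rintegral do rewrite mulrC.
  rewrite /Rintegral => h; apply: le_trans (ler_wpM2l _ h) _ => //.
  rewrite -mulrDr -mulrDl mulrA ler_wpM2r//.
  have := sqr_ge0 (`|a z.1| - `|a z.2|); rewrite normrM.
  have := real_normK (num_real (a z.1)); have := real_normK (num_real (a z.2)); nra.
apply: (@le_trans _ _ (\int[mu \x mu]_z (G1 z + G2 z))%E).
  apply: ge0_le_integral => //; first exact: measurableT_comp.
  exact: emeasurable_funD.
rewrite ge0_integralD//.
have ma2 : measurable_fun setT (fun x => (a x ^+ 2)%:E) by meas.
have half : (\int[mu]_x (\int[mu]_x' (2^-1 * (a x ^+ 2 * k x x'))%:E) <=
    (2^-1 * A)%:E * \int[mu]_x (a x ^+ 2)%:E)%E.
  rewrite -ge0_integralZl//; first last.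
  - by rewrite lee_fin mulr_ge0.
  - by move=> x _; rewrite lee_fin sqr_ge0.
  apply: ge0_le_integral => //.
  - by move=> x _; apply: integral_ge0 => y _; exact: (G10 (x, y)).
  - exact: (measurable_fun_fubini_tonelli_F G1).
  - exact: measurable_funeM.
  move=> x _.
  rewrite (_ : (\int[mu]_x' _)%E = ((2^-1 * a x ^+ 2)%:E * \int[mu]_x' (k x x')%:E)%E).
    apply: le_trans (lee_wpmul2l _ (kA x)) _; first by rewrite lee_fin mulr_ge0// sqr_ge0.
    by rewrite -!EFinM lee_fin mulrAC.
  rewrite -ge0_integralZl//.
  - by apply: eq_integral => y _; rewrite -EFinM mulrA.
  - by apply: measurable_EFinT; meas.
  - by move=> y _; rewrite lee_fin.
  - by rewrite lee_fin mulr_ge0// sqr_ge0.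
rewrite (fubini_tonelli1 G1)// (fubini_tonelli2 G2)//.
rewrite (_ : A = 2^-1 * A + 2^-1 * A); last by lra.
rewrite EFinD ge0_muleDl ?lee_fin ?mulr_ge0//; apply: leeD; first exact: half.
apply: le_trans half; rewrite le_eqVlt; apply/orP; left; apply/eqP.
by apply: eq_integral => x _; apply: eq_integral => y _; rewrite /G2 /= ksym.
Qed.

End schur.

(** * One-dimensional bounds *)

Section real_kernels.
Context {R : realType}.
Local Notation leb := (@lebesgue_measure R).
Local Notation RR := (measurableTypeR R).

Lemma is_derive_continuous (F f : R -> R) :
  (forall x, is_derive x (1 : R) F (f x)) -> continuous F.
Proof.
move=> dF x; apply: differentiable_continuous; apply/derivable1_diffP.
by have [] := dF x.
Qed.

Lemma FTC2 (F f : R -> R) (a b : R) : a < b ->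
  (forall x, is_derive x (1 : R) F (f x)) -> continuous f ->
  (\int[leb]_(x in `[a, b]) (f x)%:E = (F b - F a)%:E)%E.
Proof.
move=> ab dF cf; rewrite (continuous_FTC2 (f := f) (F := F))//.
- exact: continuous_subspaceT.
- have cF := is_derive_continuous dF; split.
  + by move=> x _; have [] := dF x.
  + exact/cvg_at_right_filter/cF.
  + exact/cvg_at_left_filter/cF.
- by move=> x _; rewrite derive1E; have [] := dF x.
Qed.

Lemma is_derive_affine (b c x : R) : is_derive x (1 : R) (fun u : R => u * b + c) b.
Proof.
have h : is_derive x (1 : R) (fun u : R => b *: u + c) (b *: 1 + 0).
  exact: (is_deriveD (f := b \*: id) (g := cst c)).
by under eq_fun do rewrite mulrC; move: h; rewrite addr0 [b *: 1]mulr1.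
Qed.

Lemma is_derive_cos_affine (b c x : R) :
  is_derive x (1 : R) (fun u : R => cos (u * b + c)) (- (b * sin (x * b + c))).
Proof.
have h := is_derive1_comp (f := cos)
  (g := fun u => u * b + c) (is_derive_cos (x * b + c)) (is_derive_affine b c x).
by apply: is_derive_eq h _; rewrite mulNr mulrC.
Qed.

Lemma is_derive_sin_affine (b c x : R) :
  is_derive x (1 : R) (fun u : R => sin (u * b + c)) (b * cos (x * b + c)).
Proof.
have h := is_derive1_comp (f := sin)
  (g := fun u => u * b + c) (is_derive_sin (x * b + c)) (is_derive_affine b c x).
by apply: is_derive_eq h _; rewrite mulrC.
Qed.

(* It dominates the indicator function of [-1, 2], which contains the coordinates
   of the unit ball and the time windows around (0, 1); being continuous, its
   Fourier transform decays quadratically. *)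
Definition bump : R -> R := (fun u : R => 9 - u ^+ 2 : R) \_ `[-3, 3].

Lemma bump_ge0 u : 0 <= bump u.
Proof.
rewrite /bump patchE; case: ifPn => // /set_mem /=; rewrite in_itv/= => /andP[? ?].
nra.
Qed.

Lemma bump_ge1 u : -1 <= u <= 2 -> 1 <= bump u.
Proof.
move=> /andP[? ?]; rewrite /bump patchE mem_set; last by rewrite /= in_itv/=; lra.
nra.
Qed.

Lemma measurable_bump : measurable_fun [set: RR] bump.
Proof.
apply: (measurable_restrictT _ _).1 => //; apply: measurable_funTS.
by apply: measurable_funB => //; exact: measurable_funX.
Qed.

Lemma bump_le u : bump u <= 9 * \1_`[-3, 3] u.
Proof.
rewrite /bump patchE indicE; case: ifPn => //; rewrite ?mulr0// mulr1 => _.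
by rewrite lerBlDr lerDl sqr_ge0.
Qed.

Lemma integrable_bump : leb.-integrable setT (EFin \o bump).
Proof.
have h : leb.-integrable setT (EFin \o (fun u : R => 9 * \1_`[-3, 3] u)).
  apply: integrableZlr; apply: integrable_indic_itv.
apply: le_integrable h => //; first by apply: measurable_EFinT; exact: measurable_bump.
move=> u _; rewrite /= lee_fin !ger0_norm ?bump_ge0 ?bump_le//.
Qed.

(** For |b| <= 1 the integral is at most 9 * 6 = 54 and (1 + |b|)^2 is at most 4, whence 216. For
    |b| > 1 one integrates by parts twice: [9 - u ^+ 2] vanishes at both ends of the support, so no
    term of order 1 / |b| survives. *)
Lemma bump_fourier_le (b c : R) :
  `|\int[leb]_u (bump u * cos (u * b + c))| <= 216 / (1 + `|b|) ^+ 2.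
Proof.
have b1 : 0 < 1 + `|b| by rewrite ltr_wpDr.
rewrite ler_pdivlMr ?exprn_gt0//.
have [bs|bl] := leP `|b| 1.
  have h : `|\int[leb]_u (bump u * cos (u * b + c))| <= 54.
    have mth : measurable_fun [set: RR] (fun u : RR => u * b + c) by meas.
    have iH : leb.-integrable setT (EFin \o (fun u => bump u * cos (u * b + c))).
      have h := integrable_cosM mth integrable_bump.
      by apply: eq_integrable h => // u _ /=; rewrite mulrC.
    apply: le_trans (le_normr_Rintegral _ iH) _ => //.
    have i1 : leb.-integrable setT (EFin \o (\1_`[-3, 3] : R -> R)).
      exact: integrable_indic_itv.
    apply: le_trans (le_Rintegral _ (integrable_norm iH) (integrableZlr 9 i1) _) _ => //.
      move=> u _ /=; rewrite normrM (ger0_norm (bump_ge0 u)).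
      by apply: le_trans (bump_le u); rewrite ler_piMr ?bump_ge0// abs_cos_le1.
    rewrite RintegralZl// /Rintegral integral_indic// setIT.
    rewrite [X in fine X](_ : _ = 6%:E); last first.
      rewrite [LHS](lebesgue_measure_itv `[(-3 : R), 3]) /= lte_fin ifT; last by lra.
      by rewrite -EFinD; congr EFin; lra.
    by rewrite /=; lra.
  apply: (@le_trans _ _ (54 * (1 + `|b|) ^+ 2)).
    by rewrite ler_wpM2r// sqr_ge0.
  have := normr_ge0 b; nra.
have b0 : b != 0 by rewrite -normr_gt0 (lt_trans _ bl).
(* The antiderivative produced by two integrations by parts; its leading term (9 - u^2) / b drops
   out at both endpoints. *)
pose F u := ((9 - u ^+ 2) / b + 2 / b ^+ 3) * sin (u * b + c) +
  (- (2 / b ^+ 2) * u) * cos (u * b + c).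
have dF x : is_derive x (1 : R) F ((9 - x ^+ 2) * cos (x * b + c)).
  have dx : is_derive x (1 : R) (@id R) 1 by exact: is_derive_id.
  have dP : is_derive x (1 : R) (fun u : R => (9 - u ^+ 2) / b + 2 / b ^+ 3) (- (2 * x) / b).
    have h := is_deriveD (is_deriveZ b^-1 (is_deriveB (is_derive_cst (9 : R) x 1)
      (is_deriveX 2 dx))) (is_derive_cst (2 / b ^+ 3) x 1).
    rewrite (_ : (fun u => _) = b^-1 \*: (cst 9 - (@id R) ^+ 2) + cst (2 / b ^+ 3)).
      by apply: is_derive_eq h _; rewrite /GRing.scale /= expr1; ring.
    by apply/funext => u /=; rewrite !fctE [_ / b]mulrC.
  have dQ : is_derive x (1 : R) (fun u : R => - (2 / b ^+ 2) * u) (- (2 / b ^+ 2)).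
    by apply: is_derive_eq (is_deriveZ (- (2 / b ^+ 2)) dx) _; rewrite /GRing.scale /= mulr1.
  have h := is_deriveD (is_deriveM dP (is_derive_sin_affine b c x))
    (is_deriveM dQ (is_derive_cos_affine b c x)).
  apply: is_derive_eq h _; rewrite /GRing.scale /=; field.
  by [].
have cf : continuous (fun x : R => (9 - x ^+ 2) * cos (x * b + c)).
  have cc := is_derive_continuous (is_derive_cos_affine b c).
  have cp : continuous (fun x : R => 9 - x ^+ 2 : R).
    by move=> x; apply: cvgB; [exact: cvg_cst|exact: exprn_continuous].
  by move=> x; apply: cvgM; [exact: cp|exact: cc].
have -> : \int[leb]_u (bump u * cos (u * b + c)) = F 3 - F (-3).
  rewrite /Rintegral (_ : (fun u => (bump u * cos (u * b + c))%:E) =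
    (EFin \o (fun u => (9 - u ^+ 2) * cos (u * b + c))) \_ `[-3, 3]).
    by rewrite -integral_mkcond (FTC2 _ dF cf)//; lra.
  apply/funext => u; rewrite /bump !patchE; case: ifPn => //.
  by rewrite mul0r.
set s1 := sin (3 * b + c); set s2 := sin (-3 * b + c).
set c1 := cos (3 * b + c); set c2 := cos (-3 * b + c).
have -> : F 3 - F (-3) = (2 / b ^+ 3) * (s1 - s2) - (6 / b ^+ 2) * (c1 + c2).
  by rewrite /F -/s1 -/s2 -/c1 -/c2; field.
have hs : `|s1 - s2| <= 2.
  apply: le_trans (ler_normB _ _) _.
  by have := abs_sin_le1 (3 * b + c); have := abs_sin_le1 (-3 * b + c); rewrite -/s1 -/s2; lra.
have hc : `|c1 + c2| <= 2.
  apply: le_trans (ler_normD _ _) _.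
  by have := abs_cos_le1 (3 * b + c); have := abs_cos_le1 (-3 * b + c); rewrite -/c1 -/c2; lra.
set B := `|b| in b1 bl *.
have Bi : 0 < B^-1 <= 1 by rewrite invr_gt0 invf_le1 ?(ltW bl) ?(lt_trans _ bl).
have h1 : `|(2 / b ^+ 3) * (s1 - s2) - (6 / b ^+ 2) * (c1 + c2)| <= 16 * B^-1 ^+ 2.
  apply: le_trans (ler_normB _ _) _.
  rewrite !normrM !normfV !normrX -/B (ger0_norm (ler0n _ 2)) (ger0_norm (ler0n _ 6)) -!exprVn.
  set i := B^-1 in Bi *.
  have /andP[i0 i1] := Bi.
  have h1 : 2 * i ^+ 3 * `|s1 - s2| <= 4 * i ^+ 2.
    apply: (@le_trans _ _ (2 * i ^+ 3 * 2)).
      by rewrite ler_wpM2l// mulr_ge0// exprn_ge0// ltW.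
    have := sqr_ge0 i; rewrite exprS; nra.
  have h2 : 6 * i ^+ 2 * `|c1 + c2| <= 12 * i ^+ 2.
    apply: (@le_trans _ _ (6 * i ^+ 2 * 2)).
      by rewrite ler_wpM2l// mulr_ge0// sqr_ge0.
    by lra.
  by lra.
apply: (@le_trans _ _ (16 * B^-1 ^+ 2 * (1 + B) ^+ 2)).
  by rewrite ler_wpM2r// sqr_ge0.
have BB : B^-1 * B = 1 by rewrite mulVf// gt_eqF// (lt_trans _ bl).
rewrite -mulrA -exprMn mulrDr BB mulr1.
have /andP[i0 i1] := Bi; nra.
Qed.

End real_kernels.

Section base_bounds.
Context {R : realType}.
Local Notation leb := (@lebesgue_measure R).
Local Notation RR := (measurableTypeR R).

Lemma continuous_measurable_idR (f : R -> R) :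
  continuous f -> measurable_fun [set: RR] (f : RR -> R).
Proof.
move=> cf; exact: (measurableT_comp (continuous_measurable_fun cf) measurable_idR).
Qed.

(* Locked, lest the unary numeral gets evaluated. *)
Definition Kc : R := locked 216.

Lemma Kc_gt0 : 0 < Kc.
Proof. by rewrite /Kc -lock ltr0n. Qed.

Lemma bump_fourier_Kc (b c : R) :
  `|\int[leb]_u (bump u * cos (u * b + c))| <= Kc / (1 + `|b|) ^+ 2.
Proof. by rewrite /Kc -lock; exact: bump_fourier_le. Qed.

(** The bound of [bump_fourier_Kc] at frequency [l * z]. Its integral in [z] is of order 1 / l,
    which is the origin of the smoothing gain. *)
Definition kern (l z : R) : R := Kc / (1 + l * `|z|) ^+ 2.

Lemma kern_den (l z : R) : 0 < l -> 0 < 1 + l * `|z|.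
Proof. by move=> l0; rewrite ltr_wpDr// mulr_ge0// ltW. Qed.

Lemma kern_ge0 (l z : R) : 0 < l -> 0 <= kern l z.
Proof. by move=> l0; apply: divr_ge0; [exact/ltW/Kc_gt0|exact: sqr_ge0]. Qed.

Lemma continuous_kern (l c : R) : 0 < l -> continuous (fun z : R => kern l (z - c)).
Proof.
move=> l0 z; apply: cvgM; first exact: cvg_cst.
apply: cvgV; first by rewrite gt_eqF// exprn_gt0// kern_den.
have h : (fun z => 1 + l * `|z - c|) @ z --> 1 + l * `|z - c|.
  apply: cvgD; first exact: cvg_cst.
  apply: cvgM; first exact: cvg_cst.
  by apply: cvg_norm; apply: cvgB; [exact: cvg_id|exact: cvg_cst].
by rewrite !expr2; apply: (cvgM h h).
Qed.

Lemma measurable_kern (l : R) : 0 < l -> measurable_fun [set: R] (kern l).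
Proof.
move=> l0; have := @continuous_kern l 0 l0.
under eq_fun do rewrite subr0.
exact: continuous_measurable_fun.
Qed.

Lemma integral_kern_right (l c : R) : 0 < l ->
  (\int[leb]_(z in `[c, +oo[) (kern l (z - c))%:E = (Kc / l)%:E)%E.
Proof.
move=> l0; pose F z : R := - (Kc / l) * (1 + l * (z - c))^-1.
have den z : c <= z -> 0 < 1 + l * (z - c).
  by move=> cz; rewrite ltr_wpDr// mulr_ge0 ?subr_ge0// ltW.
have dF x : c <= x -> is_derive x (1 : R) F (kern l (x - c)).
  move=> cx.
  have d1 : is_derive x (1 : R) (fun z : R => 1 + l * (z - c)) l.
    have h := is_derive_affine l (1 - l * c) x.
    rewrite (_ : (fun z => _) = (fun u => u * l + (1 - l * c)))//.
    by apply/funext => z; ring.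
  have n0 : 1 + l * (x - c) != 0 by rewrite gt_eqF// den.
  have d2 := is_deriveZ (- (Kc / l)) (is_deriveV (f := fun z : R => 1 + l * (z - c)) n0 d1).
  apply: is_derive_eq d2 _; rewrite /GRing.scale /= /kern ger0_norm ?subr_ge0//.
  by field; rewrite n0 gt_eqF.
rewrite (ge0_continuous_FTC2y (F := F) (l := 0)).
- by rewrite /F subrr mulr0 addr0 invr1 mulr1 -EFinB sub0r opprK.
- by move=> x _; exact: kern_ge0.
- exact/continuous_subspaceT/continuous_kern.
- rewrite /F -[X in _ --> X](mulr0 (- (Kc / l))).
  apply: cvgM; first exact: cvg_cst.
  apply/gtr0_cvgV0.
    near=> z; apply: den; near: z; apply: nbhs_pinfty_ge; exact: num_real.
  apply/cvgryPge => A; near=> z.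
  have h : (A - 1) / l + c <= z by near: z; apply: nbhs_pinfty_ge; exact: num_real.
  rewrite -lerBlDl mulrC -ler_pdivrMr// lerBrDr//.
- by move=> x cx; have [] := dF x (ltW cx).
- have [dc _] := dF c (lexx c).
  apply: cvg_at_right_filter.
  by apply: differentiable_continuous; apply/derivable1_diffP.
- move=> x; rewrite in_itv/= andbT => cx.
  by rewrite derive1E; have [] := dF x (ltW cx).
Unshelve. all: by end_near. Qed.

Lemma integral_kern (l c : R) : 0 < l ->
  (\int[leb]_z (kern l (z - c))%:E <= (2 * Kc / l)%:E)%E.
Proof.
move=> l0.
have mk (D : set RR) : measurable_fun D (fun z : RR => (kern l (z - c))%:E).
  apply: measurable_funTS; apply: measurable_EFinT.
  exact: (continuous_measurable_idR (@continuous_kern l c l0)).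
have left : (\int[leb]_(z in `]-oo, c]) (kern l (z - c))%:E = (Kc / l)%:E)%E.
  have := @ge0_integration_by_substitutionNy R (fun z => kern l (z - c)) (- c).
  rewrite opprK => ->.
  - rewrite -(integral_kern_right (- c) l0); apply: eq_integral => x _ /=.
    by rewrite /kern -opprD normrN opprK.
  - exact/continuous_subspaceT/continuous_kern.
  - by move=> x _; exact: kern_ge0.
have -> : [set: RR] = `]-oo, c] `|` `]c, +oo[.
  apply/seteqP; split=> x //= _; rewrite !in_itv/= andbT.
  by case: (leP x c) => ?; [left|right].
rewrite ge0_integral_setU//; first last.
- apply/disj_set2P/seteqP; split=> x //=; rewrite !in_itv/= andbT => -[xc cx].
  by move: cx; rewrite ltNge xc.
- by move=> x _; rewrite lee_fin kern_ge0.
rewrite left (_ : 2 * Kc / l = Kc / l + Kc / l); last by field; rewrite gt_eqF.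
rewrite EFinD leeD2l// -(integral_kern_right c l0).
apply: ge0_subset_integral => //.
- by move=> x _; rewrite lee_fin kern_ge0.
- by move=> x /=; rewrite !in_itv/= !andbT => /ltW.
Qed.

(** The kernel is the Fourier transform of [bump] at [x - x']: a one-variable Plancherel bound,
    localized in position. *)
Lemma osc_bound_linear :
  osc_bound leb leb bump (fun u x : RR => u * x) setT (2 * Kc).
Proof.
have l1 : (0 : R) < 1 by [].
have mk : measurable_fun setT (fun p : RR * RR => kern 1 (p.1 - p.2)).
  by apply: (measurableT_comp (measurable_kern l1)); meas.
apply: (@schur_test R _ RR leb _ RR leb bump (fun u x : RR => u * x) setT
  (fun x x' => kern 1 (x - x'))) => //.
- exact: integrable_bump.
- by meas.
- by rewrite mulr_ge0// ltW// Kc_gt0.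
- by move=> x x'; exact: kern_ge0.
- by move=> x x'; rewrite /kern distrC.
- move=> x x' c _ _; rewrite /kern mul1r.
  under eq_Rintegral do rewrite -mulrBr.
  exact: bump_fourier_Kc.
- move=> x.
  rewrite (_ : (fun x' => _) = (fun z => (kern 1 (z - x))%:E)); last first.
    by apply/funext => z; rewrite /kern distrC.
  by apply: le_trans (integral_kern x l1) _; rewrite divr1.
Qed.

(** The phase difference is proportional to (x - x') (x + x'). These two factors sum to 2 x, so one
    of them has modulus at least [l], and the other is then seen by the Fourier transform of [bump]
    with a dilation of at least [l]. Which factor is large is unknown, so the kernel is the sum of
    both possibilities; each has integral at most 2 Kc / l. *)
Lemma osc_bound_square (sg l : R) : `|sg| = 1 -> 0 < l ->
  osc_bound leb leb bump (fun u x : RR => u * (sg * x ^+ 2))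
    [set x | l <= `|x|] (4 * Kc / l).
Proof.
move=> sg1 l0.
have mk1 : measurable_fun setT (fun p : RR * RR => kern l (p.1 - p.2)).
  by apply: (measurableT_comp (measurable_kern l0)); meas.
have mk2 : measurable_fun setT (fun p : RR * RR => kern l (p.1 + p.2)).
  by apply: (measurableT_comp (measurable_kern l0)); meas.
apply: (@schur_test R _ RR leb _ RR leb bump (fun u x : RR => u * (sg * x ^+ 2)) _
  (fun x x' => kern l (x - x') + kern l (x + x'))) => //.
- exact: integrable_bump.
- by meas.
- by rewrite divr_ge0 ?mulr_ge0// ltW// Kc_gt0.
- by move=> x x'; rewrite addr_ge0// kern_ge0.
- by meas.
- by move=> x x'; rewrite /kern distrC addrC [x + x']addrC addrC.
- move=> x x' c /= lx lx'.
  under eq_Rintegral do rewrite -mulrBr -mulrBr.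
  apply: le_trans (bump_fourier_Kc _ _) _.
  rewrite normrM sg1 mul1r subr_sqr normrM.
  have den (z z' : R) : l <= `|z'| -> Kc / (1 + `|z| * `|z'|) ^+ 2 <= kern l z.
    move=> lz; rewrite /kern ler_wpM2l ?(ltW Kc_gt0)// lef_pV2 ?posrE; last 2 first.
    - by rewrite exprn_gt0// ltr_wpDr// mulr_ge0.
    - by rewrite exprn_gt0// kern_den.
    rewrite ler_pXn2r ?nnegrE ?addr_ge0 ?mulr_ge0// ?(ltW l0)//.
    by rewrite lerD2l mulrC ler_wpM2l.
  have [h|h] := leP l `|x + x'|.
    by apply: le_trans (den (x - x' : R) (x + x' : R) h) _; rewrite lerDl kern_ge0.
  have h' : l <= `|x - x'|.
    rewrite leNgt; apply/negP => h'.
    have : `|(x + x') + (x - x')| < l + l.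
      by apply: le_lt_trans (ler_normD _ _) _; exact: ltrD.
    rewrite (_ : x + x' + (x - x') = 2 * x); last by ring.
    by rewrite normrM ger0_norm//; lra.
  rewrite [`|x - x'| * _]mulrC; apply: le_trans (den (x + x' : R) (x - x' : R) h') _.
  by rewrite lerDr kern_ge0.
- move=> x; rewrite (_ : (fun x' => _) =
    (fun z => (kern l (z - x))%:E + (kern l (z - (- x)))%:E)%E); last first.
    by apply/funext => z; rewrite -EFinD /kern distrC opprK [z + x]addrC.
  have mc (c : R) : measurable_fun [set: RR] (fun z : RR => (kern l (z - c))%:E).
    by apply: measurable_EFinT; exact: (continuous_measurable_idR (@continuous_kern l c l0)).
  rewrite ge0_integralD//; try exact: mc;
    try by move=> z _; rewrite lee_fin kern_ge0.
  rewrite (_ : 4 * Kc / l = 2 * Kc / l + 2 * Kc / l); last by field; rewrite gt_eqF.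
  by rewrite EFinD leeD// integral_kern.
Qed.

End base_bounds.

(** * Bounds in several variables *)

Section transport.
Context {R : realType}.

(** [mu] is the image of [mu'] under [c], expressed as a change of variables for nonnegative
    functions, so that permuting and inserting factors reduces to Tonelli's theorem. *)
Definition transports dX' (X' : measurableType dX') (mu' : set X' -> \bar R)
    dX (X : measurableType dX) (mu : set X -> \bar R) (c : X' -> X) : Prop :=
  measurable_fun setT c /\
  forall f : X -> \bar R, measurable_fun setT f -> (forall x, 0 <= f x)%E ->
    (\int[mu]_x f x = \int[mu']_x f (c x))%E.

Section transported_integrals.
Context dX' (X' : measurableType dX') (mu' : {measure set X' -> \bar R}).
Context dX (X : measurableType dX) (mu : {measure set X -> \bar R}).
Variable c : X' -> X.
Hypothesis tc : transports mu' mu c.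

Lemma integral_transport (f : X -> \bar R) : measurable_fun setT f ->
  (\int[mu]_x f x = \int[mu']_x f (c x))%E.
Proof.
move=> mf; rewrite integralE [RHS]integralE.
rewrite (tc.2 _ (measurable_funepos mf) (funepos_ge0 f)).
rewrite (tc.2 _ (measurable_funeneg mf) (funeneg_ge0 f)).
by congr (_ - _)%E; apply: eq_integral => x _; rewrite ?funeposE ?funenegE.
Qed.

Lemma Rintegral_transport (f : X -> R) : measurable_fun setT f ->
  \int[mu]_x f x = \int[mu']_x f (c x).
Proof.
by move=> mf; rewrite /Rintegral integral_transport//; exact: measurable_EFinT.
Qed.

Lemma integrable_transport (f : X -> R) : mu.-integrable setT (EFin \o f) ->
  mu'.-integrable setT (EFin \o (fun x => f (c x))).
Proof.
move=> /integrableP[mf fi]; apply/integrableP; split.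
  by apply: (measurableT_comp mf); exact: tc.1.
move: fi; rewrite tc.2//; exact: measurableT_comp.
Qed.

Lemma sq_transport (th a : X -> R) : measurable_fun setT th ->
  measurable_fun setT a ->
  sq mu th a = sq mu' (fun x => th (c x)) (fun x => a (c x)).
Proof.
by move=> mth ma; rewrite /sq /fcos /fsin !Rintegral_transport//; meas.
Qed.

End transported_integrals.

(** Bounds are proved on products, where single factors can be split off, and are carried from there
    to tuples. *)
Lemma osc_bound_transport
    dX' (X' : measurableType dX') (mu' : {measure set X' -> \bar R})
    dX (X : measurableType dX) (mu : {sigma_finite_measure set X -> \bar R})
    dY' (Y' : measurableType dY') (nu' : {measure set Y' -> \bar R})
    dY (Y : measurableType dY) (nu : {measure set Y -> \bar R})
    (cX : X' -> X) (cY : Y' -> Y) (v : Y -> R) (Phi : Y -> X -> R)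
    (E : set X) (A : R) :
  transports mu' mu cX -> transports nu' nu cY ->
  (forall y, 0 <= v y) -> measurable_fun setT v ->
  measurable_fun setT (fun p : Y * X => Phi p.1 p.2) ->
  osc_bound mu' nu' (fun y => v (cY y)) (fun y x => Phi (cY y) (cX x))
    (cX @^-1` E) A ->
  osc_bound mu nu v Phi E A.
Proof.
move=> tX tY v0 mv mPhi P a m ia mm aE.
have /measurable_EFinP ma := measurable_int _ ia.
have msq : measurable_fun setT (fun y => sq mu (fun x => Phi y x + m x) a).
  apply: (measurable_sq mu (th := fun y x => Phi y x + m x) (a := fun=> a)); by meas.
rewrite tY.2; first last.
- by move=> y; rewrite lee_fin mulr_ge0// sq_ge0.
- by apply: measurable_EFinT; exact: measurable_funM.
rewrite tX.2; first last.
- by move=> y; rewrite lee_fin sqr_ge0.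
- by meas.
have := P (fun x => a (cX x)) (fun x => m (cX x)) (integrable_transport tX ia).
have mcX := tX.1.
have mmc : measurable_fun setT (fun x => m (cX x)) by meas.
move=> /(_ mmc (fun x nE => aE _ nE)); apply: le_trans.
rewrite le_eqVlt; apply/orP; left; apply/eqP; apply: eq_integral => y _.
by rewrite (sq_transport tX)//; meas.
Qed.

Lemma transports_swap dX1 (X1 : measurableType dX1) dX2 (X2 : measurableType dX2)
    dX (X : measurableType dX)
    (mu1 : {sigma_finite_measure set X1 -> \bar R})
    (mu2 : {sigma_finite_measure set X2 -> \bar R}) (mu : set X -> \bar R)
    (c : X1 * X2 -> X) :
  transports (prodm mu1 mu2) mu c ->
  transports (prodm mu2 mu1) mu (fun x => c (x.2, x.1)).
Proof.
move=> [mc tc]; split; first by meas.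
move=> f mf f0; rewrite tc//.
rewrite (fubini_tonelli2 (fun x => f (c x)))//; last by meas.
rewrite (fubini_tonelli1 (fun x => f (c (x.2, x.1))))//.
by apply: (measurableT_comp mf); meas.
Qed.

(** Time is inserted next to the second factor: this is the grouping demanded by [osc_bound_tensor],
    with time on the side of [y2]. *)
Lemma transports_insert dX1 (X1 : measurableType dX1)
    dX2 (X2 : measurableType dX2) dX (X : measurableType dX)
    dT (T : measurableType dT)
    (mu1 : {sigma_finite_measure set X1 -> \bar R})
    (mu2 : {sigma_finite_measure set X2 -> \bar R})
    (mu : {sigma_finite_measure set X -> \bar R})
    (tau : {sigma_finite_measure set T -> \bar R}) (c : X1 * X2 -> X) :
  transports (prodm mu1 mu2) mu c ->
  transports (prodm mu1 (prodm tau mu2)) (prodm tau mu)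
    (fun x => (x.2.1, c (x.1, x.2.2))).
Proof.
move=> [mc tc]; split; first by meas.
move=> f mf f0.
rewrite (fubini_tonelli1 f)//.
pose g (p : X1 * (T * X2)) := f (p.2.1, c (p.1, p.2.2)).
have mg : measurable_fun setT g.
  by apply: (measurableT_comp mf); meas.
have g0 p : (0 <= g p)%E by exact: f0.
rewrite (fubini_tonelli1 g)//.
pose h (p : X1 * T) := (\int[mu2]_x2 g (p.1, (p.2, x2)))%E.
have mh : measurable_fun setT h.
  apply: (measurable_fun_fubini_tonelli_F
    (fun q : (X1 * T) * X2 => g (q.1.1, (q.1.2, q.2)))).
    by apply: (measurableT_comp mg); meas.
  by move=> q; exact: f0.
transitivity (\int[tau]_t \int[mu1]_x1 h (x1, t))%E.
  apply: eq_integral => t _; rewrite /fubini_F tc; first last.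
  - by move=> x.
  - by apply: (measurableT_comp mf); meas.
  rewrite (fubini_tonelli1 (fun x => f (t, c x)))//.
  by apply: (measurableT_comp mf); meas.
rewrite -(fubini_tonelli h)//; last by move=> p; apply: integral_ge0 => x2 _; exact: f0.
apply: eq_integral => x1 _; rewrite /fubini_F.
rewrite (fubini_tonelli1 (fun y => g (x1, y)))//.
by apply: (measurableT_comp mg); meas.
Qed.

End transport.

Section euclidean.
Context {R : realType}.
Local Notation leb := (@lebesgue_measure R).
Local Notation RR := (measurableTypeR R).
Local Notation mu N := (@lebesgueN R N).

Lemma transports_cons N :
  transports (prodm leb (mu N)) (mu N.+1) (@tuple_of_pair R N).
Proof.
have mc : measurable_fun setT (@tuple_of_pair R N) by exact: measurable_cons.
split=> // f mf f0 /=; rewrite /lebesgue_tupleS.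
by rewrite ge0_integral_pushforward.
Qed.

Definition bumpN N (x : Rn R N) : R := \prod_(j < N) bump (tnth x j).

Lemma measurable_tnthR N (j : 'I_N) : measurable_fun setT (fun x : Rn R N => tnth x j : R).
Proof. exact: (measurableT_comp measurable_idR (@measurable_tnth _ RR N j)). Qed.

Lemma measurable_bump_tnth N (j : 'I_N) :
  measurable_fun setT (fun x : Rn R N => bump (tnth x j) : R).
Proof. exact: (measurableT_comp measurable_bump (@measurable_tnth _ RR N j)). Qed.

(** Signs are arbitrary coefficients here, so that the family is stable under removing the first
    coordinate, as the induction on [N] requires; [phase] has its first two signs prescribed. *)
Definition qphase N (sg : 'I_N -> R) (xi : Rn R N) : R :=
  \sum_(j < N) sg j * tnth xi j ^+ 2.

Lemma dotp_cons N (x xi : RR * Rn R N) :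
  dotp (tuple_of_pair x) (tuple_of_pair xi) = x.1 * xi.1 + dotp x.2 xi.2.
Proof.
rewrite /dotp big_ord_recl !tnth0; congr (_ + _).
by apply: eq_bigr => j _; rewrite !tnthS.
Qed.

Lemma bumpN_cons N (x : RR * Rn R N) :
  bumpN (tuple_of_pair x) = bump x.1 * bumpN x.2.
Proof.
rewrite /bumpN big_ord_recl tnth0; congr (_ * _).
by apply: eq_bigr => j _; rewrite tnthS.
Qed.

Lemma qphase_cons N (sg : 'I_N.+1 -> R) (xi : RR * Rn R N) :
  qphase sg (tuple_of_pair xi) =
  sg ord0 * xi.1 ^+ 2 + qphase (fun j => sg (lift ord0 j)) xi.2.
Proof.
rewrite /qphase big_ord_recl tnth0; congr (_ + _).
by apply: eq_bigr => j _; rewrite tnthS.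
Qed.

Lemma bumpN_ge0 N (x : Rn R N) : 0 <= bumpN x.
Proof. by apply: prodr_ge0 => j _; exact: bump_ge0. Qed.

Lemma bumpN_ge1 N (x : Rn R N) : (forall j, -1 <= tnth x j <= 2) -> 1 <= bumpN x.
Proof.
move=> h; rewrite /bumpN; elim/big_ind: _ => // [a b a1 b1|j _]; last exact: bump_ge1.
by rewrite -[leLHS]mulr1 ler_pM.
Qed.

Lemma measurable_prod_seq d (T : measurableType d) I (s : seq I) (f : I -> T -> R) :
  (forall i, measurable_fun setT (f i)) ->
  measurable_fun setT (fun x => \prod_(i <- s) f i x).
Proof.
move=> mf; elim: s => [|i s IH].
  by under eq_fun do rewrite big_nil; exact: measurable_cst.
by under eq_fun do rewrite big_cons; exact: measurable_funM.
Qed.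

Lemma measurable_bumpN N : measurable_fun setT (@bumpN N).
Proof. by apply: measurable_prod_seq => j; exact: measurable_bump_tnth. Qed.

Lemma measurable_sum_seq d (T : measurableType d) I (s : seq I) (f : I -> T -> R) :
  (forall i, measurable_fun setT (f i)) ->
  measurable_fun setT (fun x => \sum_(i <- s) f i x).
Proof.
move=> mf; elim: s => [|i s IH].
  by under eq_fun do rewrite big_nil; exact: measurable_cst.
by under eq_fun do rewrite big_cons; exact: measurable_funD.
Qed.

Lemma measurable_dotp N : measurable_fun setT (fun p : Rn R N * Rn R N => dotp p.1 p.2).
Proof.
apply: measurable_sum_seq => j; have mj := measurable_tnthR j.
by apply: measurable_funM; apply: (measurableT_comp mj); meas.
Qed.

Lemma measurable_qphase N (sg : 'I_N -> R) : measurable_fun setT (qphase sg).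
Proof.
apply: measurable_sum_seq => j; have mj := measurable_tnthR j.
by apply: measurable_funM; meas.
Qed.

(** This is the estimate at a fixed time: the quadratic phase then depends on the frequency alone
    and is a possible free phase. *)
Lemma osc_bound_dotp N : exists2 A : R, 0 <= A &
  osc_bound (mu N) (mu N) (@bumpN N) (@dotp R N) setT A.
Proof.
elim: N => [|N [A A0 IH]].
  (* In dimension 0 the measure is the Dirac mass at the empty tuple, and both sides equal [a
     [tuple] ^+ 2]. *)
  exists 1 => // a m ia mm _.
  have /measurable_EFinP ma := measurable_int _ ia.
  have Rd (f : Rn R 0 -> R) : measurable_fun setT f -> \int[mu 0]_x f x = f [tuple].
    move=> mf; rewrite /Rintegral /= integral_dirac//; last exact: measurable_EFinT.
    by rewrite diracT mul1e.
  have md (y : Rn R 0) : measurable_fun setT (@dotp R 0 y).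
    by apply: (measurable_fun2r y (@measurable_dotp 0)).
  have sqE y : sq (mu 0) (fun x => dotp y x + m x) a = a [tuple] ^+ 2.
    have mdy := md y.
    rewrite /sq /fcos /fsin !Rd; [|by meas|by meas].
    by rewrite !exprMn -mulrDl cos2Dsin2 mul1r.
  rewrite mul1e; under eq_integral do rewrite sqE.
  rewrite /= !integral_dirac//; last 2 first.
  - by meas.
  - by have mb := @measurable_bumpN 0; meas.
  by rewrite !diracT !mul1e /bumpN big_ord0 mul1r.
exists (2 * (2 * Kc) * A); first by rewrite !mulr_ge0// ltW// Kc_gt0.
apply: (osc_bound_transport (transports_cons N) (transports_cons N)).
- exact: bumpN_ge0.
- exact: measurable_bumpN.
- exact: measurable_dotp.
have H := @osc_bound_tensor R _ RR leb _ (Rn R N) (mu N) _ RR leb _ (Rn R N) (mu N)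
  bump (@bumpN N) (fun u x => u * x) (@dotp R N) (fun _ _ => 0) setT setT (2 * Kc) A.
move=> a m ia mm aE.
have {H} := H _ A0 bump_ge0 (@bumpN_ge0 N) measurable_bump (@measurable_bumpN N) _
  (@measurable_dotp N) (measurable_cst _) osc_bound_linear IH a m ia mm.
rewrite setXTT => /(_ _ _ (fun x nT => False_ind _ (nT I))) h.
apply: le_trans (h _ _).
- rewrite le_eqVlt; apply/orP; left; apply/eqP; apply: eq_integral => y _.
  rewrite bumpN_cons; apply/congr1/(congr2 *%R) => //; apply: eq_sq => x.
  by rewrite dotp_cons addr0.
- by rewrite mulr_ge0// ltW// Kc_gt0.
- by meas.
Qed.

(** For each [t] the phase [psi t] is absorbed by the free phase, so the bound is uniform in [t] and
    is simply integrated against [w]. The parameter is a position in [osc_bound_smoothing1] and the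
    time in [wave_time_window]. *)
Lemma osc_bound_param dX (X : measurableType dX) dY (Y : measurableType dY)
    dT (T : measurableType dT)
    (nuX : {sigma_finite_measure set X -> \bar R})
    (nuY : {sigma_finite_measure set Y -> \bar R})
    (tau : {sigma_finite_measure set T -> \bar R})
    (v : Y -> R) (w : T -> R) (Phi : Y -> X -> R) (psi : T -> X -> R)
    (E : set X) (A : R) :
  (forall y, 0 <= v y) -> measurable_fun setT v ->
  (forall t, 0 <= w t) -> tau.-integrable setT (EFin \o w) ->
  measurable_fun setT (fun p : Y * X => Phi p.1 p.2) ->
  measurable_fun setT (fun p : T * X => psi p.1 p.2) ->
  0 <= A -> osc_bound nuX nuY v Phi E A ->
  osc_bound nuX (prodm nuY tau) (fun y => v y.1 * w y.2)
    (fun y x => psi y.2 x + Phi y.1 x) E ((\int[tau]_t w t) * A).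
Proof.
move=> v0 mv w0 iw mPhi mpsi A0 P a m ia mm aE.
have /measurable_EFinP ma := measurable_int _ ia.
have /measurable_EFinP mw := measurable_int _ iw.
have mth : measurable_fun setT (fun p : (Y * T) * X =>
    psi p.1.2 p.2 + Phi p.1.1 p.2 + m p.2) by meas.
have msq : measurable_fun setT (fun y : Y * T =>
    sq nuX (fun x => psi y.2 x + Phi y.1 x + m x) a).
  apply: (measurable_sq nuX (th := fun (y : Y * T) x =>
    psi y.2 x + Phi y.1 x + m x) (a := fun _ : Y * T => a)); by meas.
pose G (y : Y * T) := (v y.1 * w y.2 *
  sq nuX (fun x => psi y.2 x + Phi y.1 x + m x) a)%:E.
have G0 y : (0 <= G y)%E by rewrite lee_fin mulr_ge0 ?sq_ge0// mulr_ge0.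
have mG : measurable_fun setT G.
  by apply: measurable_EFinT; apply: measurable_funM => //; meas.
rewrite (fubini_tonelli2 G)//.
have I0 : (0 <= \int[nuX]_x (a x ^+ 2)%:E)%E.
  by apply: integral_ge0 => x _; rewrite lee_fin sqr_ge0.
apply: (@le_trans _ _ (\int[tau]_t ((w t)%:E * (A%:E * \int[nuX]_x (a x ^+ 2)%:E)))%E).
  apply: ge0_le_integral => //.
  - by move=> t _; apply: integral_ge0.
  - exact: measurable_fun_fubini_tonelli_G.
  - apply: emeasurable_funM; first by meas.
    exact: measurable_cst.
  move=> t _; rewrite /fubini_G /G /=.
  pose mt x := psi t x + m x.
  have mmt : measurable_fun setT mt by rewrite /mt; meas.
  rewrite (_ : (fun y => _) = (fun y => (w t)%:E *
      (v y * sq nuX (fun x => Phi y x + mt x) a)%:E)%E); last first.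
    apply/funext => y; rewrite -EFinM; congr EFin; rewrite mulrA [w t * _]mulrC.
    by apply: (congr2 *%R) => //; apply: eq_sq => x; rewrite /mt; ring.
  have msq1 : measurable_fun setT (fun y : Y => sq nuX (fun x => Phi y x + mt x) a).
    apply: (measurable_sq nuX (th := fun (y : Y) x => Phi y x + mt x)
      (a := fun _ : Y => a)); by meas.
  rewrite ge0_integralZl//; first last.
  - by rewrite lee_fin.
  - by move=> y _; rewrite lee_fin mulr_ge0// sq_ge0.
  - by apply: measurable_EFinT; apply: measurable_funM.
  by apply: lee_wpmul2l; [rewrite lee_fin|exact: P].
rewrite ge0_integralZr//; first last.
- by rewrite mule_ge0// lee_fin.
- by move=> t _; rewrite lee_fin.
- by meas.
by rewrite EFinM -muleA /Rintegral fineK//; exact: integrable_fin_num iw.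
Qed.

Let bumpI := \int[leb]_u bump u.

Let bumpI0 : 0 <= bumpI.
Proof. by apply: Rintegral_ge0 => u _; exact: bump_ge0. Qed.

(** The roles are exchanged: the position [y.2] is a mere parameter, and the oscillation in the time
    [y.1] against the squared frequency provides the bound. *)
Lemma osc_bound_smoothing1 (sg l : R) : `|sg| = 1 -> 0 < l ->
  osc_bound leb (prodm leb leb) (fun y : RR * RR => bump y.1 * bump y.2)
    (fun y x => y.2 * x + y.1 * (sg * x ^+ 2)) [set x : RR | l <= `|x|]
    (bumpI * (4 * Kc / l)).
Proof.
move=> sg1 l0.
apply: (@osc_bound_param _ RR _ RR _ RR leb leb leb bump bump
  (fun y x => y * (sg * x ^+ 2)) (fun t x => t * x)).
- exact: bump_ge0.
- exact: measurable_bump.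
- exact: bump_ge0.
- exact: integrable_bump.
- by meas.
- by meas.
- by rewrite divr_ge0 ?mulr_ge0// ltW// Kc_gt0.
- exact: osc_bound_square.
Qed.

(** Time is paired with the frequency coordinate [j], and every other coordinate with its own
    position. The constant [A] is fixed before [l], so the gain 1 / l is uniform. *)
Lemma osc_bound_smoothing N (sg : 'I_N -> R) (j : 'I_N) :
  (forall i, `|sg i| = 1) ->
  exists2 A : R, 0 <= A & forall l, 0 < l ->
  osc_bound (mu N) (prodm leb (mu N)) (fun y : RR * Rn R N => bump y.1 * bumpN y.2)
    (fun y xi => dotp y.2 xi + y.1 * qphase sg xi)
    [set xi | l <= `|tnth xi j : R| ] (A / l).
Proof.
elim: N sg j => [sg []//|N IH] sg j sg1.
have mW := @measurable_bumpN N; have mW1 := @measurable_bumpN N.+1.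
have md := @measurable_dotp N; have md1 := @measurable_dotp N.+1.
have mq1 := measurable_qphase sg.
pose sg' i := sg (lift ord0 i).
have mq := measurable_qphase sg'.
have mb := @measurable_bump R.
have tX := transports_cons N.
have vT : measurable_fun setT (fun y : RR * Rn R N.+1 => bump y.1 * bumpN y.2).
  by meas.
have vT0 (y : RR * Rn R N.+1) : 0 <= bump y.1 * bumpN y.2.
  by rewrite mulr_ge0 ?bump_ge0 ?bumpN_ge0.
have mPhi : measurable_fun setT (fun p : (RR * Rn R N.+1) * Rn R N.+1 =>
    dotp p.1.2 p.2 + p.1.1 * qphase sg p.2).
  by meas.
have Kc0 := ltW (@Kc_gt0 R).
(* If [j] is not the first coordinate, time stays with the remaining ones. The first pair
   contributes its linear bound, and its term t xi_1^2 is the coupling. *)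
case: (unliftP ord0 j) => [i|] ->.
  have [A A0 {}IH] := IH sg' i (fun i => sg1 _).
  exists (2 * (2 * Kc) * A); first by rewrite !mulr_ge0.
  move=> l l0.
  apply: (osc_bound_transport tX (transports_insert leb tX)) => //.
  have Al : 0 <= A / l by rewrite divr_ge0// ltW.
  have H := @osc_bound_tensor R _ RR leb _ (Rn R N) (mu N) _ RR leb _
    (RR * Rn R N)%type (prodm leb (mu N)) bump (fun y => bump y.1 * bumpN y.2)
    (fun u x => u * x) (fun y xi => dotp y.2 xi + y.1 * qphase sg' xi)
    (fun y x => y.1 * (sg ord0 * x ^+ 2)) setT _ (2 * Kc) (A / l) _ Al bump_ge0
    _ measurable_bump _ _ _ _ osc_bound_linear (IH l l0).
  move=> a m ia mm aE; rewrite -[2 * _ * A * _]mulrA.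
  apply: le_trans (H _ _ _ _ _ _ a m ia mm _).
  - rewrite le_eqVlt; apply/orP; left; apply/eqP; apply: eq_integral => y _ /=.
    rewrite bumpN_cons /= mulrCA; apply/congr1/(congr2 *%R) => //; apply: eq_sq => x.
    by rewrite dotp_cons qphase_cons /= -/sg'; ring.
  - by rewrite mulr_ge0.
  - by move=> y; rewrite mulr_ge0 ?bump_ge0 ?bumpN_ge0.
  - by meas.
  - by meas.
  - by meas.
  - by meas.
  - move=> x nE; apply: aE => /=; rewrite tnthS => h; apply: nE; split => //.
(* If [j] is the first coordinate, the factors are swapped so that time sits in the second factor
   beside it. The quadratic phase of all other coordinates is now the coupling. *)
have [A A0 IHd] := osc_bound_dotp N.
exists (2 * A * (bumpI * (4 * Kc))); first by rewrite !mulr_ge0.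
move=> l l0.
apply: (osc_bound_transport (transports_swap tX)
  (transports_insert leb (transports_swap tX))) => //.
have Al : 0 <= bumpI * (4 * Kc / l) by rewrite mulr_ge0// divr_ge0 ?mulr_ge0// ltW.
have H := @osc_bound_tensor R _ (Rn R N) (mu N) _ RR leb _ (Rn R N) (mu N) _
  (RR * RR)%type (prodm leb leb) (@bumpN N) (fun y => bump y.1 * bump y.2)
  (@dotp R N) (fun y x => y.2 * x + y.1 * (sg ord0 * x ^+ 2))
  (fun y xi => y.1 * qphase sg' xi) setT _ A _ A0 Al (@bumpN_ge0 N) _
  (@measurable_bumpN N) _ (@measurable_dotp N) _ _ IHd
  (osc_bound_smoothing1 (sg1 ord0) l0).
move=> a m ia mm aE.
rewrite (_ : 2 * A * (bumpI * (4 * Kc)) / l = 2 * A * (bumpI * (4 * Kc / l))); last by ring.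
apply: le_trans (H _ _ _ _ a m ia mm _).
- rewrite le_eqVlt; apply/orP; left; apply/eqP; apply: eq_integral => y _ /=.
  rewrite bumpN_cons /= mulrA [X in (X * _)%:E = _]mulrC.
  apply/congr1/(congr2 *%R) => //; apply: eq_sq => x.
  by rewrite dotp_cons qphase_cons /= -/sg'; ring.
- by move=> y; rewrite mulr_ge0 ?bump_ge0.
- by meas.
- by meas.
- by meas.
- move=> x nE; apply: aE => /=; rewrite tnth0 => h; apply: nE; split => //.
Qed.

End euclidean.

(** * Time windows *)

Section window.
Context {R : realType}.
Local Notation leb := (@lebesgue_measure R).
Local Notation RR := (measurableTypeR R).

Lemma sin_le (y : R) : 0 <= y -> sin y <= y.
Proof.
rewrite le_eqVlt => /predU1P[<-|y0]; first by rewrite sin0.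
have [c _] := @MVT R sin cos 0 y y0 (fun x _ => is_derive_sin x)
  (continuous_subspaceT (@continuous_sin R)).
rewrite sin0 !subr0 => ->; rewrite ler_piMl ?cos_le1//; exact: ltW.
Qed.

(** By the mean value theorem it suffices that the cosine is at least 1/2 on [0, 1], which follows
    from cos c = 1 - 2 sin(c/2)^2 and sin(c/2) <= c/2. *)
Lemma sin_ge_half (y : R) : 0 <= y <= 1 -> y / 2 <= sin y.
Proof.
case/andP; rewrite le_eqVlt => /predU1P[<-|y0] y1; first by rewrite sin0 mul0r.
have [c] := @MVT R sin cos 0 y y0 (fun x _ => is_derive_sin x)
  (continuous_subspaceT (@continuous_sin R)).
rewrite in_itv/= => /andP[c0 cy]; rewrite sin0 !subr0 => ->.
rewrite mulrC ler_wpM2r ?(ltW y0)//.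
have c2 : sin (c / 2) <= c / 2 by apply: sin_le; lra.
have s0 : 0 <= sin (c / 2).
  by apply: sin_ge0_pi; have := @pi_ge2 R; lra.
have : cos c = 1 - 2 * sin (c / 2) ^+ 2.
  rewrite [in LHS](_ : c = c / 2 + c / 2); last by lra.
  by rewrite cosD -!expr2; have := cos2Dsin2 (c / 2); lra.
nra.
Qed.

(* y / sin y for |y| <= 1, with the value 1 at 0 *)
Definition sinc_inv (y : R) : R := `|y| * `|sin y| `^ (- 1) + \1_[set 0] y.

Lemma measurable_sinc_inv : measurable_fun setT sinc_inv.
Proof.
apply: measurable_funD.
  apply: measurable_funM; first exact: normr_measurable.
  have ms := continuous_measurable_fun (@continuous_sin R).
  have mns := measurableT_comp (@normr_measurable R setT) ms.
  exact: (measurableT_comp (measurable_powR (- 1)) mns).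
exact: measurable_indic.
Qed.

Lemma sinc_invE (y : R) : `|y| <= 1 -> sinc_inv y * sin y = y /\ 0 <= sinc_inv y <= 2.
Proof.
move=> y1; rewrite /sinc_inv indicE.
have [->|y0] := eqVneq y 0.
  by rewrite sin0 mulr0 normr0 mul0r add0r mem_set//=; split=> //; lra.
rewrite memNset/=; last exact/eqP.
rewrite addr0 powR_inv1//.
have ny : 0 < `|y| by rewrite normr_gt0.
have sy : `|sin y| = sin `|y|.
  have h : 0 <= sin `|y| by apply: sin_ge0_pi; have := @pi_ge2 R; lra.
  have [y_ge|y_lt] := leP 0 y.
    by move: h; rewrite (ger0_norm y_ge) => h; rewrite ger0_norm.
  move: h; rewrite (ltr0_norm y_lt) sinN => h; rewrite ler0_norm//.
  by rewrite -oppr_ge0.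
have half : `|y| / 2 <= `|sin y| by rewrite sy sin_ge_half// ltW.
have s0 : 0 < `|sin y| by lra.
split; last first.
  by rewrite divr_ge0//= ler_pdivrMr//; lra.
have sn0 : sin y != 0 by rewrite -normr_gt0.
have [y_ge|y_lt] := leP 0 y.
  rewrite sy ger0_norm//; move: sn0; rewrite -/(y / sin y) => sn0.
  by rewrite mulfVK.
have : `|sin y| = - sin y by rewrite sy ltr0_norm// sinN.
by move=> ->; rewrite ltr0_norm// invrN mulrNN mulfVK.
Qed.

(** The mean of cos(tau ph + al) over the window is sin(d ph) / (d ph) times its value at the
    centre, and [sinc_inv] cancels this factor exactly. The condition on [d * ph] keeps away from
    the nonzero zeros of the sine. *)
Lemma integral_window (t d al ph : R) : 0 < d -> `|d * ph| <= 1 ->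
  (\int[leb]_(tau in `[(t - d)%R, (t + d)%R])
     (cos (tau * ph + al) * sinc_inv (d * ph))%:E = (2 * d * cos (t * ph + al))%:E)%E.
Proof.
move=> d0 dph; have [e _] := sinc_invE dph.
have ltd : t - d < t + d by rewrite ltrBlDr -addrA ltrDl addr_gt0.
have cc : continuous (fun tau : R => cos (tau * ph + al) * sinc_inv (d * ph)).
  have cc := is_derive_continuous (is_derive_cos_affine ph al).
  by move=> x; apply: cvgM; [exact: cc|exact: cvg_cst].
(* The sine antiderivative divides by [ph], so the constant integrand is treated apart. *)
have [ph0|ph0] := eqVneq ph 0.
  have dF (x : R) : is_derive x (1 : R) (fun u : R => u * (cos al) + 0)
      (cos (x * ph + al) * sinc_inv (d * ph)).
    apply: is_derive_eq (is_derive_affine _ _ _) _.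
    by rewrite ph0 !mulr0 add0r /sinc_inv normr0 mul0r add0r indicE mem_set//= mulr1.
  rewrite (FTC2 ltd dF cc); congr EFin; rewrite ph0 mulr0 add0r; ring.
have dF (x : R) : is_derive x (1 : R)
    ((ph^-1 * sinc_inv (d * ph)) \*: (fun u : R => sin (u * ph + al)))
    (cos (x * ph + al) * sinc_inv (d * ph)).
  apply: is_derive_eq (is_deriveZ _ (is_derive_sin_affine ph al x)) _.
  by rewrite /GRing.scale /=; field.
rewrite (FTC2 ltd dF cc) /GRing.scale /=; congr EFin.
rewrite (_ : (t + d) * ph + al = (t * ph + al) + d * ph); last by ring.
rewrite (_ : (t - d) * ph + al = (t * ph + al) - d * ph); last by ring.
have scE (x y : R) : x *: (y : R^o) = x * y by [].
rewrite sinD sinB !scE.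
transitivity (ph^-1 * 2 * cos (t * ph + al) * (sinc_inv (d * ph) * sin (d * ph))).
  by ring.
by rewrite e; field.
Qed.

End window.

Section window_average.
Context {R : realType}.
Local Notation leb := (@lebesgue_measure R).
Local Notation RR := (measurableTypeR R).
Context dX (X : measurableType dX) (mu : {sigma_finite_measure set X -> \bar R}).
Variables (al ph a : X -> R) (t d : R).
Hypothesis mal : measurable_fun setT al.
Hypothesis mph : measurable_fun setT ph.
Hypothesis ia : mu.-integrable setT (EFin \o a).
Hypothesis d0 : 0 < d.
Hypothesis aph : forall x, a x != 0 -> `|d * ph x| <= 1.

(* Averaging e^(i u ph) over u in [t - d, t + d] multiplies it at u = t by
   sin (d ph) / (d ph), which this multiplier undoes. *)
Definition sinc_mul : X -> R := fun x => sinc_inv (d * ph x) * a x.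

Let ma : measurable_fun setT a.
Proof. by have /measurable_EFinP := measurable_int _ ia. Qed.

Lemma sinc_mul_le x : `|sinc_mul x| <= 2 * `|a x|.
Proof.
rewrite /sinc_mul; have [->|ax] := eqVneq (a x) 0; first by rewrite mulr0 normr0 mulr0.
have [_ /andP[q0 q2]] := sinc_invE (aph ax).
by rewrite normrM (ger0_norm q0) ler_wpM2r.
Qed.

Lemma measurable_sinc_mul : measurable_fun setT sinc_mul.
Proof.
apply: measurable_funM => //; apply: (measurableT_comp measurable_sinc_inv).
by meas.
Qed.

Lemma integrable_sinc_mul : mu.-integrable setT (EFin \o sinc_mul).
Proof.
have i2 := integrableZlr 2 ia.
apply: le_integrable i2 => //.
  by apply: measurable_EFinT; exact: measurable_sinc_mul.
by move=> x _ /=; rewrite lee_fin [leRHS]normrM [`|2|]ger0_norm// sinc_mul_le.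
Qed.

Let I : set RR := `[(t - d)%R, (t + d)%R].

Let iI : leb.-integrable setT (EFin \o (\1_I : RR -> R)).
Proof. exact: integrable_indic_itv. Qed.

Let mI : measurable_fun setT (\1_I : RR -> R).
Proof. by have /measurable_EFinP := measurable_int _ iI. Qed.

Let mIs : measurable I.
Proof. exact: measurable_itv. Qed.

Let RintI : \int[leb]_u (\1_I u : R) = 2 * d.
Proof.
have ltd : t - d < t + d by rewrite ltrBlDr -addrA ltrDl addr_gt0.
have e : leb I = (2 * d)%:E.
  rewrite [LHS](lebesgue_measure_itv `[(t - d)%R, (t + d)%R]) /= lte_fin ifT; last exact: ltd.
  by rewrite -EFinD; congr EFin; ring.
transitivity (fine (leb I)); last by rewrite e.
by rewrite /Rintegral integral_indic// setIT.
Qed.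

Lemma fcos_window (be : X -> R) : measurable_fun setT be ->
  2 * d * fcos mu (fun x => t * ph x + be x) a =
  \int[leb]_tau (\1_I tau * fcos mu (fun x => tau * ph x + be x) sinc_mul).
Proof.
move=> mbe; have is_ := integrable_sinc_mul.
pose H (z : RR * X) : R := cos (z.1 * ph z.2 + be z.2) * (\1_I z.1 * sinc_mul z.2).
have iH : (leb \x mu)%E.-integrable setT (EFin \o H).
  apply: integrable_cosM; first by meas.
  exact: (integrable_tensor (f := \1_I : RR -> R) iI is_).
have mc : measurable_fun setT (fun x => t * ph x + be x) by meas.
rewrite -(RintegralZl _ _ (integrable_cosM mc ia))//.
transitivity (\int[(leb \x mu)%E]_z H z); last first.
  rewrite (Rfubini iH); apply: eq_Rintegral => tau _.
  have mct : measurable_fun setT (fun x => tau * ph x + be x) by meas.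
  rewrite -(RintegralZl _ _ (integrable_cosM mct is_))//.
  by apply: eq_Rintegral => x _; rewrite /H /= mulrCA.
rewrite (Rfubini2 iH); apply: eq_Rintegral => x _.
have [ax|ax] := eqVneq (a x) 0.
  rewrite ax !mulr0; under eq_Rintegral do rewrite /H /sinc_mul /= ax !mulr0.
  by rewrite Rintegral_cst// mul0r.
have W := integral_window t (be x) d0 (aph ax).
rewrite (_ : 2 * d * (cos (t * ph x + be x) * a x) =
  a x * (2 * d * cos (t * ph x + be x))); last by ring.
have -> : 2 * d * cos (t * ph x + be x) = \int[leb]_(tau in I)
    (cos (tau * ph x + be x) * sinc_inv (d * ph x)) by rewrite /Rintegral W.
have mta : measurable_fun setT (fun tau : RR => tau * ph x + be x) by meas.
have iK := integrable_cosM mta (integrableZlr (sinc_inv (d * ph x)) iI).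
rewrite Rintegral_mkcond -RintegralZl//; last first.
  apply: eq_integrable iK => // tau _ /=; rewrite patchE indicE.
  by case: ifPn => _; rewrite ?mulr1 ?mulr0.
apply: eq_Rintegral => tau _; rewrite /H /sinc_mul /= patchE indicE.
by case: ifPn => _; rewrite /= ?mulr0 ?mul0r ?mulr0//; ring.
Qed.

(** Cauchy-Schwarz on the window in tangent form: [F ^+ 2] is at least 2 c F - c^2, and integrating
    this lower bound gives exactly 2 d c^2. *)
Lemma window_jensen (F : RR -> R) (c M : R) : measurable_fun setT F ->
  (forall u, `|F u| <= M) -> 2 * d * c = \int[leb]_u (\1_I u * F u) ->
  (((2 * d) * c ^+ 2)%:E <= \int[leb]_u (\1_I u * F u ^+ 2)%:E)%E.
Proof.
move=> mF FM cE.
have M0 : 0 <= M by apply: le_trans (FM 0).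
have iF : leb.-integrable setT (EFin \o (fun u => \1_I u * F u)).
  apply: le_integrable (integrableZlr M iI) => //; first by meas.
  move=> u _ /=; rewrite lee_fin !normrM mulrC ler_wpM2r//.
  by apply: le_trans (FM u) _; exact: ler_norm.
have iF2 : leb.-integrable setT (EFin \o (fun u => \1_I u * F u ^+ 2)).
  apply: le_integrable (integrableZlr (M ^+ 2) iI) => //; first by meas.
  move=> u _ /=; rewrite lee_fin [leLHS]normrM [leRHS]normrM mulrC ler_wpM2r//.
  by rewrite (ger0_norm (sqr_ge0 M)) normrX ler_pXn2r ?nnegrE.
rewrite -[leRHS]fineK; last exact: integrable_fin_num iF2.
rewrite lee_fin -/(Rintegral _ _ _).
have -> : 2 * d * c ^+ 2 = \int[leb]_u (2 * c * (\1_I u * F u) + - c ^+ 2 * \1_I u).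
  rewrite (RintegralD _ (integrableZlr (2 * c) iF) (integrableZlr (- c ^+ 2) iI))//.
  by rewrite !RintegralZl// -cE RintI; ring.
apply: le_Rintegral => //.
  exact: (integrableDr (integrableZlr (2 * c) iF) (integrableZlr (- c ^+ 2) iI)).
move=> u _; have : 0 <= (\1_I u : R) by [].
by have := sqr_ge0 (F u - c); nra.
Qed.

(** A sine integral is a cosine integral with a shifted phase, so the window estimates are needed
    for [fcos] only, with an arbitrary additive phase [be]. *)
Lemma fsinE (th b : X -> R) : fsin mu th b = fcos mu (fun x => th x + - (pi / 2)) b.
Proof.
by apply: eq_Rintegral => x _; rewrite cosB cos_pihalf sin_pihalf mulr0 add0r mulr1.
Qed.

Lemma abs_fcos_le (th b : X -> R) : measurable_fun setT th ->
  mu.-integrable setT (EFin \o b) -> `|fcos mu th b| <= \int[mu]_x `|b x|.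
Proof.
move=> mth ib; have ic := integrable_cosM mth ib.
apply: le_trans (le_normr_Rintegral _ ic) _ => //.
apply: le_Rintegral => //; [exact: integrable_norm ic|exact: integrable_norm|].
by move=> x _; rewrite normrM ler_piMl// abs_cos_le1.
Qed.

Lemma fcos_window_le (be : X -> R) : measurable_fun setT be ->
  (((2 * d) * fcos mu (fun x => t * ph x + be x) a ^+ 2)%:E <=
  \int[leb]_u (\1_I u * fcos mu (fun x => u * ph x + be x) sinc_mul ^+ 2)%:E)%E.
Proof.
move=> mbe; have msm := measurable_sinc_mul.
apply: (window_jensen (F := fun u : RR => fcos mu (fun x => u * ph x + be x) sinc_mul)
  (M := \int[mu]_x `|sinc_mul x|)).
- apply: (measurable_fcos mu (th := fun (u : RR) x => u * ph x + be x)
    (a := fun _ : RR => sinc_mul)); by meas.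
- have mth (w : R) : measurable_fun setT (fun x => w * ph x + be x) by meas.
  move=> u; apply: abs_fcos_le; first exact: mth.
  exact: integrable_sinc_mul.
- exact: fcos_window.
Qed.

(** The weight [v] may be any majorant of the indicator of the window. A single [v] covering the
    windows of many times turns their supremum into one integral in time. *)
Lemma sq_window (v : RR -> R) : measurable_fun setT v ->
  (forall u, \1_I u <= v u) ->
  ((sq mu (fun x => al x + t * ph x) a)%:E <= (2 * d)^-1%:E *
    \int[leb]_u (v u * sq mu (fun x => al x + u * ph x) sinc_mul)%:E)%E.
Proof.
move=> mv Iv; have msm := measurable_sinc_mul.
pose be x := al x + - (pi / 2).
have mbe : measurable_fun setT be by rewrite /be; meas.
have sqE u b : sq mu (fun x => al x + u * ph x) b =
    fcos mu (fun x => u * ph x + al x) b ^+ 2 + fcos mu (fun x => u * ph x + be x) b ^+ 2.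
  rewrite /sq fsinE; congr (_ ^+ 2 + _ ^+ 2); apply: eq_Rintegral => x _.
    by rewrite addrC.
  by rewrite /be [al x + _]addrC addrA.
have mf (b : X -> R) : measurable_fun setT b ->
    measurable_fun setT (fun u : RR => fcos mu (fun x => u * ph x + b x) sinc_mul).
  move=> mb; apply: (measurable_fcos mu (th := fun (u : RR) x => u * ph x + b x)
    (a := fun _ : RR => sinc_mul)); by meas.
have mf1 := mf _ mal; have mf2 := mf _ mbe.
have I0 u : 0 <= (\1_I u : R) by [].
have h1 := fcos_window_le mal; have h2 := fcos_window_le mbe.
have h : ((2 * d * sq mu (fun x => al x + t * ph x) a)%:E <=
    \int[leb]_u (v u * sq mu (fun x => al x + u * ph x) sinc_mul)%:E)%E.
  rewrite sqE mulrDr EFinD; apply: le_trans (leeD h1 h2) _.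
  rewrite -ge0_integralD//; first last.
  - by apply: measurable_EFinT; apply: measurable_funM => //; exact: measurable_funX.
  - by move=> u _; rewrite lee_fin mulr_ge0// sqr_ge0.
  - by apply: measurable_EFinT; apply: measurable_funM => //; exact: measurable_funX.
  - by move=> u _; rewrite lee_fin mulr_ge0// sqr_ge0.
  under [leRHS]eq_integral do rewrite sqE.
  apply: ge0_le_integral => //.
  - by move=> u _; rewrite -EFinD lee_fin addr_ge0// mulr_ge0// sqr_ge0.
  - by apply: emeasurable_funD; apply: measurable_EFinT; apply: measurable_funM => //;
      exact: measurable_funX.
  - by apply: measurable_EFinT; apply: measurable_funM => //; apply: measurable_funD;
      exact: measurable_funX.
  move=> u _; rewrite -EFinD lee_fin -mulrDr ler_wpM2r//.
  by rewrite addr_ge0// sqr_ge0.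
have d2 : 0 < 2 * d by rewrite mulr_gt0.
apply: le_trans (lee_wpmul2l _ h); last by rewrite lee_fin invr_ge0 ltW.
by rewrite -EFinM lee_fin mulKf// gt_eqF.
Qed.

End window_average.

(** * Unions of frequency supports *)

Section osc_bound_union.
Context {R : realType}.
Context dX (X : measurableType dX) (mu : {sigma_finite_measure set X -> \bar R}).
Context dY (Y : measurableType dY) (nu : {measure set Y -> \bar R}).

Lemma sqD_le (th a b : X -> R) : measurable_fun setT th ->
  mu.-integrable setT (EFin \o a) -> mu.-integrable setT (EFin \o b) ->
  sq mu th (fun x => a x + b x) <= 2 * (sq mu th a + sq mu th b).
Proof.
move=> mth ia ib; rewrite /sq.
have -> : fcos mu th (fun x => a x + b x) = fcos mu th a + fcos mu th b.
  rewrite /fcos -RintegralD//; [|exact: integrable_cosM|exact: integrable_cosM].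
  by apply: eq_Rintegral => x _; rewrite mulrDr.
have -> : fsin mu th (fun x => a x + b x) = fsin mu th a + fsin mu th b.
  rewrite /fsin -RintegralD//; [|exact: integrable_sinM|exact: integrable_sinM].
  by apply: eq_Rintegral => x _; rewrite mulrDr.
move: (fcos mu th a) (fcos mu th b) (fsin mu th a) (fsin mu th b) => p q r s.
by have := sqr_ge0 (p - q); have := sqr_ge0 (r - s); nra.
Qed.

Lemma integrable_indicM (E : set X) (a : X -> R) : measurable E ->
  mu.-integrable setT (EFin \o a) ->
  mu.-integrable setT (EFin \o (fun x => \1_E x * a x)).
Proof.
move=> mE ia; have mi : measurable_fun setT (\1_E : X -> R) by exact: measurable_indic.
apply: (integrableM1 mi) ia => x; rewrite indicE.
by case: (_ \in _); rewrite /= ?normr1 ?normr0.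
Qed.

Lemma osc_boundU (v : Y -> R) (Phi : Y -> X -> R) (E F : set X) (A B : R) :
  (forall y, 0 <= v y) -> measurable_fun setT v ->
  measurable_fun setT (fun p : Y * X => Phi p.1 p.2) ->
  measurable E -> 0 <= A -> 0 <= B ->
  osc_bound mu nu v Phi E A -> osc_bound mu nu v Phi F B ->
  osc_bound mu nu v Phi (E `|` F) (2 * (A + B)).
Proof.
move=> v0 mv mPhi mE A0 B0 PE PF a m ia mm aEF.
have /measurable_EFinP ma := measurable_int _ ia.
pose a1 x := \1_E x * a x; pose a2 x := \1_(~` E) x * a x.
have mCE : measurable (~` E) by exact: measurableC.
have ia1 : mu.-integrable setT (EFin \o a1) by exact: integrable_indicM.
have ia2 : mu.-integrable setT (EFin \o a2) by exact: integrable_indicM.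
have /measurable_EFinP ma1 := measurable_int _ ia1.
have /measurable_EFinP ma2 := measurable_int _ ia2.
have aE : a = (fun x => a1 x + a2 x).
  apply/funext => x; rewrite /a1 /a2 -mulrDl !indicE in_setC.
  by case: (_ \in _); rewrite /= ?addr0 ?add0r mul1r.
have a10 x : ~ E x -> a1 x = 0 by move=> nE; rewrite /a1 indicE memNset// mul0r.
have a20 x : ~ F x -> a2 x = 0.
  move=> nF; rewrite /a2 indicE; have [xE|xE] := pselect (E x).
    by rewrite memNset ?mul0r//=; apply.
  by rewrite aEF ?mulr0// => -[].
have h1 := PE _ _ ia1 mm a10; have h2 := PF _ _ ia2 mm a20.
have mth y : measurable_fun setT (fun x => Phi y x + m x) by meas.
have msq (b : X -> R) : measurable_fun setT b ->
    measurable_fun setT (fun y => sq mu (fun x => Phi y x + m x) b).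
  move=> mb; apply: (measurable_sq mu (th := fun y x => Phi y x + m x)
    (a := fun _ : Y => b)); by meas.
have ms := msq _ ma; have ms1 := msq _ ma1; have ms2 := msq _ ma2.
apply: (@le_trans _ _ (\int[nu]_y (2%:E *
    ((v y * sq mu (fun x => Phi y x + m x) a1)%:E +
     (v y * sq mu (fun x => Phi y x + m x) a2)%:E)))%E).
  apply: ge0_le_integral => //.
  - by move=> y _; rewrite lee_fin mulr_ge0// sq_ge0.
  - by apply: measurable_EFinT; exact: measurable_funM.
  - by apply: measurable_funeM; apply: emeasurable_funD;
      apply: measurable_EFinT; exact: measurable_funM.
  move=> y _; rewrite -EFinD -EFinM lee_fin -mulrDr mulrCA ler_wpM2l//.
  by rewrite [in leLHS]aE; exact: sqD_le.
rewrite ge0_integralZl//; first last.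
- by move=> y _; rewrite -EFinD lee_fin addr_ge0// mulr_ge0// sq_ge0.
- by apply: emeasurable_funD; apply: measurable_EFinT; exact: measurable_funM.
rewrite ge0_integralD//; first last.
- by apply: measurable_EFinT; exact: measurable_funM.
- by move=> y _; rewrite lee_fin mulr_ge0// sq_ge0.
- by apply: measurable_EFinT; exact: measurable_funM.
- by move=> y _; rewrite lee_fin mulr_ge0// sq_ge0.
rewrite EFinM -muleA; apply: lee_wpmul2l => //.
apply: le_trans (leeD h1 h2) _.
have I0 : (0 <= \int[mu]_x (a x ^+ 2)%:E)%E.
  by apply: integral_ge0 => x _; rewrite lee_fin sqr_ge0.
rewrite EFinD ge0_muleDl ?lee_fin//; apply: leeD.
  apply: lee_wpmul2l => //; apply: ge0_le_integral => //.
  - by move=> x _; rewrite lee_fin sqr_ge0.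
  - by apply: measurable_EFinT; exact: measurable_funX.
  - by apply: measurable_EFinT; exact: measurable_funX.
  move=> x _; rewrite lee_fin /a1 indicE.
  by case: (_ \in _); rewrite /= ?mul1r// mul0r expr0n sqr_ge0.
apply: lee_wpmul2l => //; apply: ge0_le_integral => //.
- by move=> x _; rewrite lee_fin sqr_ge0.
- by apply: measurable_EFinT; exact: measurable_funX.
- by apply: measurable_EFinT; exact: measurable_funX.
move=> x _; rewrite lee_fin /a2 indicE.
by case: (_ \in _); rewrite /= ?mul1r// mul0r expr0n sqr_ge0.
Qed.

End osc_bound_union.

(** * Localized bounds for a single solution *)

Section waves.
Context {R : realType} (N : nat) (sg : 'I_N -> R).
Hypothesis sg1 : forall i, `|sg i| = 1.
Local Notation leb := (@lebesgue_measure R).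
Local Notation RR := (measurableTypeR R).
Local Notation mu := (@lebesgueN R N).
Implicit Types (a : Rn R N -> R).

(* |e^(itL) f|^2 at x, where the Fourier transform of f is the real function a *)
Definition wave a (t : R) (x : Rn R N) : R :=
  sq mu (fun xi => dotp x xi + t * qphase sg xi) a.

Lemma wave_ge0 a t x : 0 <= wave a t x. Proof. exact: sq_ge0. Qed.

Lemma measurable_wave a : measurable_fun setT a ->
  measurable_fun setT (fun p : RR * Rn R N => wave a p.1 p.2).
Proof.
move=> ma; have md := @measurable_dotp R N; have mq := measurable_qphase sg.
apply: (measurable_sq mu (th := fun (p : RR * Rn R N) xi => dotp p.2 xi + p.1 * qphase sg xi)
  (a := fun _ : RR * Rn R N => a)); by meas.
Qed.

Lemma measurable_wave1 a (t : R) : measurable_fun setT a ->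
  measurable_fun setT (wave a t).
Proof. by move=> ma; have mw := measurable_wave ma; exact: (measurable_fun2r (t : RR) mw). Qed.

Definition l2 a : \bar R := (\int[mu]_xi (a xi ^+ 2)%:E)%E.

Lemma l2_ge0 a : (0 <= l2 a)%E.
Proof. by apply: integral_ge0 => x _; rewrite lee_fin sqr_ge0. Qed.

Lemma wave_fixed_time : exists2 A : R, 0 <= A & forall a t,
  mu.-integrable setT (EFin \o a) ->
  (\int[mu]_x (bumpN x * wave a t x)%:E <= A%:E * l2 a)%E.
Proof.
have [A A0 P] := @osc_bound_dotp R N; exists A => // a t ia.
have mq := measurable_qphase sg.
apply: (P a (fun xi => t * qphase sg xi)) => //; first by meas.
by move=> xi /(_ I).
Qed.

(** Time is only a parameter here: nothing is gained from oscillation, but the total mass of [v]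
    appears as a factor, which is small for a short range of times. *)
Lemma wave_time_window : exists2 A : R, 0 <= A & forall a (v : RR -> R),
  mu.-integrable setT (EFin \o a) -> (forall u, 0 <= v u) ->
  leb.-integrable setT (EFin \o v) ->
  (\int[mu]_x ((bumpN x)%:E * \int[leb]_u (v u * wave a u x)%:E)
    <= ((\int[leb]_u v u) * A)%:E * l2 a)%E.
Proof.
have [A A0 P] := @osc_bound_dotp R N; exists A => // a v ia v0 iv.
have mq := measurable_qphase sg; have md := @measurable_dotp R N.
have /measurable_EFinP ma := measurable_int _ ia.
have /measurable_EFinP mv := measurable_int _ iv.
have mb := @measurable_bumpN R N.
have mw := measurable_wave ma.
have := @osc_bound_param R _ (Rn R N) _ (Rn R N) _ RR mu mu leb (@bumpN R N) v
  (@dotp R N) (fun u xi => u * qphase sg xi) setT A (@bumpN_ge0 R N) mb v0 iv md _ A0 P a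
  (fun=> 0) ia (measurable_cst _) (fun x nT => False_ind _ (nT I)).
have mpsi : measurable_fun setT (fun p : RR * Rn R N => p.1 * qphase sg p.2) by meas.
move=> /(_ mpsi); apply: le_trans.
pose G (y : Rn R N * RR) := (bumpN y.1 * v y.2 * wave a y.2 y.1)%:E.
have mG : measurable_fun setT G by rewrite /G; meas.
have G0 y : (0 <= G y)%E by rewrite lee_fin mulr_ge0 ?wave_ge0// mulr_ge0 ?bumpN_ge0.
rewrite (_ : \int[prodm mu leb]_y _ = \int[prodm mu leb]_y G y)%E; last first.
  apply: eq_integral => y _; congr EFin; congr (_ * _); apply: eq_sq => xi.
  by rewrite addr0 addrC.
rewrite (fubini_tonelli1 G)// le_eqVlt; apply/orP; left; apply/eqP.
apply: eq_integral => x _; rewrite /fubini_F -ge0_integralZl//; first last.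
- by rewrite lee_fin bumpN_ge0.
- by move=> u _; rewrite lee_fin mulr_ge0 ?wave_ge0.
- apply: measurable_EFinT; apply: measurable_funM => //.
  exact: (measurable_fun_pair1 (f := fun p : RR * Rn R N => wave a p.1 p.2) x mw).
by apply: eq_integral => u _; rewrite -EFinM mulrA.
Qed.

Definition coord_large (l : R) (j : 'I_N) : set (Rn R N) := [set xi | l <= `|tnth xi j : R| ].

Lemma measurable_coord_large l j : measurable (coord_large l j).
Proof.
have mj := @measurable_tnthR R N j.
have mn := measurableT_comp (@normr_measurable R setT) mj.
rewrite (_ : coord_large l j = (fun xi : Rn R N => `|tnth xi j : R|) @^-1` `[l, +oo[%classic).
  by rewrite -[X in measurable X]setTI; exact: mn.
by apply/seteqP; split=> xi /=; rewrite in_itv/= andbT.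
Qed.

(** A frequency far from the origin has a large coordinate, but which one varies over the shell, so
    the smoothing bounds of several coordinates are combined. *)
Lemma wave_smoothing_set (s : seq 'I_N) : exists2 A : R, 0 <= A & forall l, 0 < l ->
  osc_bound mu (prodm leb mu) (fun y : RR * Rn R N => bump y.1 * bumpN y.2)
    (fun y xi => dotp y.2 xi + y.1 * qphase sg xi)
    [set xi | exists2 j, j \in s & coord_large l j xi] (A / l).
Proof.
have mq := measurable_qphase sg; have md := @measurable_dotp R N.
have mb := @measurable_bumpN R N; have mb1 := @measurable_bump R.
elim: s => [|j s [B B0 IH]].
  exists 0 => // l l0 a m ia mm a0.
  have a00 xi : a xi = 0 by apply: a0 => -[].
  rewrite mul0r mul0e integral0_eq// => y _; apply/congr1.
  rewrite /sq /fcos /fsin; under eq_Rintegral do rewrite a00 mulr0.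
  under [X in _ + X ^+ 2]eq_Rintegral do rewrite a00 mulr0.
  by rewrite Rintegral_cst// mul0r expr0n addr0 mulr0.
have [A A0 P] := osc_bound_smoothing j sg1.
exists (2 * (A + B)); first by rewrite mulr_ge0// addr_ge0.
move=> l l0.
have := @osc_boundU R _ _ mu _ _ (prodm leb mu) (fun y : RR * Rn R N => bump y.1 * bumpN y.2)
  (fun y xi => dotp y.2 xi + y.1 * qphase sg xi) (coord_large l j) _ (A / l) (B / l)
  _ _ _ (measurable_coord_large l j) _ _ (P l l0) (IH l l0).
rewrite -mulrDl mulrA => H.
move=> a m ia mm a0; apply: H => //.
- by move=> y; rewrite mulr_ge0 ?bump_ge0 ?bumpN_ge0.
- by meas.
- by meas.
- by rewrite divr_ge0// ltW.
- by rewrite divr_ge0// ltW.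
move=> xi nE; apply: a0 => -[i0]; rewrite inE => /predU1P[->|si] h;
  apply: nE; [left|right] => //.
by exists i0.
Qed.

End waves.

(** * Maximal functions of frequency shells *)

Section maximal_pieces.
Context {R : realType} (N : nat) (sg : 'I_N -> R).
Hypothesis sg1 : forall i, `|sg i| = 1.
Local Notation leb := (@lebesgue_measure R).
Local Notation RR := (measurableTypeR R).
Local Notation mu := (@lebesgueN R N).
Local Notation wave := (@wave R N sg).
Implicit Types (a : Rn R N -> R).

Definition shell (k : nat) : set (Rn R N) :=
  [set xi | sqnorm xi < 4 ^+ k /\ (k = 0%N \/ 4 ^+ k.-1 <= sqnorm xi)].

(** The coordinates are bounded only up to [<=] in the sum; the strict inequality comes from N < (N
    + 1)^2, which holds for every [N]. *)
Lemma sqnorm_coord (l : R) (xi : Rn R N) : 0 < l ->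
  (forall j, ~ coord_large l j xi) -> sqnorm xi < (N.+1%:R * l) ^+ 2.
Proof.
move=> l0 h; apply: (@le_lt_trans _ _ (\sum_(j < N) l ^+ 2)).
  apply: ler_sum => j _; have /negP := h j; rewrite -ltNge => hj.
  by rewrite -real_normK ?num_real// ler_pXn2r ?nnegrE// ltW.
rewrite sumr_const card_ord -[X in X < _]mulr_natl exprMn ltr_pM2r ?exprn_gt0//.
by rewrite -natrX ltr_nat expnS expn1 leq_pmulr.
Qed.

Lemma qphase_le (xi : Rn R N) : `|qphase sg xi| <= sqnorm xi.
Proof.
apply: le_trans (ler_norm_sum _ _ _) _; apply: ler_sum => j _.
by rewrite normrM sg1 mul1r ger0_norm ?sqr_ge0.
Qed.

Lemma wave_smoothing : exists2 C : R, 0 <= C & forall k a,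
  mu.-integrable setT (EFin \o a) -> (forall xi, ~ shell k xi -> a xi = 0) ->
  (\int[mu]_x ((bumpN x)%:E * \int[leb]_u (bump u * wave a u x)%:E)
    <= (C / 2 ^+ k)%:E * l2 a)%E.
Proof.
have [A A0 P] := wave_smoothing_set sg1 (index_enum 'I_N).
have [B B0 Q] := wave_time_window sg.
have Ib0 : 0 <= \int[leb]_u bump u by apply: Rintegral_ge0 => u _; exact: bump_ge0.
exists ((\int[leb]_u bump u) * B + 2 * N.+1%:R * A).
  by rewrite addr_ge0// mulr_ge0// mulr_ge0.
move=> k a ia a0.
have /measurable_EFinP ma := measurable_int _ ia.
have weaken (c : R) : c <= ((\int[leb]_u bump u) * B + 2 * N.+1%:R * A) / 2 ^+ k ->
    (c%:E * l2 a <= (((\int[leb]_u bump u) * B + 2 * N.+1%:R * A) / 2 ^+ k)%:E * l2 a)%E.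
  by move=> h; apply: lee_wpmul2r; [exact: l2_ge0|rewrite lee_fin].
(* Shell 0 is a full ball and offers no large coordinate; since 2^0 = 1 no gain is claimed there,
   and the bound without oscillation is enough. *)
case: k a0 weaken => [|k] a0 weaken.
  apply: le_trans (weaken ((\int[leb]_u bump u) * B) _); last first.
    by rewrite expr0 divr1 lerDl !mulr_ge0.
  by apply: Q => //; [exact: bump_ge0|exact: integrable_bump].
(* On the shell of index k + 1 the norm is at least 2^k, so some coordinate is at least [l]. The
   shift of the index accounts for the 2 in the constant. *)
pose l : R := 2 ^+ k / N.+1%:R.
have l0 : 0 < l by rewrite divr_gt0// exprn_gt0.
apply: le_trans (weaken (A / l) _); last first.
  have k2 : (2 : R) ^+ k != 0 by rewrite expf_neq0.
  rewrite (_ : A / l = 2 * N.+1%:R * A / 2 ^+ k.+1); last first.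
    have n0 : (N.+1%:R : R) != 0 by rewrite pnatr_eq0.
    rewrite /l exprS; move: (N.+1%:R : R) n0 => n n0; field.
    by rewrite k2 n0.
  by rewrite ler_wpM2r ?invr_ge0 ?exprn_ge0// lerDr mulr_ge0.
have mw := measurable_wave sg ma.
have mb := @measurable_bumpN R N; have mb1 := @measurable_bump R.
pose G (y : RR * Rn R N) := (bump y.1 * bumpN y.2 * wave a y.1 y.2)%:E.
have mG : measurable_fun setT G by rewrite /G; meas.
have G0 y : (0 <= G y)%E by rewrite lee_fin mulr_ge0 ?wave_ge0// mulr_ge0 ?bumpN_ge0 ?bump_ge0.
have supp xi :
    ~ [set xi | exists2 j, j \in index_enum 'I_N & coord_large l j xi] xi -> a xi = 0.
  move=> nE; apply: a0 => -[_ [//|]] /=; apply/negP; rewrite -ltNge.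
  have hn j : ~ coord_large l j xi.
    by move=> hj; apply: nE; exists j => //; exact: mem_index_enum.
  apply: lt_le_trans (sqnorm_coord l0 hn) _.
  rewrite /l mulrCA divff ?pnatr_eq0// mulr1 -exprM mulnC exprM.
  by rewrite (_ : (2 : R) ^+ 2 = 4)//; ring.
have := P l l0 a (fun=> 0) ia (measurable_cst _) supp.
apply: le_trans.
rewrite (_ : \int[prodm leb mu]_y _ = \int[prodm leb mu]_y G y)%E; last first.
  apply: eq_integral => y _; congr EFin; congr (_ * _); apply: eq_sq => xi.
  by rewrite addr0.
rewrite (fubini_tonelli2 G)// le_eqVlt; apply/orP; left; apply/eqP.
apply: eq_integral => x _; rewrite /fubini_G -ge0_integralZl//; first last.
- by rewrite lee_fin bumpN_ge0.
- by move=> u _; rewrite lee_fin mulr_ge0 ?wave_ge0// bump_ge0.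
- apply: measurable_EFinT; apply: measurable_funM => //.
  exact: (measurable_fun_pair1 (f := fun p : RR * Rn R N => wave a p.1 p.2) x mw).
by apply: eq_integral => u _; rewrite -EFinM mulrA [bumpN x * _]mulrC.
Qed.

End maximal_pieces.

(** * Counting the times above a threshold *)

Section weak_lr_count.
Context {R : realType}.

(** By monotonicity the times above [b] are those before the first index [m] with [t m <= b], which
    exists because [t] tends to 0; so [m] is the cardinality controlled by [weak_lr]. *)
Lemma weak_lr_count (r : R) (t : nat -> R) : nonincreasing_seq t ->
  t @ \oo --> (0 : R) -> weak_lr r t ->
  exists2 K : R, 0 <= K & forall b, 0 < b ->
    exists m : nat, (forall n, (m <= n)%N -> t n <= b) /\ m%:R <= K * b `^ (- r).
Proof.
move=> tni t0 tw.
set S := [set (b `^ r)%:E * counting [set n | (b < t n)%R] | b in [set b : R | (0 < b)%R]]%E.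
have S0 x : S x -> (0 <= x)%E.
  by move=> [b _ <-]; rewrite mule_ge0 ?lee_fin ?powR_ge0.
have supS : (0 <= ereal_sup S)%E.
  apply: (@le_trans _ _ ((1 `^ r)%:E * counting [set n | (1 < t n)%R])%E).
    by apply: S0; exists 1 => //=.
  by apply: ereal_sup_ubound; exists 1 => //=.
exists (fine (ereal_sup S)); first exact: fine_ge0.
move=> b b0.
have ex : exists m, t m <= b.
  have [m _ /(_ m (leqnn m)) /ltW h] : \forall n \near \oo, t n < b.
    exact: (cvgr_lt 0 t0).
  by exists m.
have := ex_minnP ex; case => m tm mmin.
exists m; split.
  by move=> n mn; apply: le_trans tm; exact: tni.
have br : 0 < b `^ r by rewrite powR_gt0.
rewrite powRN ler_pdivlMr// mulrC -lee_fin fineK; last first.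
  by rewrite ge0_fin_numE.
apply: (@le_trans _ _ ((b `^ r)%:E * counting [set n | (b < t n)%R])%E); last first.
  by apply: ereal_sup_ubound; exists b.
rewrite EFinM; apply: lee_wpmul2l; first by rewrite lee_fin ltW.
have -> : (m%:R%:E : \bar R) = counting `I_m.
  by rewrite /counting (asboolT (finite_II m)) (card_fset_set (card_eqxx _)).
apply: le_measure; rewrite ?inE//.
move=> n /= nm; rewrite ltNge; apply/negP => /mmin; by rewrite leqNgt nm.
Qed.

End weak_lr_count.

Section dominating_functions.
Context {R : realType} (N : nat) (sg : 'I_N -> R).
Hypothesis sg1 : forall i, `|sg i| = 1.
Local Notation leb := (@lebesgue_measure R).
Local Notation RR := (measurableTypeR R).
Local Notation mu := (@lebesgueN R N).
Local Notation wave := (@wave R N sg).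
Implicit Types (a : Rn R N -> R).

(** A measurable majorant stands in for the supremum over [T], which may be uncountable. *)
Definition dominates (T : set R) a (D : Rn R N -> \bar R) : Prop :=
  [/\ measurable_fun setT D, (forall x, 0 <= D x)%E &
    forall t x, T t -> ((wave a t x)%:E <= D x)%E].

(** The half-width 4^-k is the largest admissible one: on the shell the phase is at most 4^k, so its
    product with the half-width stays within [-1, 1]. The factor 4 is the square of the bound 2 on
    [sinc_inv], and 4^k / 2 is the inverse length of a window. *)
Lemma window_dominates (k : nat) a (v : RR -> R) (T : set R) :
  mu.-integrable setT (EFin \o a) -> (forall xi, ~ shell k xi -> a xi = 0) ->
  measurable_fun setT v -> (forall u, 0 <= v u) ->
  (forall t u, T t -> \1_`[(t - 4 ^- k)%R, (t + 4 ^- k)%R] u <= v u) ->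
  exists a', [/\ mu.-integrable setT (EFin \o a'),
    (forall xi, ~ shell k xi -> a' xi = 0), (l2 a' <= 4%:E * l2 a)%E &
    dominates T a (fun x => (4 ^+ k / 2)%:E * \int[leb]_u (v u * wave a' u x)%:E)%E].
Proof.
move=> ia a0 mv v0 Tv.
have mq := measurable_qphase sg.
have d0 : 0 < (4 : R) ^- k by rewrite invr_gt0 exprn_gt0.
have aph xi : a xi != 0 -> `|4 ^- k * qphase sg xi| <= 1.
  move=> an0; have [sk|/a0 az] := pselect (shell k xi); last by rewrite az eqxx in an0.
  rewrite normrM ger0_norm ?(ltW d0)// mulrC ler_pdivrMr ?exprn_gt0// mul1r.
  exact: le_trans (qphase_le sg1 xi) (ltW sk.1).
pose a' := sinc_mul (qphase sg) a (4 ^- k).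
have ia' : mu.-integrable setT (EFin \o a') by exact: integrable_sinc_mul.
have /measurable_EFinP ma' := measurable_int _ ia'.
have /measurable_EFinP ma := measurable_int _ ia.
have mw := measurable_wave sg ma'.
have mvw : measurable_fun setT (fun p : RR * Rn R N => v p.1 * wave a' p.1 p.2) by meas.
exists a'; split => //.
- by move=> xi /a0 az; rewrite /a' /sinc_mul az mulr0.
- rewrite /l2 -ge0_integralZl//; last 2 first.
  + by apply: measurable_EFinT; exact: measurable_funX.
  + by move=> xi _; rewrite lee_fin sqr_ge0.
  apply: ge0_le_integral => //.
  + by move=> xi _; rewrite lee_fin sqr_ge0.
  + by apply: measurable_EFinT; exact: measurable_funX.
  + by apply: measurable_funeM; apply: measurable_EFinT; exact: measurable_funX.
  move=> xi _; rewrite -EFinM lee_fin.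
  have h := sinc_mul_le aph xi; rewrite -/a' in h.
  rewrite -[a' xi ^+ 2]real_normK ?num_real// -[a xi ^+ 2]real_normK ?num_real//.
  by have := normr_ge0 (a' xi); nra.
split.
- apply: measurable_funeM.
  apply: (measurable_fun_fubini_tonelli_G
    (fun p : RR * Rn R N => (v p.1 * wave a' p.1 p.2)%:E)).
    by apply: measurable_EFinT.
  by move=> p; rewrite lee_fin mulr_ge0 ?wave_ge0.
- move=> x; rewrite mule_ge0 ?lee_fin ?divr_ge0 ?exprn_ge0//.
  by apply: integral_ge0 => u _; rewrite lee_fin mulr_ge0 ?wave_ge0.
- move=> t x Tt.
  have md : measurable_fun setT (@dotp R N x).
    exact: (measurable_fun2r x (@measurable_dotp R N)).
  have := sq_window (t := t) md mq ia d0 aph mv (fun u => Tv t u Tt).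
  by rewrite invfM invrK [2^-1 * _]mulrC.
Qed.

Lemma maximal_piece_half : exists2 C : R, 0 <= C & forall (k : nat) a,
  mu.-integrable setT (EFin \o a) -> (forall xi, ~ shell k xi -> a xi = 0) ->
  exists D, dominates [set t | 0 < t < 1] a D /\
    (\int[mu]_x ((bumpN x)%:E * D x) <= (C * 2 ^+ k)%:E * l2 a)%E.
Proof.
have [C C0 P] := wave_smoothing sg1.
(* The product of 4^k / 2 from the windows, C / 2^k from smoothing and 4 from [l2 a'] is 2 C 2^k.
   The weight [bump] covers all windows, which lie in [-1, 2]. *)
exists (2 * C); first by rewrite mulr_ge0.
move=> k a ia a0.
have k4 : (4 : R) ^- k <= 1 by rewrite invf_le1 ?exprn_gt0// exprn_ege1 ?ler1n.
have d0 : 0 < (4 : R) ^- k by rewrite invr_gt0 exprn_gt0.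
have := @window_dominates k a bump [set t | 0 < t < 1] ia a0 (@measurable_bump R)
  (@bump_ge0 R).
case.
  move=> t u /= /andP[t0 t1]; rewrite indicE.
  case: (boolP (_ \in _)) => [/set_mem|_] /=; last exact: bump_ge0.
  rewrite in_itv/= => /andP[u1 u2]; apply: bump_ge1; apply/andP; split; lra.
move=> a' [ia' a'0 l2a' [mD D0 dom]].
eexists; split; first by split; [exact: mD|exact: D0|exact: dom].
have k2 : 0 <= (4 : R) ^+ k / 2 by rewrite divr_ge0// exprn_ge0.
have /measurable_EFinP ma' := measurable_int _ ia'.
have mw := measurable_wave sg ma'; have mb1 := @measurable_bump R.
have mvw : measurable_fun setT (fun p : RR * Rn R N => bump p.1 * wave a' p.1 p.2) by meas.
under eq_integral do rewrite muleCA.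
rewrite ge0_integralZl//; first last.
- move=> x _; rewrite mule_ge0 ?lee_fin ?bumpN_ge0//.
  by apply: integral_ge0 => u _; rewrite lee_fin mulr_ge0 ?wave_ge0// bump_ge0.
- apply: emeasurable_funM; first by apply: measurable_EFinT; exact: measurable_bumpN.
  apply: (measurable_fun_fubini_tonelli_G
    (fun p : RR * Rn R N => (bump p.1 * wave a' p.1 p.2)%:E)).
    by apply: measurable_EFinT.
  by move=> p; rewrite lee_fin mulr_ge0 ?wave_ge0// bump_ge0.
apply: le_trans (lee_wpmul2l _ (P k a' ia' a'0)) _; first by rewrite lee_fin.
rewrite muleA -EFinM.
have c0 : 0 <= 4 ^+ k / 2 * (C / 2 ^+ k) by rewrite mulr_ge0// divr_ge0// exprn_ge0.
apply: le_trans (lee_wpmul2l _ l2a') _; first by rewrite lee_fin.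
rewrite muleA -EFinM; apply: lee_wpmul2r; first exact: l2_ge0.
rewrite lee_fin (_ : (4 : R) = 2 * 2); last by ring.
rewrite exprMn le_eqVlt; apply/orP; left; apply/eqP; field.
by rewrite expf_neq0.
Qed.

(** Writing 2^k as 4^(k/2) gives both shell estimates the same shape, so that one summation serves
    them. *)
Lemma maximal_piece_half_powR : exists2 C : R, 0 <= C & forall (k : nat) a,
  mu.-integrable setT (EFin \o a) -> (forall xi, ~ shell k xi -> a xi = 0) ->
  exists D, dominates [set t | 0 < t < 1] a D /\
    (\int[mu]_x ((bumpN x)%:E * D x) <= (C * 4 `^ (k%:R * (1 / 2)))%:E * l2 a)%E.
Proof.
have [C C0 P] := maximal_piece_half; exists C => // k a ia a0.
have -> : (4 : R) `^ (k%:R * (1 / 2)) = 2 ^+ k; last exact: P.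
rewrite mulrC powRrM powR_mulrn ?powR_ge0//; congr (_ ^+ _).
rewrite div1r powR12_sqrt// (_ : (4 : R) = 2 ^+ 2); last by ring.
by rewrite sqrtr_sqr ger0_norm.
Qed.

Lemma measurable_sum_wave a (t : nat -> R) (m : nat) : measurable_fun setT a ->
  measurable_fun setT (fun x => \sum_(n < m) (wave a (t n) x)%:E)%E.
Proof.
by move=> ma; apply: emeasurable_sum => n; apply: measurable_EFinT; exact: measurable_wave1.
Qed.

Lemma maximal_piece_weak_lr (r : R) (t : nat -> R) : 0 < r ->
  (forall n, 0 < t n < 1) -> nonincreasing_seq t -> t @ \oo --> (0 : R) -> weak_lr r t ->
  exists2 C : R, 0 <= C & forall (k : nat) a,
  mu.-integrable setT (EFin \o a) -> (forall xi, ~ shell k xi -> a xi = 0) ->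
  exists D, dominates (range t) a D /\
    (\int[mu]_x ((bumpN x)%:E * D x) <= (C * 4 `^ (k%:R * (r / (r + 1))))%:E * l2 a)%E.
Proof.
move=> r0 t01 tni tcv tw.
have [K K0 cnt] := weak_lr_count tni tcv tw.
have [A A0 PA] := wave_time_window sg.
have [B B0 PB] := wave_fixed_time sg.
have r1 : 0 < r + 1 by rewrite addr_gt0.
have r1n : r + 1 != 0 by rewrite gt_eqF.
(* The part 6 A comes from the times up to [b]: (4^k / 2) (b + 2 d) A times 4, with b + 2 d <= 3 b.
   The part K B comes from at most K b^-r larger times, each at cost B. *)
exists (6 * A + K * B); first by rewrite addr_ge0// mulr_ge0.
move=> k a ia a0; have /measurable_EFinP ma := measurable_int _ ia.
(* This threshold equates the two costs 4^k b and b^-r. *)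
pose b : R := 4 `^ (- (k%:R / (r + 1))); pose d : R := 4 ^- k.
have b0 : 0 < b by rewrite powR_gt0.
have d0 : 0 < d by rewrite invr_gt0 exprn_gt0.
have db : d <= b.
  rewrite /d /b -powR_invn//; apply: ler_powR; first by rewrite ler1n.
  by rewrite lerN2 ler_pdivrMr// ler_peMr// lerDr ltW.
have kb : 4 ^+ k * b = 4 `^ (k%:R * (r / (r + 1))).
  rewrite -powR_mulrn// /b -powRD; last by rewrite pnatr_eq0 implybT.
  by congr (_ `^ _); field.
have br : b `^ (- r) = 4 `^ (k%:R * (r / (r + 1))).
  by rewrite /b -powRrM; congr (_ `^ _); field.
have [m [tm mK]] := cnt b b0; rewrite br in mK.
set P := 4 `^ _ in kb br mK *.
(* This interval contains the windows of all times in (0, b]. *)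
pose J : set RR := `[(- d)%R, (b + d)%R]%classic.
have mJs : measurable J by exact: measurable_itv.
have iJ : leb.-integrable setT (EFin \o (\1_J : RR -> R)) by exact: integrable_indic_itv.
have /measurable_EFinP mJ := measurable_int _ iJ.
have J0 (u : RR) : 0 <= (\1_J u : R) by [].
have IJ : \int[leb]_u (\1_J u : R) = b + 2 * d.
  have lbd : - d < b + d by rewrite ltrNl opprD ltrBlDr; lra.
  have e : leb J = (b + 2 * d)%:E.
    rewrite [LHS](lebesgue_measure_itv `[(- d)%R, (b + d)%R]) /= lte_fin ifT; last exact: lbd.
    by rewrite -EFinD; congr EFin; ring.
  transitivity (fine (leb J)); last by rewrite e.
  by rewrite /Rintegral integral_indic// setIT.
have := @window_dominates k a (\1_J : RR -> R) [set s | 0 < s <= b] ia a0 mJ J0.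
case.
  move=> s u /= /andP[s0 sb]; rewrite !indicE.
  case: (boolP (u \in _)) => [/set_mem|_] /=; last by [].
  rewrite in_itv/= -/d => /andP[u1 u2].
  have uJ : J u by rewrite /J /= in_itv/=; apply/andP; split; lra.
  by rewrite (mem_set uJ).
move=> a' [ia' a'0 l2a' [mD D0 dom]].
set D1 := (fun x => _) in mD D0 dom.
(* For the few times above [b] the supremum is replaced by the sum. *)
pose D2 x := (\sum_(n < m) (wave a (t n) x)%:E)%E.
have D20 x : (0 <= D2 x)%E by apply: sume_ge0 => n _; rewrite lee_fin wave_ge0.
have mD2 : measurable_fun setT D2 by exact: measurable_sum_wave.
exists (fun x => D1 x + D2 x)%E; split.
  split; first exact: emeasurable_funD.
    by move=> x; exact: adde_ge0 (D0 x) (D20 x).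
  move=> _ x [n _ <-]; have [mn|nm] := leqP m n.
    apply: le_trans (dom (t n) x _) _; last by rewrite leeDl.
    by have /andP[tn _] := t01 n; rewrite /= tn tm.
  apply: (@le_trans _ _ (D2 x)); last exact: (leeDr _ (D0 x)).
  rewrite /D2 (bigD1 (Ordinal nm))//= leeDl// sume_ge0// => i _.
  by rewrite lee_fin wave_ge0.
have mbN : measurable_fun setT (fun x : Rn R N => (bumpN x)%:E).
  by apply: measurable_EFinT; exact: measurable_bumpN.
have bN0 (x : Rn R N) : (0 <= (bumpN x)%:E)%E by rewrite lee_fin bumpN_ge0.
rewrite (eq_integral (fun x => (bumpN x)%:E * D1 x + (bumpN x)%:E * D2 x)%E); last first.
  by move=> x _; exact: ge0_muleDr (D0 x) (D20 x).
rewrite ge0_integralD//; try exact: emeasurable_funM;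
  try (by move=> x _; exact: (mule_ge0 (bN0 x) (D0 x)));
  try (by move=> x _; exact: (mule_ge0 (bN0 x) (D20 x))).
rewrite mulrDl EFinD ge0_muleDl ?lee_fin ?mulr_ge0 ?powR_ge0//; apply: leeD.
  rewrite /D1; under eq_integral do rewrite muleCA.
  have k2 : 0 <= (4 : R) ^+ k / 2 by rewrite divr_ge0// exprn_ge0.
  have /measurable_EFinP ma' := measurable_int _ ia'.
  have mw := measurable_wave sg ma'.
  have mvw : measurable_fun setT (fun p : RR * Rn R N => \1_J p.1 * wave a' p.1 p.2).
    by meas.
  rewrite ge0_integralZl//; first last.
  - move=> x _; rewrite mule_ge0//.
    by apply: integral_ge0 => u _; rewrite lee_fin mulr_ge0 ?wave_ge0.
  - apply: emeasurable_funM => //.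
    apply: (measurable_fun_fubini_tonelli_G
      (fun p : RR * Rn R N => (\1_J p.1 * wave a' p.1 p.2)%:E)).
      by apply: measurable_EFinT.
    by move=> p; rewrite lee_fin mulr_ge0 ?wave_ge0.
  apply: le_trans (lee_wpmul2l _ (PA a' _ ia' J0 iJ)) _; first by rewrite lee_fin.
  rewrite IJ muleA -EFinM.
  have c0 : 0 <= 4 ^+ k / 2 * ((b + 2 * d) * A).
    by rewrite mulr_ge0// mulr_ge0// addr_ge0 ?mulr_ge0// ltW.
  apply: le_trans (lee_wpmul2l _ l2a') _; first by rewrite lee_fin.
  rewrite muleA -EFinM; apply: lee_wpmul2r; first exact: l2_ge0.
  rewrite lee_fin -kb.
  have k4 : 0 < (4 : R) ^+ k by rewrite exprn_gt0.
  rewrite (_ : _ * 4 = (4 ^+ k * A) * (2 * (b + 2 * d))); last by field.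
  rewrite (_ : 6 * A * _ = (4 ^+ k * A) * (6 * b)); last by ring.
  by rewrite ler_wpM2l ?mulr_ge0 ?(ltW k4)//; lra.
rewrite (eq_integral (fun x => \sum_(n < m) (bumpN x * wave a (t n) x)%:E)%E); last first.
  move=> x _; rewrite /D2 ge0_sume_distrr//.
  by move=> n _; rewrite lee_fin wave_ge0.
rewrite ge0_integral_sum//; first last.
- by move=> n x _; rewrite lee_fin mulr_ge0 ?wave_ge0 ?bumpN_ge0.
- move=> n; apply: measurable_EFinT; apply: measurable_funM; first exact: measurable_bumpN.
  exact: measurable_wave1.
apply: (@le_trans _ _ (\sum_(n < m) (B%:E * l2 a))%E); first by apply: lee_sum => n _; exact: PB.
rewrite -ge0_sume_distrl; last by move=> n _; rewrite lee_fin.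
apply: lee_wpmul2r; first exact: l2_ge0.
rewrite sumEFin sumr_const card_ord lee_fin -mulr_natl.
by rewrite mulrAC ler_wpM2r.
Qed.

End dominating_functions.

(** * Summation over the shells *)

Section summation.
Context {R : realType} (N : nat) (sg : 'I_N -> R).
Local Notation mu := (@lebesgueN R N).
Local Notation wave := (@wave R N sg).
Implicit Types (a g : Rn R N -> R).

(** Summing q (x / q - c)^2 >= 0 over k gives P >= 2 c S - c^2 Q for every c; the choice c = S / Q
    optimizes it. *)
Lemma weighted_cauchy_schwarz (n : nat) (q x : nat -> R) : (forall k, 0 < q k) ->
  (\sum_(k < n) x k) ^+ 2 <= (\sum_(k < n) q k) * \sum_(k < n) ((q k)^-1 * x k ^+ 2).
Proof.
move=> q0; set Q := \sum_(k < n) q k; set S := \sum_(k < n) x k.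
set P := \sum_(k < n) _.
have Q0 : 0 <= Q by apply: sumr_ge0 => k _; exact: ltW.
have P0 : 0 <= P.
  by apply: sumr_ge0 => k _; rewrite mulr_ge0 ?sqr_ge0// invr_ge0 ltW.
have h c : 2 * c * S - c ^+ 2 * Q <= P.
  rewrite /S /Q /P !mulr_sumr -sumrB; apply: ler_sum => k _.
  have qk := q0 k; set y := (q k)^-1 * x k.
  have -> : x k = q k * y by rewrite /y mulrA mulfV ?mul1r// gt_eqF.
  rewrite (_ : (q k)^-1 * (q k * y) ^+ 2 = q k * y ^+ 2); last by field; rewrite gt_eqF.
  have := mulr_ge0 (ltW qk) (sqr_ge0 (y - c)); nra.
(* The weights are positive, so Q = 0 only for the empty sum. *)
have [Qz|Qn] := eqVneq Q 0.
  have x0 k : (k < n)%N -> False.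
    move=> kn; have : Q > 0.
      rewrite /Q (bigD1 (Ordinal kn))//= ltr_pwDl//.
      by apply: sumr_ge0 => i _; exact: ltW.
    by rewrite Qz ltxx.
  have -> : S = 0 by rewrite /S big1// => -[k kn] _; case: (x0 k kn).
  by rewrite expr0n/= mulr_ge0.
have Qp : 0 < Q by rewrite lt_neqAle eq_sym Qn.
have := h (S / Q); rewrite -(ler_pM2l Qp) => /(le_trans _); apply.
rewrite le_eqVlt; apply/orP; left; apply/eqP; field; exact: Qn.
Qed.

Lemma Rintegral_sum_ord (n : nat) (h : nat -> Rn R N -> R) :
  (forall k, mu.-integrable setT (EFin \o h k)) ->
  \int[mu]_x (\sum_(k < n) h k x) = \sum_(k < n) \int[mu]_x h k x /\
  mu.-integrable setT (EFin \o (fun x => \sum_(k < n) h k x)).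
Proof.
move=> ih; elim: n => [|n [IH1 IH2]].
  split; last by under eq_fun do rewrite big_ord0; exact: integrable0.
  by under eq_Rintegral do rewrite big_ord0; rewrite big_ord0 Rintegral_cst// mul0r.
split; last by under eq_fun do rewrite big_ord_recr; exact: integrableDr.
under eq_Rintegral do rewrite big_ord_recr /=.
by rewrite big_ord_recr/= -IH1 RintegralD.
Qed.

Lemma wave_sum_le (n : nat) (q : nat -> R) (a : nat -> Rn R N -> R) t x :
  (forall k, 0 < q k) -> (forall k, mu.-integrable setT (EFin \o a k)) ->
  wave (fun xi => \sum_(k < n) a k xi) t x <=
  (\sum_(k < n) q k) * \sum_(k < n) ((q k)^-1 * wave (a k) t x).
Proof.
move=> q0 ia; rewrite /wave.
have md : measurable_fun setT (@dotp R N x).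
  exact: (measurable_fun2r x (@measurable_dotp R N)).
have mq := measurable_qphase sg.
have mth : measurable_fun setT (fun xi => dotp x xi + t * qphase sg xi) by meas.
set th := (fun xi => _) in mth *.
rewrite /sq.
have -> : fcos mu th (fun xi => \sum_(k < n) a k xi) = \sum_(k < n) fcos mu th (a k).
  have [<- _] := @Rintegral_sum_ord n _ (fun k => integrable_cosM mth (ia k)).
  by apply: eq_Rintegral => xi _; rewrite mulr_sumr.
have -> : fsin mu th (fun xi => \sum_(k < n) a k xi) = \sum_(k < n) fsin mu th (a k).
  have [<- _] := @Rintegral_sum_ord n _ (fun k => integrable_sinM mth (ia k)).
  by apply: eq_Rintegral => xi _; rewrite mulr_sumr.
under [X in _ <= _ * X]eq_bigr do rewrite mulrDr.
rewrite big_split/= mulrDr.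
apply: lerD.
  exact: (@weighted_cauchy_schwarz n q (fun k => fcos mu th (a k)) q0).
exact: (@weighted_cauchy_schwarz n q (fun k => fsin mu th (a k)) q0).
Qed.

Lemma measurable_sqnorm : measurable_fun setT (@sqnorm R N).
Proof.
by apply: measurable_sum_seq => j; have mj := @measurable_tnthR R N j; meas.
Qed.

Lemma sqnorm_ge0 (xi : Rn R N) : 0 <= sqnorm xi.
Proof. by apply: sumr_ge0 => j _; exact: sqr_ge0. Qed.

Definition low (m : nat) : set (Rn R N) := [set xi | sqnorm xi < 4 ^+ m].

Lemma measurable_low m : measurable (low m).
Proof.
rewrite (_ : low m = @sqnorm R N @^-1` `]-oo, 4 ^+ m[%classic).
  by rewrite -[X in measurable X]setTI; exact: measurable_sqnorm.
by apply/seteqP; split=> xi /=; rewrite in_itv/=.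
Qed.

Lemma low_finite m : (mu (low m) < +oo)%E.
Proof.
pose box : set (Rn R N) := [set x | forall i, `[(- 2 ^+ m)%R, (2 ^+ m)%R]%classic (tnth x i : R)].
have mbox : measurable box.
  rewrite (_ : box = \bigcap_(i in [set: 'I_N]) ((fun x : Rn R N => tnth x i) @^-1`
     `[(- 2 ^+ m)%R, (2 ^+ m)%R]%classic)).
    apply: fin_bigcap_measurable => // i _.
    by rewrite -[X in measurable X]setTI; apply: measurable_tnth.
  by apply/seteqP; split=> x /= H i; [move=> _|]; exact: H.
apply: (@le_lt_trans _ _ (mu box)).
  apply: le_measure; rewrite ?inE//; first exact: measurable_low.
  move=> xi /= h i; suff : `|tnth xi i : R| <= 2 ^+ m.
    by rewrite ler_norml /= in_itv.
  rewrite -(@ler_pXn2r _ 2%N) ?nnegrE ?exprn_ge0//.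
  rewrite real_normK ?num_real//; apply: le_trans (_ : sqnorm xi <= _).
    rewrite /sqnorm (bigD1 i)//= lerDl; apply: sumr_ge0 => j _; exact: sqr_ge0.
  apply: (le_trans (ltW h)).
  by rewrite -exprM mulnC exprM (_ : (2 : R) ^+ 2 = 4)//; ring.
have -> : mu box = (\prod_(i < N) (2 * 2 ^+ m)%:E)%E.
  rewrite [LHS](lebesgueN_box (A := fun=> `[(- 2 ^+ m)%R, (2 ^+ m)%R]%classic))//.
  apply: eq_bigr => i _.
  have p : 0 < (2 : R) ^+ m by rewrite exprn_gt0.
  have lt : - 2 ^+ m < (2 : R) ^+ m by lra.
  rewrite [LHS](lebesgue_measure_itv `[(- 2 ^+ m)%R, (2 ^+ m)%R]) /= lte_fin ifT; last exact: lt.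
  by rewrite -EFinD; congr EFin; ring.
by rewrite prodEFin ltry.
Qed.

End summation.

Section maximal_real.
Context {R : realType} (N : nat) (sg : 'I_N -> R).
Local Notation mu := (@lebesgueN R N).
Local Notation wave := (@wave R N sg).
Implicit Types (a g : Rn R N -> R).

Definition trunc (m : nat) g (xi : Rn R N) : R := \1_(@low R N m) xi * g xi.
Definition shell_part (k : nat) g (xi : Rn R N) : R := \1_(@shell R N k) xi * g xi.
Definition weight (s : R) (xi : Rn R N) : R := (1 + sqnorm xi) `^ s.

Lemma weight_ge0 s xi : 0 <= weight s xi. Proof. exact: powR_ge0. Qed.

Lemma measurable_weight s : measurable_fun setT (weight s).
Proof.
have h : measurable_fun setT (fun xi : Rn R N => 1 + sqnorm xi).
  by have ms := @measurable_sqnorm R N; meas.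
exact: (measurableT_comp (measurable_powR s) h).
Qed.

Lemma shell_lowS m : @shell R N m.+1 = low m.+1 `&` ~` low m.
Proof.
apply/seteqP; split=> xi /=; rewrite /low /=.
  by move=> [h [//|h2]]; split=> //; apply/negP; rewrite -leNgt.
by move=> [h /negP]; rewrite -leNgt => h2; split=> //; right.
Qed.

Lemma shell_low0 : @shell R N 0 = low 0.
Proof. by apply/seteqP; split=> xi /=; [case|move=> h; split=> //; left]. Qed.

Lemma measurable_shell k : measurable (@shell R N k).
Proof.
case: k => [|k]; first by rewrite shell_low0; exact: measurable_low.
rewrite shell_lowS; apply: measurableI; first exact: measurable_low.
by apply: measurableC; exact: measurable_low.
Qed.

Lemma low_subS m : @low R N m `<=` low m.+1.
Proof.
move=> xi /= h; apply: lt_le_trans h _; rewrite exprS ler_peMl ?exprn_ge0//.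
by rewrite ler1n.
Qed.

Lemma indic_low m (xi : Rn R N) :
  (\1_(low m) xi : R) = \sum_(k < m.+1) \1_(shell k) xi.
Proof.
elim: m => [|m IH]; first by rewrite big_ord_recl big_ord0 addr0 shell_low0.
rewrite big_ord_recr /= -IH shell_lowS !indicE.
have [h|h] := boolP (xi \in low m).
  have -> : (xi \in low m.+1) = true.
    by apply/mem_set; apply: low_subS; exact: set_mem.
  have -> : (xi \in low m.+1 `&` ~` low m) = false.
    by apply/memNset => -[_]; apply; exact: set_mem.
  by rewrite addr0.
have -> : (xi \in low m.+1 `&` ~` low m) = (xi \in low m.+1).
  rewrite in_setI in_setC h andbT //.
by rewrite add0r.
Qed.

Lemma trunc_sum m g xi : trunc m g xi = \sum_(k < m.+1) shell_part k g xi.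
Proof. by rewrite /trunc indic_low mulr_suml. Qed.

Lemma shell_part_sq k g xi : shell_part k g xi ^+ 2 = \1_(shell k) xi * g xi ^+ 2.
Proof.
by rewrite /shell_part indicE; case: (_ \in _); rewrite /= ?mul1r// !mul0r expr0n.
Qed.

(** On a set of finite measure L^2 embeds in L^1, through |g| <= 1 + g^2. *)
Lemma integrable_low (E : set (Rn R N)) m g : measurable E -> E `<=` low m ->
  measurable_fun setT g -> (l2 g < +oo)%E ->
  mu.-integrable setT (EFin \o (fun xi => \1_E xi * g xi)).
Proof.
move=> mE Em mg l2g.
have mi : measurable_fun setT (\1_E : Rn R N -> R) by exact: measurable_indic.
have iE : mu.-integrable setT (EFin \o (\1_(low m) : Rn R N -> R)).
  apply/integrableP; split.
    by apply: measurable_EFinT; apply: measurable_indic; exact: measurable_low.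
  under eq_integral do rewrite /= ger0_norm//.
  rewrite integral_indic//; last exact: measurable_low.
  by rewrite setIT; exact: low_finite.
have ig : mu.-integrable setT (EFin \o (fun xi => g xi ^+ 2)).
  apply/integrableP; split; first by apply: measurable_EFinT; exact: measurable_funX.
  by under eq_integral do rewrite /= ger0_norm ?sqr_ge0//.
apply: le_integrable (integrableDr iE ig) => //.
  by apply: measurable_EFinT; exact: measurable_funM.
move=> xi _ /=; rewrite lee_fin [leRHS]ger0_norm ?addr_ge0 ?sqr_ge0// normrM.
rewrite (ger0_norm (_ : 0 <= \1_E xi))// indicE; case: (boolP (xi \in E)) => [/set_mem xE|_] /=.
  rewrite mul1r indicE (mem_set (Em _ xE)) /= -[g xi ^+ 2]real_normK ?num_real//.
  have := sqr_ge0 (`|g xi| - 2^-1); have := sqr_ge0 (`|g xi|); nra.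
by rewrite mul0r addr_ge0 ?sqr_ge0.
Qed.

Lemma shell_sub_low k : @shell R N k `<=` low k.
Proof. by move=> xi []. Qed.

(** The factor 4^s pays for the lower radius of the shell, where the squared norm is only known to
    be at least 4^(k-1). *)
Lemma weight_shell (s : R) k xi : 0 <= s -> shell k xi ->
  4 `^ (k%:R * s) <= 4 `^ s * weight s xi.
Proof.
move=> s0 [_ [->|]].
  rewrite mul0r powRr0 -[leLHS]mulr1; apply: ler_pM => //.
    by rewrite -[leLHS](powRr0 4); apply: ler_powR => //; rewrite ler1n.
  rewrite /weight -[leLHS](powRr0 (1 + sqnorm xi)); apply: ler_powR => //.
  by rewrite lerDl sqnorm_ge0.
case: k => [_|k /= hk].
  rewrite mul0r powRr0 -[leLHS]mulr1; apply: ler_pM => //.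
    by rewrite -[leLHS](powRr0 4); apply: ler_powR => //; rewrite ler1n.
  rewrite /weight -[leLHS](powRr0 (1 + sqnorm xi)); apply: ler_powR => //.
  by rewrite lerDl sqnorm_ge0.
rewrite (_ : k.+1%:R = k%:R + 1 :> R); last by rewrite -natr1.
rewrite mulrDl mul1r powRD ?pnatr_eq0 ?implybT// mulrC ler_wpM2l ?powR_ge0//.
rewrite powRrM powR_mulrn// /weight ge0_ler_powR ?nnegrE ?exprn_ge0//.
  by rewrite addr_ge0 ?sqnorm_ge0.
by apply: le_trans hk _; rewrite lerDr.
Qed.

(** The two shell estimates differ only in the set of times and the exponent, so the summation is
    carried out for abstract [T] and [sigma]. *)
Variables (T : set R) (sigma C s : R).
Hypothesis C0 : 0 <= C.
Hypothesis s0 : 0 <= s.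
Hypothesis sigma_s : sigma < s.
Hypothesis piece : forall k a, mu.-integrable setT (EFin \o a) ->
  (forall xi, ~ shell k xi -> a xi = 0) ->
  exists D, dominates sg T a D /\
    (\int[mu]_x ((bumpN x)%:E * D x) <= (C * 4 `^ (k%:R * sigma))%:E * l2 a)%E.

(** Its powers are the weights in Cauchy-Schwarz. They satisfy rho^-k 4^(k sigma) = 4^(k s), which
    turns the growth of the shell estimates into the weight of H^s, and they are summable because
    sigma < s. *)
Let rho : R := 4 `^ (- (s - sigma)).

Let rho0 : 0 < rho. Proof. by rewrite powR_gt0. Qed.

Let rho1 : rho < 1.
Proof.
rewrite /rho powRN invf_lt1 ?powR_gt0//.
have := @gt0_ltr_powR R (s - sigma); rewrite subr_gt0 => /(_ sigma_s 1 4).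
by rewrite powR1 !nnegrE; apply; rewrite ?ltr1n.
Qed.

Lemma geometric_le (n : nat) : \sum_(k < n) rho ^+ k <= (1 - rho)^-1.
Proof.
have h : 0 < 1 - rho by rewrite subr_gt0.
rewrite -[leRHS]mul1r ler_pdivlMr//.
have := subrX1 rho n; rewrite -[rho - 1]opprB mulNr => e.
have -> : (\sum_(k < n) rho ^+ k) * (1 - rho) = 1 - rho ^+ n by rewrite mulrC; lra.
by rewrite gerBl exprn_ge0// ltW.
Qed.

Lemma maximal_real : exists2 C' : R, 0 <= C' & forall g, measurable_fun setT g ->
  (l2 g < +oo)%E -> exists D : Rn R N -> \bar R,
  [/\ measurable_fun setT D, (forall x, 0 <= D x)%E,
    (forall m t x, T t -> ((wave (trunc m g) t x)%:E <= D x)%E) &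
    (\int[mu]_x ((bumpN x)%:E * D x) <= C'%:E *
      \int[mu]_xi (weight s xi * g xi ^+ 2)%:E)%E].
Proof.
have r1 : 0 < 1 - rho by rewrite subr_gt0.
exists ((1 - rho)^-1 * C * 4 `^ s); first by rewrite !mulr_ge0 ?powR_ge0// invr_ge0 ltW.
move=> g mg l2g.
have ia k : mu.-integrable setT (EFin \o shell_part k g).
  exact: (integrable_low (measurable_shell k) (@shell_sub_low k) mg l2g).
have sa k xi : ~ shell k xi -> shell_part k g xi = 0.
  by move=> h; rewrite /shell_part indicE memNset// mul0r.
pose D_ k := projT1 (cid (piece (ia k) (sa k))).
have D_P k : dominates sg T (shell_part k g) (D_ k) /\
    (\int[mu]_x ((bumpN x)%:E * D_ k x) <=
      (C * 4 `^ (k%:R * sigma))%:E * l2 (shell_part k g))%E.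
  exact: (projT2 (cid (piece (ia k) (sa k)))).
have mD_ k : measurable_fun setT (D_ k) by have [[]] := D_P k.
have D_0 k x : (0 <= D_ k x)%E by have [[]] := D_P k.
have D_w k t x : T t -> ((wave (shell_part k g) t x)%:E <= D_ k x)%E.
  by have [[_ _ h] _] := D_P k; exact: h.
pose F k x := ((rho ^- k)%:E * D_ k x)%E.
have rk k : 0 < rho ^- k by rewrite invr_gt0 exprn_gt0.
have mF k : measurable_fun setT (F k) by exact: measurable_funeM.
have F0 k x : (0 <= F k x)%E by rewrite mule_ge0// lee_fin ltW.
(* Taking the whole series rather than a partial sum makes the majorant independent of the
   truncation [m]. *)
pose D x := ((1 - rho)^-1%:E * \sum_(k <oo) F k x)%E.
have r10 : (0 <= (1 - rho)^-1%:E)%E by rewrite lee_fin invr_ge0 ltW.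
have mS : measurable_fun setT (fun x => \sum_(k <oo) F k x)%E.
  exact: ge0_emeasurable_sum.
exists D; split.
- exact: measurable_funeM.
- by move=> x; rewrite mule_ge0// nneseries_ge0.
- move=> m t x Tt.
  have -> : trunc m g = (fun xi => \sum_(k < m.+1) shell_part k g xi).
    by apply/funext => xi; exact: trunc_sum.
  have := @wave_sum_le R N sg m.+1 (fun k => rho ^+ k) (fun k => shell_part k g) t x
    (fun k => exprn_gt0 k rho0) ia.
  rewrite -lee_fin => /le_trans; apply.
  apply: (@le_trans _ _ ((1 - rho)^-1 *
    \sum_(k < m.+1) ((rho ^+ k)^-1 * wave (shell_part k g) t x))%:E).
    rewrite lee_fin ler_wpM2r ?geometric_le// sumr_ge0// => k _.
    by rewrite mulr_ge0 ?wave_ge0// ltW.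
  rewrite EFinM; apply: lee_wpmul2l => //.
  apply: (@le_trans _ _ (\sum_(k < m.+1) F k x)%E).
    rewrite -sumEFin; apply: lee_sum => k _; rewrite EFinM.
    by apply: lee_wpmul2l; [rewrite lee_fin ltW|exact: D_w].
  rewrite -(big_mkord xpredT (fun k => F k x)).
  by apply: nneseries_lim_ge => // k _.
have ma k : measurable_fun setT (shell_part k g).
  by have /measurable_EFinP := measurable_int _ (ia k).
have mw := measurable_weight s.
have mwa k : measurable_fun setT (fun xi => (weight s xi * shell_part k g xi ^+ 2)%:E).
  by apply: measurable_EFinT; apply: measurable_funM => //; exact: measurable_funX.
have wa0 k xi : (0 <= (weight s xi * shell_part k g xi ^+ 2)%:E)%E.
  by rewrite lee_fin mulr_ge0 ?sqr_ge0// weight_ge0.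
have mb : measurable_fun setT (fun x : Rn R N => (bumpN x)%:E).
  by apply: measurable_EFinT; exact: measurable_bumpN.
have b0 (x : Rn R N) : (0 <= (bumpN x)%:E)%E by rewrite lee_fin bumpN_ge0.
have rhoE k : rho ^- k * (C * 4 `^ (k%:R * sigma)) = C * 4 `^ (k%:R * s).
  rewrite mulrCA; congr (_ * _); rewrite -powR_mulrn ?(ltW rho0)// -powRN /rho -powRrM.
  rewrite -powRD ?pnatr_eq0 ?implybT//; congr (_ `^ _); ring.
have stepk k : (\int[mu]_x ((bumpN x)%:E * F k x) <=
    (C * 4 `^ s)%:E * \int[mu]_xi (weight s xi * shell_part k g xi ^+ 2)%:E)%E.
  rewrite (eq_integral (fun x => (rho ^- k)%:E * ((bumpN x)%:E * D_ k x))%E); last first.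
    by move=> x _; rewrite /F muleCA.
  rewrite ge0_integralZl//; first last.
  - by rewrite lee_fin ltW.
  - by move=> x _; exact: mule_ge0.
  - exact: emeasurable_funM.
  have [_ h] := D_P k.
  apply: le_trans (lee_wpmul2l _ h) _; first by rewrite lee_fin ltW.
  rewrite muleA -EFinM rhoE EFinM -muleA [in leRHS]EFinM -[leRHS]muleA.
  apply: lee_wpmul2l; first by rewrite lee_fin.
  rewrite /l2 -!ge0_integralZl//; first last.
  - by move=> x _; rewrite lee_fin sqr_ge0.
  - by apply: measurable_EFinT; exact: measurable_funX.
  apply: ge0_le_integral => //.
  - by move=> x _; rewrite mule_ge0// lee_fin ?powR_ge0 ?sqr_ge0.
  - by apply: measurable_funeM; apply: measurable_EFinT; exact: measurable_funX.
  - exact: measurable_funeM.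
  move=> xi _; rewrite -!EFinM lee_fin [leRHS]mulrA.
  have [h'|h'] := pselect (shell k xi); last by rewrite sa// expr0n !mulr0.
  by rewrite ler_wpM2r ?sqr_ge0// weight_shell.
rewrite (eq_integral (fun x => (1 - rho)^-1%:E * \sum_(k <oo) ((bumpN x)%:E * F k x))%E);
    last first.
  by move=> x _; rewrite /D muleCA nneseriesZl.
rewrite ge0_integralZl//; first last.
- by move=> x _; apply: nneseries_ge0 => k _ _; exact: mule_ge0.
- apply: ge0_emeasurable_sum => [k x _ _|k _]; first exact: mule_ge0.
  exact: emeasurable_funM.
rewrite -mulrA [in leRHS]EFinM -[leRHS]muleA; apply: lee_wpmul2l => //.
rewrite integral_nneseries//; first last.
- by move=> k x _; exact: mule_ge0.
- by move=> k; exact: emeasurable_funM.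
apply: (@le_trans _ _ (\sum_(k <oo) ((C * 4 `^ s)%:E *
    \int[mu]_xi (weight s xi * shell_part k g xi ^+ 2)%:E))%E).
  apply: lee_nneseries => [k _ _|k _]; last exact: stepk.
  by apply: integral_ge0 => x _; exact: mule_ge0.
rewrite nneseriesZl; last by move=> k _; apply: integral_ge0 => x _; exact: wa0.
apply: lee_wpmul2l; first by rewrite lee_fin mulr_ge0 ?powR_ge0.
rewrite -integral_nneseries//.
apply: ge0_le_integral => //.
- by move=> xi _; apply: nneseries_ge0 => k _ _; exact: wa0.
- by apply: ge0_emeasurable_sum => // k xi _ _; exact: wa0.
- by apply: measurable_EFinT; apply: measurable_funM => //; exact: measurable_funX.
(* The shells are disjoint: a partial sum of their indicators is the indicator of some [low n],
   hence at most 1. *)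
move=> xi _; apply: lime_le; first by apply: is_cvg_nneseries => k _ _; exact: wa0.
apply: nearW => n; rewrite big_mkord sumEFin lee_fin -mulr_sumr.
rewrite ler_wpM2l ?weight_ge0//.
under eq_bigr do rewrite shell_part_sq.
case: n => [|n]; first by rewrite big_ord0 sqr_ge0.
rewrite -mulr_suml -indic_low indicE.
by case: (_ \in _); rewrite /= ?mul1r// mul0r sqr_ge0.
Qed.

End maximal_real.

(** * Complex-valued functions and the extension to L^2 *)

Section complex_valued.
Context {R : realType} (N : nat) (eps : 'I_N -> bool).
Local Notation mu := (@lebesgueN R N).
Local Notation normc := ComplexField.Normc.normc.
Local Notation Re := (@complex.Re R).
Local Notation Im := (@complex.Im R).
Implicit Types (z w : R[i]) (f g h k u : Rn R N -> R[i]).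

Definition nrm2 z : R := Re z ^+ 2 + Im z ^+ 2.

Lemma nrm2_ge0 z : 0 <= nrm2 z.
Proof. by rewrite addr_ge0 ?sqr_ge0. Qed.

Lemma normc_sqr z : normc z ^+ 2 = nrm2 z.
Proof. by case: z => a b; rewrite /= sqr_sqrtr// addr_ge0 ?sqr_ge0. Qed.

Lemma normc_ge0R z : 0 <= normc z.
Proof. by case: z => a b; exact: sqrtr_ge0. Qed.

Lemma ReB z w : Re (z - w) = Re z - Re w. Proof. by case: z w => a b [c d]. Qed.
Lemma ImB z w : Im (z - w) = Im z - Im w. Proof. by case: z w => a b [c d]. Qed.

Lemma nrm2_subC z w : nrm2 (z - w) = nrm2 (w - z).
Proof. by rewrite /nrm2 !ReB !ImB; ring. Qed.

Lemma nrm2_sub_le z w v : nrm2 (z - v) <= 2 * (nrm2 (z - w) + nrm2 (w - v)).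
Proof.
rewrite /nrm2 !ReB !ImB; move: (Re z) (Re w) (Re v) (Im z) (Im w) (Im v) => a b c a' b' c'.
by have := sqr_ge0 (a - b - (b - c)); have := sqr_ge0 (a' - b' - (b' - c')); nra.
Qed.

Lemma nrm2_le z w : nrm2 z <= 2 * (nrm2 (z - w) + nrm2 w).
Proof.
have := nrm2_sub_le z w 0.
by rewrite /nrm2 !ReB !ImB/= !subr0.
Qed.

Lemma measurable_nrm2 f : measurable_fun setT (Re \o f) -> measurable_fun setT (Im \o f) ->
  measurable_fun setT (fun x => nrm2 (f x)).
Proof. by move=> mr mi; rewrite /nrm2; meas. Qed.

Lemma measurable_ReB f g : measurable_fun setT (Re \o f) -> measurable_fun setT (Re \o g) ->
  measurable_fun setT (Re \o (fun x => f x - g x)).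
Proof.
move=> mf mg; rewrite (_ : _ \o _ = (fun x => (Re \o f) x - (Re \o g) x)); first by meas.
by apply/funext => x /=; rewrite ReB.
Qed.

Lemma measurable_ImB f g : measurable_fun setT (Im \o f) -> measurable_fun setT (Im \o g) ->
  measurable_fun setT (Im \o (fun x => f x - g x)).
Proof.
move=> mf mg; rewrite (_ : _ \o _ = (fun x => (Im \o f) x - (Im \o g) x)); first by meas.
by apply/funext => x /=; rewrite ImB.
Qed.

Lemma L2norm_sqr f : (L2norm f `^ 2 = \int[mu]_x (nrm2 (f x))%:E)%E.
Proof.
rewrite /L2norm poweR_Lnorm//; apply: eq_integral => x _.
by rewrite /= ger0_norm ?normc_ge0R// powR_mulrn ?normc_ge0R// normc_sqr.
Qed.

Lemma L2norm_cvg0 (h : nat -> Rn R N -> R[i]) (e : R) : 0 < e ->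
  L2norm (h k) @[k --> \oo] --> 0%E ->
  \forall k \near \oo, (\int[mu]_x (nrm2 (h k x))%:E <= e%:E)%E.
Proof.
move=> e0 /fine_cvgP[fk /cvgr0Pnorm_lt /(_ (Num.sqrt e))].
rewrite sqrtr_gt0 => /(_ e0) nk; near=> k; rewrite -L2norm_sqr.
have fin : L2norm (h k) \is a fin_num by near: k.
have : `|fine (L2norm (h k))| < Num.sqrt e by near: k.
rewrite -(fineK fin) /= lee_fin ger0_norm ?fine_ge0 ?Lnorm_ge0// => lt.
rewrite powR_mulrn ?fine_ge0 ?Lnorm_ge0// -[leRHS]sqr_sqrtr ?(ltW e0)//.
by rewrite ler_pXn2r ?nnegrE ?sqrtr_ge0 ?fine_ge0 ?Lnorm_ge0// ltW.
Unshelve. all: by end_near. Qed.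

Lemma cLfun2_measurable f : cLfun 2%:E f ->
  measurable_fun setT (Re \o f) /\ measurable_fun setT (Im \o f).
Proof.
by rewrite /cLfun !inE => -[/andP[+ _] /andP[+ _]]; rewrite !inE/=.
Qed.

Lemma cLfun1_integrable f : cLfun 1%E f ->
  mu.-integrable setT (EFin \o (Re \o f)) /\ mu.-integrable setT (EFin \o (Im \o f)).
Proof. by move=> [/Lfun1_integrable hr /Lfun1_integrable hi]. Qed.

(** When no extension exists the value is the default [cst 0], which is in L^2 as well, so no case
    distinction is left to later proofs. *)
Lemma L2_extension_cLfun2 (T : (Rn R N -> R[i]) -> (Rn R N -> R[i])) f :
  cLfun 2%:E (L2_extension T f).
Proof.
rewrite /L2_extension; case: xgetP => [g _ []//|_].
have p12 : (1 <= 2%:E :> \bar R)%E by rewrite lee_fin ler1n.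
by split; exact: (Lfun_addr_closed mu p12).1.
Qed.

(* The signs are such that [phase eps] is convertible to [qphase sgn]. *)
Definition sgn (j : 'I_N) : R :=
  if j == 0%N :> nat then 1 else if j == 1%N :> nat then -1 else (-1) ^+ eps j.

Lemma normr_sgn j : `|sgn j| = 1.
Proof.
rewrite /sgn; case: ifP => _; first by rewrite normr1.
by case: ifP => _; rewrite ?normrN1// normrX normrN1 expr1n.
Qed.

Local Notation wave := (@wave R N sgn).
Local Notation th t x := (fun xi : Rn R N => dotp x xi + t * qphase sgn xi).

Lemma measurable_th (t : R) (x : Rn R N) : measurable_fun setT (th t x).
Proof.
have md : measurable_fun setT (@dotp R N x).
  exact: (measurable_fun2r x (@measurable_dotp R N)).
by have mq := measurable_qphase sgn; meas.
Qed.

Lemma schrodinger_integralE t h x :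
  mu.-integrable setT (EFin \o (Re \o h)) -> mu.-integrable setT (EFin \o (Im \o h)) ->
  schrodinger_integral eps t h x =
  Complex (fcos mu (th t x) (Re \o h) - fsin mu (th t x) (Im \o h))
          (fcos mu (th t x) (Im \o h) + fsin mu (th t x) (Re \o h)).
Proof.
move=> ir ii; have mth := measurable_th t x.
rewrite /schrodinger_integral /cintegral; congr Complex.
  rewrite /fcos /fsin -RintegralB//; [|exact: integrable_cosM|exact: integrable_sinM].
  by apply: eq_Rintegral => xi _ /=; case: (h xi).
rewrite /fcos /fsin -RintegralD//; [|exact: integrable_cosM|exact: integrable_sinM].
by apply: eq_Rintegral => xi _ /=; case: (h xi).
Qed.

Lemma nrm2_schrodinger_integral_le t h x :
  mu.-integrable setT (EFin \o (Re \o h)) -> mu.-integrable setT (EFin \o (Im \o h)) ->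
  nrm2 (schrodinger_integral eps t h x) <= 2 * (wave (Re \o h) t x + wave (Im \o h) t x).
Proof.
move=> ir ii; rewrite schrodinger_integralE// /nrm2 /= /wave /sq.
set p := fcos _ _ (Re \o h); set q := fsin _ _ (Im \o h).
set r := fcos _ _ (Im \o h); set s := fsin _ _ (Re \o h).
by have := sqr_ge0 (p + q); have := sqr_ge0 (r - s); nra.
Qed.

Lemma integrable_ReB f g : mu.-integrable setT (EFin \o (Re \o f)) ->
  mu.-integrable setT (EFin \o (Re \o g)) ->
  mu.-integrable setT (EFin \o (Re \o (fun x => f x - g x))).
Proof.
move=> i j; apply: eq_integrable (integrableB measurableT i j) => // x _ /=.
by rewrite ReB EFinB.
Qed.

Lemma integrable_ImB f g : mu.-integrable setT (EFin \o (Im \o f)) ->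
  mu.-integrable setT (EFin \o (Im \o g)) ->
  mu.-integrable setT (EFin \o (Im \o (fun x => f x - g x))).
Proof.
move=> i j; apply: eq_integrable (integrableB measurableT i j) => // x _ /=.
by rewrite ImB EFinB.
Qed.

Lemma schrodinger_integralB t h k x :
  mu.-integrable setT (EFin \o (Re \o h)) -> mu.-integrable setT (EFin \o (Im \o h)) ->
  mu.-integrable setT (EFin \o (Re \o k)) -> mu.-integrable setT (EFin \o (Im \o k)) ->
  schrodinger_integral eps t (fun xi => h xi - k xi) x =
  schrodinger_integral eps t h x - schrodinger_integral eps t k x.
Proof.
move=> hr hi kr ki; have mth := measurable_th t x.
rewrite !schrodinger_integralE//; [|exact: integrable_ReB|exact: integrable_ImB].
have cB p q r : mu.-integrable setT (EFin \o p) -> mu.-integrable setT (EFin \o q) ->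
    (forall xi, r xi = p xi - q xi) ->
    fcos mu (th t x) r = fcos mu (th t x) p - fcos mu (th t x) q.
  move=> ip iq e; rewrite /fcos -RintegralB//; [|exact: integrable_cosM..].
  by apply: eq_Rintegral => xi _; rewrite e mulrBr.
have sB p q r : mu.-integrable setT (EFin \o p) -> mu.-integrable setT (EFin \o q) ->
    (forall xi, r xi = p xi - q xi) ->
    fsin mu (th t x) r = fsin mu (th t x) p - fsin mu (th t x) q.
  move=> ip iq e; rewrite /fsin -RintegralB//; [|exact: integrable_sinM..].
  by apply: eq_Rintegral => xi _; rewrite e mulrBr.
have reB xi := ReB (h xi) (k xi); have imB xi := ImB (h xi) (k xi).
set hk := fun xi => h xi - k xi.
have e1 := cB _ _ (Re \o hk) hr kr reB; have e2 := cB _ _ (Im \o hk) hi ki imB.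
have e3 := sB _ _ (Re \o hk) hr kr reB; have e4 := sB _ _ (Im \o hk) hi ki imB.
rewrite e1 e2 e3 e4; move: (fcos _ _ _) (fcos _ _ _) (fcos _ _ _) (fcos _ _ _) (fsin _ _ _)
  (fsin _ _ _) (fsin _ _ _) (fsin _ _ _) => c1 c2 c3 c4 s1 s2 s3 s4.
by congr Complex => /=; ring.
Qed.

Lemma measurable_schrodinger_integral t h :
  mu.-integrable setT (EFin \o (Re \o h)) -> mu.-integrable setT (EFin \o (Im \o h)) ->
  measurable_fun setT (Re \o schrodinger_integral eps t h) /\
  measurable_fun setT (Im \o schrodinger_integral eps t h).
Proof.
move=> ir ii.
have /measurable_EFinP mr := measurable_int _ ir.
have /measurable_EFinP mi := measurable_int _ ii.
have md := @measurable_dotp R N; have mq := measurable_qphase sgn.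
have mth : measurable_fun setT
    (fun p : Rn R N * Rn R N => dotp p.1 p.2 + t * qphase sgn p.2) by meas.
have mc a : measurable_fun setT a -> measurable_fun setT (fun x => fcos mu (th t x) a).
  move=> ma; apply: (measurable_fcos mu (th := fun x xi => dotp x xi + t * qphase sgn xi)
    (a := fun _ : Rn R N => a)); by meas.
have ms a : measurable_fun setT a -> measurable_fun setT (fun x => fsin mu (th t x) a).
  move=> ma; apply: (measurable_fsin mu (th := fun x xi => dotp x xi + t * qphase sgn xi)
    (a := fun _ : Rn R N => a)); by meas.
split.
  rewrite (_ : _ \o _ = fun x => fcos mu (th t x) (Re \o h) - fsin mu (th t x) (Im \o h)).
    by apply: measurable_funB; [exact: mc|exact: ms].
  by apply/funext => x;
    rewrite -[LHS]/(Re (schrodinger_integral eps t h x)) schrodinger_integralE.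
rewrite (_ : _ \o _ = fun x => fcos mu (th t x) (Im \o h) + fsin mu (th t x) (Re \o h)).
  by apply: measurable_funD; [exact: mc|exact: ms].
by apply/funext => x;
  rewrite -[LHS]/(Im (schrodinger_integral eps t h x)) schrodinger_integralE.
Qed.

End complex_valued.

Section maximal_complex.
Context {R : realType} (N : nat) (eps : 'I_N -> bool).
Local Notation mu := (@lebesgueN R N).
Local Notation normc := ComplexField.Normc.normc.
Local Notation Re := (@complex.Re R).
Local Notation Im := (@complex.Im R).
Local Notation sg := (@sgn R N eps).
Local Notation wave := (@wave R N sg).
Implicit Types (g h u : Rn R N -> R[i]) (D : Rn R N -> \bar R).

Definition ctrunc m g (xi : Rn R N) : R[i] :=
  Complex (trunc m (Re \o g) xi) (trunc m (Im \o g) xi).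

Lemma integrable_ctrunc m g : cLfun 2%:E g ->
  mu.-integrable setT (EFin \o (Re \o ctrunc m g)) /\
  mu.-integrable setT (EFin \o (Im \o ctrunc m g)).
Proof.
move=> g2; have [mr mi] := cLfun2_measurable g2.
have [/Lfun2_integrable_sqr hr /Lfun2_integrable_sqr hi] := g2.
have l2fin a : mu.-integrable setT (EFin \o (fun x => a x ^+ 2)) -> (l2 a < +oo)%E.
  move=> /integrableP[_]; under eq_integral => x _ do rewrite /= ger0_norm ?sqr_ge0//.
  by [].
split.
  exact: (integrable_low (measurable_low m) (@subset_refl _ _) mr (l2fin _ hr)).
exact: (integrable_low (measurable_low m) (@subset_refl _ _) mi (l2fin _ hi)).
Qed.

(** Outside [low m] the weight is at least 4^(s m), so a finite H^s norm forces the truncations to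
    converge to [g] in L^2. *)
Lemma trunc_tail (s : R) m g : 0 <= s -> cLfun 2%:E g ->
  (((4 `^ s) ^+ m)%:E * (\int[mu]_xi (nrm2 (g xi - ctrunc m g xi))%:E)
  <= \int[mu]_xi (weight s xi * nrm2 (g xi))%:E)%E.
Proof.
move=> s0 g2; have [mr mi] := cLfun2_measurable g2.
have [/(measurable_int _)/measurable_EFinP kr /(measurable_int _)/measurable_EFinP ki] :=
  integrable_ctrunc m g2.
have mn := measurable_nrm2 (measurable_ReB mr kr) (measurable_ImB mi ki).
have mg := measurable_nrm2 mr mi; have mw := @measurable_weight R N s.
rewrite -ge0_integralZl//; first last.
- by move=> x _; rewrite lee_fin nrm2_ge0.
- exact: measurable_EFinT.
apply: ge0_le_integral => //.
- by move=> x _; rewrite -EFinM lee_fin mulr_ge0 ?nrm2_ge0// exprn_ge0// powR_ge0.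
- by apply: measurable_funeM; exact: measurable_EFinT.
- by apply: measurable_EFinT; exact: measurable_funM.
move=> xi _; rewrite -EFinM lee_fin /nrm2 ReB ImB /= /trunc indicE.
case: (boolP (xi \in low m)) => [_|/negP h] /=.
  by rewrite !mul1r !subrr expr0n addr0 mulr0 mulr_ge0 ?weight_ge0 ?nrm2_ge0.
rewrite !mul0r !subr0; apply: ler_wpM2r; first exact: nrm2_ge0.
rewrite -powR_mulrn ?powR_ge0// -powRrM mulrC powRrM powR_mulrn// /weight.
apply: ge0_ler_powR; rewrite ?nnegrE ?exprn_ge0 ?addr_ge0 ?sqnorm_ge0//.
have : 4 ^+ m <= sqnorm xi by rewrite leNgt; apply/negP => h'; apply: h; exact/mem_set.
by move=> /le_trans; apply; rewrite lerDr.
Qed.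

Lemma tnth_unit_ball (x : Rn R N) j : unit_ball x -> `|tnth x j : R| < 1.
Proof.
rewrite /unit_ball /= /sqnorm (bigD1 j)//= => h.
rewrite -(@ltr_pXn2r _ 2%N) ?nnegrE// real_normK ?num_real// expr1n.
apply: le_lt_trans h; rewrite lerDl; apply: sumr_ge0 => i _; exact: sqr_ge0.
Qed.

Lemma unit_ball_bumpN (x : Rn R N) : unit_ball x -> 1 <= bumpN x.
Proof.
move=> xB; apply: bumpN_ge1 => j.
by have := tnth_unit_ball j xB; rewrite ltr_norml => /andP[? ?]; apply/andP; split; lra.
Qed.

Lemma measurable_unit_ball : measurable (@unit_ball R N).
Proof. by have := @measurable_low R N 0; rewrite /low expr0. Qed.

(** Continuity from L^2 to weighted L^2 at a fixed time; applied to the difference of two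
    approximations of [g], it shows that they lead to the same limit on the ball. *)
Lemma schrodinger_integral_local : exists2 A : R, 0 <= A & forall t h,
  mu.-integrable setT (EFin \o (Re \o h)) -> mu.-integrable setT (EFin \o (Im \o h)) ->
  (\int[mu]_x (bumpN x * nrm2 (schrodinger_integral eps t h x))%:E <=
   A%:E * \int[mu]_xi (nrm2 (h xi))%:E)%E.
Proof.
have [A A0 P] := wave_fixed_time sg; exists (2 * A); first by rewrite mulr_ge0.
move=> t h ir ii; have [mr mi] := measurable_schrodinger_integral eps t ir ii.
have /measurable_EFinP mhr := measurable_int _ ir.
have /measurable_EFinP mhi := measurable_int _ ii.
have mn := measurable_nrm2 mr mi; have mb := @measurable_bumpN R N.
have mwr := measurable_wave1 sg t mhr.
have mwi := measurable_wave1 sg t mhi.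
have b0 (x : Rn R N) : 0 <= bumpN x := bumpN_ge0 x.
apply: (@le_trans _ _ (\int[mu]_x (2%:E * ((bumpN x * wave (Re \o h) t x)%:E +
    (bumpN x * wave (Im \o h) t x)%:E)))%E).
  apply: ge0_le_integral => //.
  - by move=> x _; rewrite lee_fin mulr_ge0// nrm2_ge0.
  - by meas.
  - by apply: measurable_funeM; apply: emeasurable_funD; meas.
  move=> x _; rewrite -EFinD -EFinM lee_fin -mulrDr mulrCA ler_wpM2l//.
  exact: nrm2_schrodinger_integral_le.
rewrite ge0_integralZl//; first last.
- by move=> x _; rewrite adde_ge0// lee_fin mulr_ge0// wave_ge0.
- by apply: emeasurable_funD; meas.
rewrite ge0_integralD//; first last.
- by meas.
- by move=> x _; rewrite lee_fin mulr_ge0// wave_ge0.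
- by meas.
- by move=> x _; rewrite lee_fin mulr_ge0// wave_ge0.
rewrite EFinM -muleA; apply: lee_wpmul2l; first by rewrite lee_fin.
apply: le_trans (leeD (P _ t ir) (P _ t ii)) _.
rewrite -ge0_muleDr ?l2_ge0//; apply: lee_wpmul2l; first by rewrite lee_fin.
rewrite /l2 -ge0_integralD//; try by move=> x _; rewrite lee_fin sqr_ge0.
  by apply: measurable_EFinT; apply: measurable_funX.
by apply: measurable_EFinT; apply: measurable_funX.
Qed.

(** The value [u] is reached along the sequence [h] hidden in the extension, while [D] controls the
    sequence [k]. Since both approximate [g], the fixed time bound makes their images close on the
    ball. The excess [F] of |u|^2 over 2 D then has arbitrarily small integral there, so it vanishes
    almost everywhere. *)
Lemma L2_extension_ae_le t g u (k : nat -> Rn R N -> R[i]) D :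
  is_L2_extension (schrodinger_integral eps t) g u ->
  (forall m, mu.-integrable setT (EFin \o (Re \o k m)) /\
    mu.-integrable setT (EFin \o (Im \o k m))) ->
  (forall e : R, 0 < e -> exists m, (\int[mu]_xi (nrm2 (g xi - k m xi))%:E <= e%:E)%E) ->
  measurable_fun setT D -> (forall x, 0 <= D x)%E ->
  (forall m x, (nrm2 (schrodinger_integral eps t (k m) x))%:E <= D x)%E ->
  {ae mu, forall x, unit_ball x -> ((nrm2 (u x))%:E <= 2%:E * D x)%E}.
Proof.
move=> [g2 u2 [h [h12 hg Shu]]] ik kg mD D0 kD.
have [A A0 P] := schrodinger_integral_local.
have [mur mui] := cLfun2_measurable u2.
have [mgr mgi] := cLfun2_measurable g2.
have mun := measurable_nrm2 mur mui.
pose F x := maxe 0%E ((nrm2 (u x))%:E - 2%:E * D x)%E.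
have mF : measurable_fun setT F.
  apply: measurable_maxe; first exact: measurable_cst.
  by apply: emeasurable_funB; [exact: measurable_EFinT|exact: measurable_funeM].
have mB := measurable_unit_ball.
have F0 x : (0 <= F x)%E by rewrite /F le_max lexx.
(* Two quasi-triangle inequalities give F <= 4 (a + b). The integral of [a] is at most e, and that
   of [b] at most A times the squared distance of [h j] and [k m], itself at most 4 e. *)
have small (e : R) : 0 < e -> (\int[mu]_(x in @unit_ball R N) F x <= ((4 + 16 * A) * e)%:E)%E.
  move=> e0.
  have [m km] := kg _ e0.
  have [j [hgj Shuj]] : exists j, (\int[mu]_x (nrm2 (h j x - g x))%:E <= e%:E)%E /\
      (\int[mu]_x (nrm2 (schrodinger_integral eps t (h j) x - u x))%:E <= e%:E)%E.
    have n1 := L2norm_cvg0 e0 hg; have n2 := L2norm_cvg0 e0 Shu.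
    have [j _ /(_ j (leqnn j)) [? ?]] := filterI n1 n2.
    by exists j.
  have [hr hi] := cLfun1_integrable (h12 j).1; have [kr ki] := ik m.
  have /measurable_EFinP mhr := measurable_int _ hr.
  have /measurable_EFinP mhi := measurable_int _ hi.
  have /measurable_EFinP mkr := measurable_int _ kr.
  have /measurable_EFinP mki := measurable_int _ ki.
  have [mShr mShi] := measurable_schrodinger_integral eps t hr hi.
  set hk := fun xi => h j xi - k m xi.
  have ihkr : mu.-integrable setT (EFin \o (Re \o hk)) := integrable_ReB hr kr.
  have ihki : mu.-integrable setT (EFin \o (Im \o hk)) := integrable_ImB hi ki.
  have [mShkr mShki] := measurable_schrodinger_integral eps t ihkr ihki.
  have mn1 := measurable_nrm2 (measurable_ReB mShr mur) (measurable_ImB mShi mui).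
  have mn2 := measurable_nrm2 mShkr mShki.
  have mb := @measurable_bumpN R N.
  have b0 (x : Rn R N) : 0 <= bumpN x := bumpN_ge0 x.
  pose a x := nrm2 (schrodinger_integral eps t (h j) x - u x).
  pose b x := bumpN x * nrm2 (schrodinger_integral eps t hk x).
  have ma : measurable_fun setT a by [].
  have mbb : measurable_fun setT b by rewrite /b; meas.
  have a0 x : 0 <= a x := nrm2_ge0 _.
  have bb0 x : 0 <= b x by rewrite mulr_ge0// nrm2_ge0.
  have ptw x : unit_ball x -> (F x <= 4%:E * ((a x)%:E + (b x)%:E))%E.
    move=> xB; rewrite /F ge_max -EFinD -EFinM lee_fin mulr_ge0 ?(addr_ge0 (a0 x) (bb0 x))//=.
    have := kD m x; have := D0 x; case: (D x) => [d| |] //= d0 kd; last first.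
      by rewrite gt0_muley ?lte_fin// leNye.
    rewrite -?EFinM -?EFinB lee_fin; move: kd; rewrite !lee_fin => kd.
    have e1 := nrm2_le (u x) (schrodinger_integral eps t (k m) x).
    have e2 := nrm2_sub_le (u x) (schrodinger_integral eps t (h j) x)
      (schrodinger_integral eps t (k m) x).
    rewrite [nrm2 (u x - schrodinger_integral eps t (h j) x)]nrm2_subC -/(a x) in e2.
    rewrite -schrodinger_integralB// -/hk in e2.
    have e3 : nrm2 (schrodinger_integral eps t hk x) <= b x.
      by rewrite /b ler_peMl ?nrm2_ge0// unit_ball_bumpN.
    by lra.
  apply: (@le_trans _ _ (\int[mu]_x (4%:E * ((a x)%:E + (b x)%:E)))%E).
    apply: (@le_trans _ _ (\int[mu]_(x in @unit_ball R N) (4%:E * ((a x)%:E + (b x)%:E)))%E).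
      apply: ge0_le_integral => //.
      - exact: measurable_funTS.
      - apply: measurable_funTS; apply: measurable_funeM; apply: emeasurable_funD; meas.
    apply: ge0_subset_integral => //.
    - by apply: measurable_funeM; apply: emeasurable_funD; meas.
    - by move=> x _; rewrite mule_ge0// adde_ge0// lee_fin.
  rewrite ge0_integralZl//; first last.
  - by move=> x _; rewrite adde_ge0// lee_fin.
  - by apply: emeasurable_funD; meas.
  rewrite ge0_integralD//; first last.
  - by meas.
  - by move=> x _; rewrite lee_fin.
  - by meas.
  - by move=> x _; rewrite lee_fin.
  have mn3 := measurable_nrm2 (measurable_ReB mhr mgr) (measurable_ImB mhi mgi).
  have mn4 := measurable_nrm2 (measurable_ReB mgr mkr) (measurable_ImB mgi mki).
  have mn5 := measurable_nrm2 (measurable_ReB mhr mkr) (measurable_ImB mhi mki).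
  have hke : (\int[mu]_x (nrm2 (hk x))%:E <= (4 * e)%:E)%E.
    apply: (@le_trans _ _ (\int[mu]_x (2%:E * ((nrm2 (h j x - g x))%:E +
       (nrm2 (g x - k m x))%:E)))%E).
      apply: ge0_le_integral => //.
      - by move=> x _; rewrite lee_fin nrm2_ge0.
      - exact: measurable_EFinT.
      - by apply: measurable_funeM; apply: emeasurable_funD; exact: measurable_EFinT.
      by move=> x _; rewrite -EFinD -EFinM lee_fin nrm2_sub_le.
    rewrite ge0_integralZl//; first last.
    - by move=> x _; rewrite adde_ge0// lee_fin nrm2_ge0.
    - by apply: emeasurable_funD; exact: measurable_EFinT.
    rewrite ge0_integralD//; first last.
    - exact: measurable_EFinT.
    - by move=> x _; rewrite lee_fin nrm2_ge0.
    - exact: measurable_EFinT.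
    - by move=> x _; rewrite lee_fin nrm2_ge0.
    rewrite (_ : (4 * e)%:E = 2%:E * (e%:E + e%:E))%E; last first.
      by rewrite -EFinD -EFinM; congr EFin; ring.
    by apply: lee_wpmul2l; [rewrite lee_fin|exact: leeD].
  have h1 : (\int[mu]_x (b x)%:E <= (A * (4 * e))%:E)%E.
    apply: le_trans (P t hk ihkr ihki) _; rewrite EFinM.
    by apply: lee_wpmul2l; rewrite ?lee_fin.
  rewrite (_ : ((4 + 16 * A) * e)%:E = 4%:E * (e%:E + (A * (4 * e))%:E))%E; last first.
    by rewrite -EFinD -EFinM; congr EFin; ring.
  by apply: lee_wpmul2l; [rewrite lee_fin|exact: leeD].
have int0 : (\int[mu]_(x in @unit_ball R N) `|F x| = 0)%E.
  under eq_integral => x _ do rewrite gee0_abs//.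
  apply/eqP; rewrite eq_le integral_ge0// andbT; apply/lee_addgt0Pr => e e0; rewrite add0e.
  have c0 : 0 < 4 + 16 * A by rewrite ltr_pwDl// mulr_ge0.
  have := small (e / (4 + 16 * A)) (divr_gt0 e0 c0).
  by rewrite mulrC divfK// gt_eqF.
have mFB : measurable_fun (@unit_ball R N) F by exact: measurable_funTS.
have /(ae_eq_integral_abs mu mB mFB) := int0.
apply: filterS => x /= h' xB; have := h' xB; rewrite /F.
move/eqP; rewrite eq_le => /andP[+ _]; rewrite ge_max lexx /= => le0.
have [Dx|Dx] := eqVneq (D x) +oo%E; first by rewrite Dx gt0_muley ?lte_fin// leey.
have := D0 x; move: le0 Dx; case: (D x) => [d| |] //= + _ _.
by rewrite -?EFinM -?EFinB !lee_fin subr_le0.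
Qed.

End maximal_complex.

(** * From squared majorants to the Sobolev norm *)

Lemma poweR2K {R : realType} (x : \bar R) : (0 <= x)%E -> ((x `^ 2) `^ 2^-1 = x)%E.
Proof. by move=> x0; rewrite -poweRrM divff// poweRe1. Qed.

Lemma lee_poweR {R : realType} (r : R) (x y : \bar R) : 0 <= r -> (0 <= x)%E -> (x <= y)%E ->
  (x `^ r <= y `^ r)%E.
Proof.
move=> r0 x0 xy; apply: (gt0_ler_poweR r0) => //; rewrite in_itv/= leey andbT//.
exact: le_trans xy.
Qed.

Section sobolev_bound.
Context {R : realType} (N : nat) (eps : 'I_N -> bool).
Local Notation mu := (@lebesgueN R N).
Local Notation normc := ComplexField.Normc.normc.
Local Notation Re := (@complex.Re R).
Local Notation Im := (@complex.Im R).
Local Notation sg := (@sgn R N eps).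
Local Notation wave := (@wave R N sg).

Lemma sobolev_norm_sqr (s : R) (f : Rn R N -> R[i]) :
  (sobolev_norm s f `^ 2 = \int[mu]_xi (weight s xi * nrm2 (fourier f xi))%:E)%E.
Proof.
rewrite /sobolev_norm poweR_Lnorm//; apply: eq_integral => xi _.
have n0 : 0 <= (1 + sqnorm xi) `^ (s / 2) * normc (fourier f xi).
  by rewrite mulr_ge0 ?powR_ge0 ?normc_ge0R.
rewrite /= ger0_norm// powR_mulrn// exprMn normc_sqr -powR_mulrn ?powR_ge0// -powRrM.
by rewrite divfK.
Qed.

Lemma nrm2_maximal_le (u : nat -> Rn R N -> R[i]) (x : Rn R N) (D : \bar R) : (0 <= D)%E ->
  (forall n, ((nrm2 (u n x))%:E <= D)%E) -> (maximal u x `^ 2 <= D)%E.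
Proof.
move=> D0 h.
have m0 : (0 <= maximal u x)%E.
  by apply: le_ereal_sup_tmp; exists (normc (u 0%N x))%:E;
    [exists 0%N|rewrite lee_fin normc_ge0R].
have : (maximal u x <= D `^ 2^-1)%E.
  apply: ge_ereal_sup => _ [n _ <-].
  rewrite -[leLHS]poweR2K ?lee_fin ?normc_ge0R//.
  apply: lee_poweR; rewrite ?invr_ge0// ?poweR_ge0//.
  by rewrite poweR_EFin powR_mulrn ?normc_ge0R// normc_sqr.
move=> /(lee_poweR (ler0n R 2) m0) /le_trans; apply.
by rewrite -poweRrM mulVf// poweRe1.
Qed.

Lemma measurable_maximal (u : nat -> Rn R N -> R[i]) :
  (forall n, measurable_fun setT (Re \o u n) /\ measurable_fun setT (Im \o u n)) ->
  measurable_fun setT (maximal u).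
Proof.
move=> mu_; rewrite (_ : maximal u =
    fun x => esups ((fun n y => (normc (u n y))%:E) ^~ x) 0%N).
  apply: measurable_fun_esups => n; apply: measurable_EFinT.
  have [mr mi] := mu_ n; have mn := measurable_nrm2 mr mi.
  rewrite (_ : (fun y => _) = (fun y => Num.sqrt (nrm2 (u n y)))).
    by apply: (measurableT_comp _ mn);
      apply: continuous_measurable_fun; exact: sqrt_continuous.
  by apply/funext => y; rewrite /nrm2; case: (u n y).
apply/funext => x; rewrite /maximal /esups /sdrop /=; congr ereal_sup.
by apply/seteqP; split=> _ [n _ <-]; exists n.
Qed.

Lemma maximal_sobolev (T : set R) (t : nat -> R) (C sigma s : R) :
  (forall n, T (t n)) -> 0 <= C -> 0 <= sigma -> sigma < s ->
  (forall k a, mu.-integrable setT (EFin \o a) ->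
    (forall xi, ~ shell k xi -> a xi = 0) ->
    exists D, dominates sg T a D /\
      (\int[mu]_x ((bumpN x)%:E * D x) <= (C * 4 `^ (k%:R * sigma))%:E * l2 a)%E) ->
  exists C' : R, forall f : Rn R N -> R[i], sobolev s f ->
    (Lnorm mu 2%:E (maximal (fun n => schrodinger eps (t n) f) \_ unit_ball)
     <= C'%:E * sobolev_norm s f)%E.
Proof.
move=> tT C0 sigma0 sigma_s piece.
have s0 : 0 < s := le_lt_trans sigma0 sigma_s.
have [C' C'0 P] := maximal_real C0 (ltW s0) sigma_s piece.
(* One factor 2 comes from splitting [g] into real and imaginary part, the other from the passage to
   the L^2 limit. *)
exists (Num.sqrt (4 * C')) => f [_ fs].
set g := fourier f.
have g2 : cLfun 2%:E g := L2_extension_cLfun2 _ _.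
have [mr mi] := cLfun2_measurable g2.
have [/Lfun2_integrable_sqr hr /Lfun2_integrable_sqr hi] := g2.
have l2fin a : mu.-integrable setT (EFin \o (fun x => a x ^+ 2)) -> (l2 a < +oo)%E.
  move=> /integrableP[_]; under eq_integral => x _ do rewrite /= ger0_norm ?sqr_ge0//.
  by [].
have [Da [mDa Da0 Daw Dai]] := P _ mr (l2fin _ hr).
have [Db [mDb Db0 Dbw Dbi]] := P _ mi (l2fin _ hi).
pose D x := (2%:E * (Da x + Db x))%E.
have mD : measurable_fun setT D by apply: measurable_funeM; exact: emeasurable_funD.
have D0 x : (0 <= D x)%E by rewrite mule_ge0// adde_ge0.
set u := fun n => schrodinger eps (t n) f.
have u2 n : cLfun 2%:E (u n) := L2_extension_cLfun2 _ _.
set X := sobolev_norm s f in fs *.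
have X0 : (0 <= X)%E by exact: Lnorm_ge0.
have Xf : X \is a fin_num by rewrite ge0_fin_numE.
have X2 : (X `^ 2 = \int[mu]_xi (weight s xi * nrm2 (g xi))%:E)%E by exact: sobolev_norm_sqr.
have ae1 n : {ae mu, forall x, unit_ball x -> ((nrm2 (u n x))%:E <= 2%:E * D x)%E}.
  (* Where [xget] falls back on the default 0 the bound is immediate; otherwise the value is a
     genuine extension. *)
  rewrite /u /schrodinger /L2_extension; case: xgetP => [v _ /= ev|_]; last first.
    by apply: aeW => x _; rewrite /nrm2 /= expr0n addr0 mule_ge0.
  apply: (L2_extension_ae_le (k := fun m => ctrunc m g) ev) => //.
  - by move=> m; exact: integrable_ctrunc.
  - move=> e e0.
    have q1 : 1 < 4 `^ s.
      have := @gt0_ltr_powR R s s0 1 4; rewrite powR1 !nnegrE; apply; rewrite ?ltr1n//.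
    have q0 : 0 < 4 `^ s by rewrite powR_gt0.
    (* Here s > 0 enters: the tail bound of [trunc_tail] decays geometrically in [m]. *)
    have [m] : exists m, fine (X `^ 2)%E * ((4 `^ s)^-1) ^+ m <= e.
      have : (fine (X `^ 2)%E * ((4 `^ s)^-1) ^+ m) @[m --> \oo] --> fine (X `^ 2)%E * 0.
        apply: cvgMr; apply: cvg_expr; rewrite ger0_norm ?invr_ge0 ?(ltW q0)//.
        by rewrite invf_lt1.
      rewrite mulr0 => /cvgr0Pnorm_le /(_ _ e0) [m _ /(_ m (leqnn m)) /= h].
      by exists m; apply: le_trans (ler_norm _) h.
    move=> hm; exists m.
    have := trunc_tail m (ltW s0) g2; rewrite -X2 => h.
    have Q : 0 < (4 `^ s) ^+ m by rewrite exprn_gt0.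
    rewrite -(lee_pmul2l _ (_ : 0 < ((4 `^ s) ^+ m)%:E)%E) ?lte_fin//.
    apply: le_trans h _; rewrite -[leLHS]fineK ?fin_num_poweR// -EFinM lee_fin.
    by rewrite mulrC -ler_pdivrMr// -exprVn.
  - move=> m x.
    have [kr ki] := integrable_ctrunc m g2.
    apply: le_trans (_ : (2 * (wave (trunc m (Re \o g)) (t n) x +
       wave (trunc m (Im \o g)) (t n) x))%:E <= _)%E.
      by rewrite lee_fin; exact: nrm2_schrodinger_integral_le.
    rewrite /D EFinM; apply: lee_wpmul2l; first by rewrite lee_fin.
    rewrite EFinD.
    by apply: leeD; [exact: Daw|exact: Dbw].
(* The majorant [D] does not depend on [n], so countably many null sets are discarded at once and
   the supremum obeys the same bound. *)
have aeall : {ae mu, forall x, unit_ball x -> (maximal u x `^ 2 <= 2%:E * D x)%E}.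
  apply: filterS (ae_foralln ae1) => x h xB.
  by apply: nrm2_maximal_le => [|n]; [rewrite mule_ge0|exact: h].
set M := maximal u \_ unit_ball.
have mM : measurable_fun setT M.
  apply: (iffLR (measurable_restrictT (maximal u) (@measurable_unit_ball R N))).
  apply: measurable_funTS.
  by apply: measurable_maximal => n; exact: cLfun2_measurable.
have mb := @measurable_bumpN R N.
have mbE : measurable_fun setT (fun x : Rn R N => (bumpN x)%:E) by exact: measurable_EFinT.
have b0 (x : Rn R N) : (0 <= (bumpN x)%:E)%E by rewrite lee_fin bumpN_ge0.
have mw := @measurable_weight R N s.
have mwr : measurable_fun setT (fun xi => weight s xi * (Re \o g) xi ^+ 2).
  by apply: measurable_funM => //; exact: measurable_funX.
have mwi : measurable_fun setT (fun xi => weight s xi * (Im \o g) xi ^+ 2).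
  by apply: measurable_funM => //; exact: measurable_funX.
have bound : (Lnorm mu 2%:E M `^ 2 <= (4 * C')%:E * X `^ 2)%E.
  rewrite poweR_Lnorm//.
  apply: (@le_trans _ _ (\int[mu]_x (4%:E * ((bumpN x)%:E * Da x + (bumpN x)%:E * Db x)))%E).
    apply: ae_ge0_le_integral => //.
    - by move=> x _; exact: poweR_ge0.
    - apply: (measurableT_comp (measurable_poweR 2)); exact: measurableT_comp.
    - by move=> x _; rewrite mule_ge0// adde_ge0// mule_ge0.
    - by apply: measurable_funeM; apply: emeasurable_funD; exact: emeasurable_funM.
    apply: filterS aeall => x h _; rewrite /M patchE; case: ifPn => [/set_mem xB|_]; last first.
      by rewrite abse0 poweR0r// mule_ge0// adde_ge0// mule_ge0.
    rewrite gee0_abs; last first.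
      apply: le_ereal_sup_tmp; exists (normc (u 0%N x))%:E; first by exists 0%N.
      by rewrite lee_fin normc_ge0R.
    apply: le_trans (h xB) _.
    rewrite /D muleA -EFinM (_ : 2 * 2 = 4 :> R); last by ring.
    apply: lee_wpmul2l; first by rewrite lee_fin.
    rewrite -ge0_muleDr//; apply: (@le_trans _ _ (1%:E * (Da x + Db x)))%E; first by rewrite mul1e.
    by apply: lee_wpmul2r; [rewrite adde_ge0|rewrite lee_fin unit_ball_bumpN].
  rewrite ge0_integralZl//; first last.
  - by move=> x _; rewrite adde_ge0// mule_ge0.
  - by apply: emeasurable_funD; exact: emeasurable_funM.
  rewrite ge0_integralD//; first last.
  - exact: emeasurable_funM.
  - by move=> x _; rewrite mule_ge0.
  - exact: emeasurable_funM.
  - by move=> x _; rewrite mule_ge0.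
  rewrite EFinM -muleA; apply: lee_wpmul2l; first by rewrite lee_fin.
  apply: le_trans (leeD Dai Dbi) _.
  have pos (a : Rn R N -> R) x : (0 <= (weight s x * a x ^+ 2)%:E)%E.
    by rewrite lee_fin mulr_ge0 ?sqr_ge0 ?weight_ge0.
  rewrite -ge0_muleDr; [|by apply: integral_ge0 => x _; exact: pos..].
  apply: lee_wpmul2l; first by rewrite lee_fin.
  rewrite X2 -ge0_integralD//; try by move=> x _; exact: pos.
  - by rewrite le_eqVlt; apply/orP; left; apply/eqP; apply: eq_integral => x _;
      rewrite -EFinD -mulrDr.
  - exact: measurable_EFinT mwr.
  - exact: measurable_EFinT mwi.
rewrite -[leLHS]poweR2K ?Lnorm_ge0//.
have c0 : 0 <= 4 * C' by rewrite mulr_ge0.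
apply: (le_trans (lee_poweR _ (poweR_ge0 _ _) bound)); first by rewrite invr_ge0.
rewrite poweRM ?poweR_ge0 ?lee_fin// poweR2K//.
by apply: lee_wpmul2r => //; rewrite poweR_EFin lee_fin powR12_sqrt.
Qed.

End sobolev_bound.

Theorem theorem1p9 (R : realType) (N : nat) (eps : 'I_N -> bool) (r : R)
    (t : nat -> R) (s : R) :
  (2 <= N)%N ->
  0 < r ->
  (forall n, 0 < t n < 1) ->
  nonincreasing_seq t ->
  t @ \oo --> (0 : R) ->
  weak_lr r t ->
  Num.min (r / (r + 1)) (1 / 2) < s ->
  exists C : R, forall f : Rn R N -> R[i], sobolev s f ->
    (Lnorm (lebesgueN N) 2%:E
       (maximal (fun n => schrodinger eps (t n) f) \_ unit_ball)
     <= C%:E * sobolev_norm s f)%E.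
Proof.
move=> _ r0 t01 tni tcv tw; rewrite gt_min => /orP[rs|hs].
  have [C C0 P] := maximal_piece_weak_lr (@normr_sgn R N eps) r0 t01 tni tcv tw.
  apply: (maximal_sobolev _ C0 _ rs P); first by move=> n; exists n.
  by rewrite divr_ge0// ?addr_ge0// ltW.
have [C C0 P] := maximal_piece_half_powR (@normr_sgn R N eps).
by apply: (maximal_sobolev t01 C0 _ hs P); rewrite divr_ge0.
Qed.
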